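(* Let $g\in BV(\mathbb T)\setminus H^{\frac12+}(\mathbb T)$ be real valued, where $\mathbb T=\mathbb R/(2\pi\mathbb Z)$. Let $u$ be the solution of the KdV equation $u_t+u_{xxx}+uu_x=0$, $t\in\mathbb R$, $x\in\mathbb T$, with $u(0,\cdot)=g$. Then for a.e. $t$, the fractal dimension of the graph (as a function of $x$) of both $e^{-t\partial_{xxx}}g$ and $u(t,\cdot)$ is at least $\frac32$.
   Context: $BV(\mathbb T)$ is the set of functions of bounded variation on $\mathbb T$, and $H^{\frac12+}(\mathbb T)=\bigcup_{s>1/2}H^s(\mathbb T)$. $e^{-t\partial_{xxx}}g=\sum_n\widehat g(n)e^{itn^3+inx}$ is the solution of the Airy equation $q_t+q_{xxx}=0$ with data $g$. The KdV solution is the unique global one given by the $L^2(\mathbb T)$ well-posedness theory (Bourgain). For a.e. $t$ both functions have continuous representatives in $x$, to which the graph statement refers. The fractal (upper box-counting) dimension of a bounded set $E$ is $\limsup_{\epsilon\to0}\frac{\log\mathcal N(E,\epsilon)}{\log(1/\epsilon)}$, with $\mathcal N(E,\epsilon)$ the minimum number of $\epsilon$-balls needed to cover $E$. *)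

(* Defs.v *)
From mathcomp Require Import all_boot all_order all_algebra.
From mathcomp Require Import complex.
From mathcomp Require Import all_classical all_reals all_analysis.

Set Implicit Arguments.
Unset Strict Implicit.
Unset Printing Implicit Defensive.
Import Order.TTheory GRing.Theory Num.Theory.
Import numFieldNormedType.Exports.

Local Open Scope classical_set_scope.
Local Open Scope ring_scope.
Local Open Scope complex_scope.

(** Functions on T = R/(2 pi Z) are 2 pi-periodic functions on R; integrals
    over T are Lebesgue integrals over [torus_dom], one full period. *)

Definition torus_dom {R : realType} : set R := `[0, 2 * pi].

Definition torus_fun (R : realType) (f : R -> R) : Prop := periodic f (2 * pi).

Definition BV_torus (R : realType) (f : R -> R) : Prop :=
  torus_fun f /\ bounded_variation 0 (2 * pi) f.

Definition L2_torus (R : realType) (f : R -> R) : Prop :=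
  [/\ torus_fun f, measurable_fun setT f &
      (\int[@lebesgue_measure R]_(x in torus_dom) (f x ^+ 2)%:E < +oo)%E].

Definition cabs (R : realType) (z : R[i]) : R := ComplexField.Normc.normc z.

Definition expi (R : realType) (theta : R) : R[i] := cos theta +i* sin theta.

Definition cintegral (R : realType) (D : set R) (f : R -> R[i]) : R[i] :=
  (\int[@lebesgue_measure R]_(x in D) complex.Re (f x)) +i*
  (\int[@lebesgue_measure R]_(x in D) complex.Im (f x)).

Definition fourier_coef (R : realType) (f : R -> R) (n : int) : R[i] :=
  ((2 * pi)^-1)%:C *
  cintegral torus_dom (fun x => (f x)%:C * expi (- (n%:~R * x))).

Definition in_sobolev (R : realType) (s : R) (f : R -> R) : Prop :=
  L2_torus f /\
  (\esum_(n in [set: int])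
     ((1 + (n%:~R : R) ^+ 2) `^ s * cabs (fourier_coef f n) ^+ 2)%:E
   < +oo)%E.

Definition in_sobolev_half_plus (R : realType) (f : R -> R) : Prop :=
  exists2 s : R, 2^-1 < s & in_sobolev s f.

(** The partial sum over |n| <= N of the series for exp(-t d_xxx) g. *)
Definition airy_partial (R : realType) (g : R -> R) (t : R) (N : nat) (x : R)
    : R[i] :=
  \sum_(k < N.*2.+1) let n : int := k%:Z - N%:Z in
    fourier_coef g n * expi (t * n%:~R ^+ 3 + n%:~R * x).

(** [w] is the sum in L^2(T) of the series for exp(-t d_xxx) g; this determines
    [w] up to a null set. *)
Definition is_airy (R : realType) (g : R -> R) (t : R) (w : R -> R) : Prop :=
  L2_torus w /\
  (\int[@lebesgue_measure R]_(x in torus_dom)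
     (cabs (airy_partial g t N x - (w x)%:C) ^+ 2)%:E)%E
    @[N --> \oo] --> 0%E.

Definition torus_test (R : realType) (phi : R -> R) : Prop :=
  torus_fun phi /\ forall (k : nat) (x : R), derivable (derive1n k phi) x 1.

(** The equation u_t + u_xxx + u u_x = 0 in the sense of distributions, in the
    form appropriate to u in C(R; L^2(T)): pairing with a test function in x and
    moving all x-derivatives onto it, with u u_x = (u^2 / 2)_x. *)
Definition weak_kdv (R : realType) (u : R -> R -> R) : Prop :=
  forall phi : R -> R, torus_test phi -> forall t : R,
    is_derive t 1
      (fun s : R =>
         (\int[@lebesgue_measure R]_(x in torus_dom) (u s x * phi x) : R))
      (\int[@lebesgue_measure R]_(x in torus_dom)
         (u t x * derive1n 3 phi x + 2^-1 * u t x ^+ 2 * derive1 phi x)).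

Definition continuous_L2 (R : realType) (u : R -> R -> R) : Prop :=
  forall t : R,
    (\int[@lebesgue_measure R]_(x in torus_dom) ((u s x - u t x) ^+ 2)%:E)%E
      @[s --> t] --> 0%E.

(** On every [-T, T], [u] coincides with a function whose space-time Fourier
    transform F satisfies
      sum_n int <tau - n^3 + m n> |F_n(tau)|^2 dtau < oo,
      sum_n (int |F_n(tau)| dtau)^2 < oo.
    For m = 0 this is membership in the time-restricted Bourgain space at the
    L^2 level (X^{0,1/2} together with the l^2_n L^1_tau component).
    In general, with m the conserved mean of [u], it is the same condition on
    u(t, x + m t) - m, the mean-zero solution to which Bourgain's theory
    applies; the translation by m t shifts the frequency tau by m n. *)
Definition bourgain_class (R : realType) (m : R) (u : R -> R -> R) : Prop :=
  forall T : R, 0 < T -> exists F : int -> R -> R[i],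
    [/\ forall n, measurable_fun setT (fun tau => complex.Re (F n tau)) /\
                  measurable_fun setT (fun tau => complex.Im (F n tau)),
        (\esum_(n in [set: int])
           \int[@lebesgue_measure R]_tau
             ((1 + `|tau - n%:~R ^+ 3 + m * n%:~R|) * cabs (F n tau) ^+ 2)%:E
         < +oo)%E,
        (\esum_(n in [set: int])
           (\int[@lebesgue_measure R]_tau (cabs (F n tau))%:E) ^+ 2 < +oo)%E
      & forall (t : R) (n : int), - T <= t <= T ->
          fourier_coef (u t) n
          = cintegral setT (fun tau => expi (t * tau) * F n tau)].

Definition torus_mean (R : realType) (f : R -> R) : R :=
  (2 * pi)^-1 * \int[@lebesgue_measure R]_(x in torus_dom) f x.

(** [u t x] is the global solution with data [g] of the L^2(T) theory: the
    distributional solution in C(R; L^2(T)) and in the class in which Bourgain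
    constructs it. *)
Record kdv_solution (R : realType) (g : R -> R) (u : R -> R -> R) : Prop := {
  kdv_L2 : forall t : R, L2_torus (u t);
  kdv_continuous : continuous_L2 u;
  kdv_initial : {ae @lebesgue_measure R, forall x : R, u 0 x = g x};
  kdv_equation : weak_kdv u;
  kdv_bourgain : bourgain_class (torus_mean g) u
}.

Definition graph_torus (R : realType) (v : R -> R) : set (R * R) :=
  [set p | torus_dom p.1 /\ p.2 = v p.1].

Definition disc (R : realType) (c : R * R) (eps : R) : set (R * R) :=
  [set p | Num.sqrt ((p.1 - c.1) ^+ 2 + (p.2 - c.2) ^+ 2) < eps].

(** The infimum is attained unless no finite cover exists, when it is +oo. *)
Definition covering_number (R : realType) (E : set (R * R)) (eps : R) : \bar R :=
  ereal_inf [set (n%:R : R)%:E | n in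
    [set n : nat | exists c : nat -> R * R,
       E `<=` \bigcup_(i in `I_n) disc (c i) eps]].

Definition upper_box_dim (R : realType) (E : set (R * R)) : \bar R :=
  limf_esup (fun eps : R =>
    (lne (covering_number E eps) * ((ln eps^-1)^-1)%:E)%E) (0 : R)^'+.

Definition continuous_torus (R : realType) (v : R -> R) : Prop :=
  torus_fun v /\ continuous v.

(* Main.v *)
Require Import Defs.
From mathcomp Require Import all_boot all_order all_algebra.
From mathcomp Require Import complex ring lra zify.
From mathcomp Require Import all_classical all_reals all_analysis measurable_realfun.
Set Implicit Arguments.
Unset Strict Implicit.
Unset Printing Implicit Defensive.
Import Order.TTheory GRing.Theory Num.Theory.
Import numFieldNormedType.Exports.
Local Open Scope classical_set_scope.
Local Open Scope ring_scope.
Local Open Scope complex_scope.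

(** If the graph of a continuous [v] had upper box dimension below 3/2, counting discs
    would give [int |v (x + h) - v x| dx <= C * h ^ (1/2 + s)] with [s > 0]. Pair the
    increment with a dyadic block [q] of the Fourier series of [v], [h] being the inverse
    of the frequency: the coefficients are O(1/|n|), so [|v (x + h) - v x|_2^2 <= C * h],
    and if in addition [int q ^ 4] is, up to logarithms, as small as the square of
    [int q ^ 2] may be, then interpolation forces [int q ^ 2 <= C * h ^ (1 + s/2)] up to
    logarithms, that is, H^(1/2+) regularity.

    The bound on [int q ^ 4] holds for the Airy flow of a BV function at almost every
    time, because its average over a time period only sees the solutions of
    [n1 + n2 = n3 + n4], [n1^3 + n2^3 = n3^3 + n4^3], which are trivial unless
    [n1 + n2 = 0]. It also yields uniform convergence of the dyadic partial sums, hence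
    the continuous representative; Airy coefficients have constant modulus, so H^(1/2+)
    regularity would pass to [g].

    For KdV, two normal form transformations (integrations by parts in time) show that
    the coefficients of [u t] differ from those of the Airy flow, translated by the mean,
    by O(|n| ^ (- 5/4)): first with weight 1, which uses only [u] in C(R; L^2), giving
    O(1/|n|), and then with weight [|n| ^ (1/4)]. Such a perturbation is harmless in the
    argument above. *)

(** * Complex numbers and sums over integer intervals *)

(** The exceptional times depend on [g] alone: the fourth moment bound is proved for the Airy flow
    of [g] and does not see translations in [x], so it serves the main part of the KdV solution as
    well. The obstacle in the normal form is that for a solution merely continuous in time with
    values in L^2 the infinite sums of the boundary terms cannot be differentiated term by term. All
    sums are therefore cut to [|n| <= L]. The truncated equation then has an error that tends to 0
    uniformly on compact time intervals, by L^2 continuity, and the resonant cubic terms, which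
    cancel by oddness, keep a defect coming from frequencies close to [L]. Both disappear when [L]
    tends to infinity with [n] fixed. The first pass gives coefficients O(1/|n|), for which
    [|n| ^ b] is an admissible l^2 weight when [b < 1/2]; the second pass takes [b = 1/4]. Such a
    gain is enough because the exponent [s] of the modulus of continuity may be assumed at most 1/2,
    so that [h ^ (1/4) <= h ^ (s/2)]. *)

Definition cj (R : realType) (z : R[i]) : R[i] := z^*%C.

#[global] Arguments cabs : simpl never.
#[global] Arguments cj : simpl never.
#[global] Arguments expi : simpl never.
#[global] Arguments cintegral : simpl never.

Section Complex.
Variable R : realType.
Implicit Types (z w : R[i]) (x y : R).

Lemma cabs_sqr z : cabs z ^+ 2 = complex.Re z ^+ 2 + complex.Im z ^+ 2.
Proof. by case: z => a b; rewrite /cabs /= sqr_sqrtr// addr_ge0// sqr_ge0. Qed.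

Lemma cabs_ge0 z : 0 <= cabs z.
Proof. by case: z => a b; rewrite /cabs /= sqrtr_ge0. Qed.

Lemma cabs0 : cabs (0 : R[i]) = 0.
Proof. exact: ComplexField.Normc.normc0. Qed.

Lemma cabs1 : cabs (1 : R[i]) = 1.
Proof. exact: ComplexField.Normc.normc1. Qed.

Lemma cabs_eq0 z : cabs z = 0 -> z = 0.
Proof. exact: ComplexField.Normc.eq0_normc. Qed.

Lemma cabsM z w : cabs (z * w) = cabs z * cabs w.
Proof. exact: ComplexField.Normc.normcM. Qed.

Lemma cabsV z : cabs z^-1 = (cabs z)^-1.
Proof. exact: ComplexField.Normc.normcV. Qed.

Lemma cabsN z : cabs (- z) = cabs z.
Proof. exact: normcN. Qed.

Lemma cabsD z w : cabs (z + w) <= cabs z + cabs w.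
Proof. exact: le_normcD. Qed.

Lemma cabsB z w : cabs (z - w) <= cabs z + cabs w.
Proof. by rewrite (le_trans (cabsD _ _))// cabsN. Qed.

Lemma cabsBC z w : cabs (z - w) = cabs (w - z).
Proof. by rewrite -cabsN opprB. Qed.

Lemma cabsJ z : cabs (cj z) = cabs z.
Proof. by case: z => a b; rewrite /cabs /= sqrrN. Qed.

Lemma cabsR x : cabs x%:C = `|x|.
Proof. by rewrite /cabs /= expr0n /= addr0 sqrtr_sqr. Qed.

Lemma cabs_sum (I : Type) (s : seq I) (P : pred I) (F : I -> R[i]) :
  cabs (\sum_(i <- s | P i) F i) <= \sum_(i <- s | P i) cabs (F i).
Proof.
elim/big_rec2: _ => [|i a b _ h]; first by rewrite cabs0.
by rewrite (le_trans (cabsD _ _))// lerD2l.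
Qed.

Lemma le_Re_cabs z : `|complex.Re z| <= cabs z.
Proof.
rewrite -[leRHS]ger0_norm ?cabs_ge0// -ler_sqr ?nnegrE// !real_normK ?num_real//.
by rewrite cabs_sqr lerDl sqr_ge0.
Qed.

Lemma le_Im_cabs z : `|complex.Im z| <= cabs z.
Proof.
rewrite -[leRHS]ger0_norm ?cabs_ge0// -ler_sqr ?nnegrE// !real_normK ?num_real//.
by rewrite cabs_sqr lerDr sqr_ge0.
Qed.

Lemma cabs_le_ReIm z : cabs z <= `|complex.Re z| + `|complex.Im z|.
Proof.
rewrite -[leLHS]ger0_norm ?cabs_ge0// -[leRHS]ger0_norm ?addr_ge0//.
rewrite -ler_sqr ?nnegrE// !real_normK ?num_real// cabs_sqr.
rewrite sqrrD !real_normK ?num_real// lerD2r lerDl.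
by rewrite mulrn_wge0// mulr_ge0.
Qed.

Lemma mulCJ z : z * (cj z) = (cabs z ^+ 2)%:C.
Proof.
rewrite cabs_sqr /cj; case: z => a b; rewrite /=; simpc.
by apply/eqP; rewrite eq_complex /= !expr2; apply/andP; split; apply/eqP; ring.
Qed.

Lemma cReD z w : complex.Re (z + w) = complex.Re z + complex.Re w.
Proof. by case: z => a b; case: w. Qed.
Lemma cImD z w : complex.Im (z + w) = complex.Im z + complex.Im w.
Proof. by case: z => a b; case: w. Qed.
Lemma cReN z : complex.Re (- z) = - complex.Re z. Proof. by case: z. Qed.
Lemma cImN z : complex.Im (- z) = - complex.Im z. Proof. by case: z. Qed.
Lemma cReM z w : complex.Re (z * w)
  = complex.Re z * complex.Re w - complex.Im z * complex.Im w.
Proof. by case: z => a b; case: w. Qed.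
Lemma cImM z w : complex.Im (z * w)
  = complex.Re z * complex.Im w + complex.Im z * complex.Re w.
Proof. by case: z => a b; case: w. Qed.

Lemma ReImP z w : complex.Re z = complex.Re w -> complex.Im z = complex.Im w ->
  z = w.
Proof. by case: z => a b; case: w => c d /= -> ->. Qed.

Lemma Re_sum (I : Type) (s : seq I) (P : pred I) (F : I -> R[i]) :
  complex.Re (\sum_(i <- s | P i) F i) = \sum_(i <- s | P i) complex.Re (F i).
Proof. by elim/big_rec2: _ => // i a b _ <-; rewrite cReD. Qed.

Lemma Im_sum (I : Type) (s : seq I) (P : pred I) (F : I -> R[i]) :
  complex.Im (\sum_(i <- s | P i) F i) = \sum_(i <- s | P i) complex.Im (F i).
Proof. by elim/big_rec2: _ => // i a b _ <-; rewrite cImD. Qed.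

Lemma cjD z w : cj (z + w) = cj z + cj w. Proof. exact: (rmorphD (@conjc R)). Qed.
Lemma cjB z w : cj (z - w) = cj z - cj w. Proof. exact: (rmorphB (@conjc R)). Qed.
Lemma cjM z w : cj (z * w) = cj z * cj w. Proof. exact: (rmorphM (@conjc R)). Qed.
Lemma cjK z : cj (cj z) = z. Proof. exact: conjcK. Qed.
Lemma cjR x : cj x%:C = x%:C. Proof. exact: conjc_real. Qed.
Lemma cj0 : cj 0 = 0 :> R[i]. Proof. exact: conjc0. Qed.
Lemma cj1 : cj 1 = 1 :> R[i]. Proof. exact: conjc1. Qed.
Lemma Im_cj z : complex.Im (cj z) = - complex.Im z. Proof. by case: z. Qed.
Lemma cj_sum (I : Type) (s : seq I) (P : pred I) (F : I -> R[i]) :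
  cj (\sum_(i <- s | P i) F i) = \sum_(i <- s | P i) cj (F i).
Proof. by elim/big_rec2: _ => [|i a b _ <-]; rewrite ?cj0// cjD. Qed.

Lemma CRD x y : (x + y)%:C = x%:C + y%:C :> R[i]. Proof. exact: (rmorphD (real_complex R)). Qed.
Lemma CRB x y : (x - y)%:C = x%:C - y%:C :> R[i]. Proof. exact: (rmorphB (real_complex R)). Qed.
Lemma CRM x y : (x * y)%:C = x%:C * y%:C :> R[i]. Proof. exact: (rmorphM (real_complex R)). Qed.
Lemma CR_nat n : (n%:R)%:C = n%:R :> R[i]. Proof. exact: (rmorph_nat (real_complex R)). Qed.
Lemma CR_int (n : int) : (n%:~R)%:C = n%:~R :> R[i]. Proof. exact: (rmorph_int (real_complex R)). Qed.
Lemma CRV x : (x^-1)%:C = (x%:C)^-1 :> R[i]. Proof. exact: (fmorphV (real_complex R)). Qed.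
Lemma CR_sum (I : Type) (s : seq I) (P : pred I) (F : I -> R) :
  (\sum_(i <- s | P i) F i)%:C = \sum_(i <- s | P i) (F i)%:C :> R[i].
Proof. by elim/big_rec2: _ => [|i a b _ <-]; rewrite ?CRD. Qed.

Lemma expi0 : expi 0 = 1 :> R[i].
Proof. by rewrite /expi cos0 sin0. Qed.

Lemma expiD x y : expi (x + y) = expi x * expi y.
Proof.
rewrite /expi cosD sinD; apply: ReImP; rewrite ?cReM ?cImM //=.
by rewrite addrC [X in _ + X]mulrC [X in X + _]mulrC [LHS]addrC mulrC; ring.
Qed.

Lemma expiN x : expi (- x) = (cj (expi x)).
Proof. by rewrite /expi cosN sinN /cj. Qed.

Lemma cabs_expi x : cabs (expi x) = 1.
Proof.
have h : cabs (expi x) ^+ 2 = 1 by rewrite cabs_sqr /= cos2Dsin2.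
by apply/eqP; rewrite -(@eqrXn2 _ 2) ?cabs_ge0 ?ler01// expr1n h.
Qed.

Lemma expi_mulN x : expi x * expi (- x) = 1.
Proof. by rewrite -expiD subrr expi0. Qed.

Lemma expi_2pi_int (n : int) : expi (n%:~R * (2 * pi)) = 1 :> R[i].
Proof.
have h (m : nat) : expi (m%:R * (2 * pi)) = 1 :> R[i].
  elim: m => [|m ih]; first by rewrite mul0r expi0.
  rewrite -natr1 mulrDl mul1r expiD ih mul1r /expi.
  by rewrite mulr_natl cos2pi sin2pi.
case: n => m; first exact: h.
by rewrite NegzE mulrNz mulNr expiN h cj1.
Qed.

End Complex.

(** * Sums over symmetric intervals of integers *)

Section IntSums.
Variable R : realType.

Definition zs (N : nat) : seq int := [seq k%:Z - N%:Z | k <- iota 0 N.*2.+1].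

Lemma mem_zs N (n : int) : (n \in zs N) = (`|n| <= N)%N.
Proof.
apply/mapP/idP => [[k]|h]; first by rewrite mem_iota => ? ->; lia.
by exists (absz (n + N%:Z)); rewrite ?mem_iota; lia.
Qed.

Lemma uniq_zs N : uniq (zs N).
Proof. by rewrite map_inj_uniq ?iota_uniq// => i j; lia. Qed.

Lemma size_zs N : size (zs N) = N.*2.+1.
Proof. by rewrite size_map size_iota. Qed.

(** The right-hand side is the indexing of [airy_partial]. *)
Lemma sum_zs (V : nmodType) N (F : int -> V) :
  \sum_(n <- zs N) F n = \sum_(k < N.*2.+1) F (k%:Z - N%:Z).
Proof.
by rewrite big_map -(big_mkord xpredT (fun k => F (k%:Z - N%:Z))) /index_iota subn0.
Qed.

Lemma sum_zs0 (V : nmodType) (F : int -> V) (P : pred int) :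
  \sum_(n <- zs 0 | P n) F n = if P 0 then F 0 else 0.
Proof. by rewrite /zs /= subr0 big_mkcond big_seq1. Qed.

Lemma perm_zsS N : perm_eq (zs N.+1) (N.+1%:Z :: (- N.+1%:Z) :: zs N).
Proof.
apply: uniq_perm; first exact: uniq_zs.
  rewrite 2!cons_uniq uniq_zs andbT in_cons 2!mem_zs; lia.
by move=> n; rewrite mem_zs 2!in_cons mem_zs; lia.
Qed.

Lemma sum_zsS (V : nmodType) N (F : int -> V) :
  \sum_(n <- zs N.+1) F n = F N.+1%:Z + F (- N.+1%:Z) + \sum_(n <- zs N) F n.
Proof. by rewrite (perm_big _ (perm_zsS N)) /= !big_cons addrA. Qed.

Lemma sum_zsN (V : nmodType) N (P : pred int) (F : int -> V) :
  \sum_(n <- zs N | P n) F n = \sum_(n <- zs N | P (- n)) F (- n).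
Proof.
rewrite -(big_map (@GRing.opp int) P F); apply: perm_big; apply: uniq_perm.
- exact: uniq_zs.
- by rewrite map_inj_uniq ?uniq_zs//; exact: oppr_inj.
- move=> n; apply/idP/mapP => [h|[m h ->]].
    by exists (- n); rewrite ?opprK//; move: h; rewrite !mem_zs; lia.
  by move: h; rewrite !mem_zs; lia.
Qed.

Lemma ler_sum_sub (T : eqType) (s t : seq T) (P Q : pred T) (F : T -> R) :
  uniq s -> uniq t ->
  (forall i, i \in s -> P i -> (i \in t) && Q i) ->
  (forall i, i \in t -> Q i -> 0 <= F i) ->
  \sum_(i <- s | P i) F i <= \sum_(i <- t | Q i) F i.
Proof.
move=> us ut st F0.
rewrite [leRHS](bigID (fun i => (i \in s) && P i)) /=.
rewrite -[leLHS]addr0 lerD//; last first.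
  by rewrite big_seq_cond; apply: sumr_ge0 => i /and3P[? ? _]; exact: F0.
rewrite -big_filter -[leRHS]big_filter; rewrite le_eqVlt; apply/orP; left.
apply/eqP/perm_big/uniq_perm; rewrite ?filter_uniq//.
move=> i; rewrite !mem_filter; apply/idP/idP.
  by move=> /andP[Pi si]; have /andP[-> ->] := st i si Pi; rewrite Pi si.
by case/andP=> /andP[_ /andP[-> ->]].
Qed.

Lemma ler_sum_mono (T : eqType) (s : seq T) (P : pred T) (F G : T -> R) :
  (forall i, i \in s -> P i -> F i <= G i) ->
  \sum_(i <- s | P i) F i <= \sum_(i <- s | P i) G i.
Proof.
by move=> h; rewrite big_seq_cond [leRHS]big_seq_cond; apply: ler_sum => i /andP[? ?]; exact: h.
Qed.

Lemma sum_eq1 (V : nmodType) (T : eqType) (s : seq T) (a : T) (F : T -> V) :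
  uniq s -> \sum_(i <- s | i == a) F i = if a \in s then F a else 0.
Proof.
move=> us; case: ifPn => h; first by rewrite -big_filter filter_pred1_uniq// big_seq1.
rewrite big_seq_cond big_pred0// => i; apply/negbTE/negP => /andP[hi /eqP e].
by rewrite e (negbTE h) in hi.
Qed.

(** For inner sums whose variable is pinned by a linear constraint such as [p + q = n]. The only
    candidate may fall outside the range, so its membership is a premise of the bound and never has
    to be decided. *)
Lemma ler_sum1 (T : eqType) (s : seq T) (P : pred T) (a : T) (F : T -> R) B :
  uniq s -> 0 <= B -> (forall i, i \in s -> P i -> i = a) ->
  (a \in s -> P a -> F a <= B) -> \sum_(i <- s | P i) F i <= B.
Proof.
move=> us B0 Pa FB.
have [/andP[sa pa]|h] := boolP ((a \in s) && P a).
  rewrite big_seq_cond (eq_bigl (pred1 a)).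
    by rewrite -big_filter filter_pred1_uniq// big_seq1 FB.
  by move=> i /=; apply/andP/eqP => [[? ?]|->]; [exact: Pa|].
rewrite big_seq_cond big_pred0// => i; apply/negbTE/negP => /andP[hi hp].
by rewrite -(Pa i hi hp) hi hp in h.
Qed.

Lemma sum_inv_sqr N : \sum_(m <- zs N) ((m%:~R : R) ^+ 2)^-1 <= 4.
Proof.
have S1 : \sum_(m <- zs 0) ((m%:~R : R) ^+ 2)^-1 = 0.
  by rewrite sum_zs0 /= expr0n /= invr0.
(* The remainder makes the induction close: [2 / (n + 1) - 2 / (n + 2)] exceeds the two new terms,
   [2 / (n + 2) ^ 2]. The index 0 contributes 0, since [0^-1 = 0]. *)
suff h n : \sum_(m <- zs n.+1) ((m%:~R : R) ^+ 2)^-1 <= 4 - 2 / n.+1%:R.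
  case: N => [|n]; first by rewrite S1.
  by rewrite (le_trans (h n))// gerBl divr_ge0.
elim: n => [|n ih].
  by rewrite sum_zsS S1 mulrNz sqrrN /= expr1n; lra.
rewrite sum_zsS mulrNz sqrrN -mulr2n.
apply: le_trans (lerD (lexx _) ih) _.
have -> : ((n.+2%:Z)%:~R : R) = n.+1%:R + 1 by rewrite natr1.
have -> : (n.+2%:R : R) = n.+1%:R + 1 by rewrite natr1.
have : 0 < n.+1%:R :> R by rewrite ltr0n.
move: (n.+1%:R) => a a0.
rewrite -subr_ge0.
have -> : 4 - 2 / (a + 1) - (((a + 1) ^+ 2)^-1 *+ 2 + (4 - 2 / a))
  = 2 / (a * (a + 1) ^+ 2).
  by field; apply/andP; split; lra.
by rewrite divr_ge0// mulr_ge0 ?sqr_ge0// ltW.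
Qed.

Lemma sum_inv_sqr_shift N (j : int) :
  \sum_(k <- zs N) (((k - j)%:~R : R) ^+ 2)^-1 <= 4.
Proof.
rewrite -(big_map (fun k => k - j) xpredT (fun m => ((m%:~R : R) ^+ 2)^-1)).
apply: le_trans (sum_inv_sqr (N + `|j|)); apply: ler_sum_sub => //.
- by rewrite map_inj_uniq ?uniq_zs// => ? ?; lia.
- exact: uniq_zs.
- by move=> i /mapP[k]; rewrite !mem_zs => ? -> _; lia.
- by move=> i _ _; rewrite invr_ge0 sqr_ge0.
Qed.

End IntSums.

(** * Integrals over one period *)

Section TorusIntegral.
Variable R : realType.
Notation mu := (@lebesgue_measure R).
Notation D := (@torus_dom R).
Implicit Types (f g : R -> R) (p q : R -> R[i]).

Definition iD f := mu.-integrable D (EFin \o f).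
Definition mD f := measurable_fun D f.
Definition II f : R := \int[mu]_(x in D) f x.

Lemma twopi_gt0 : 0 < 2 * pi :> R. Proof. by rewrite mulr_gt0// pi_gt0. Qed.
Lemma twopi_ge0 : 0 <= 2 * pi :> R. Proof. exact: ltW twopi_gt0. Qed.

Lemma measurable_torus_dom : measurable D.
Proof. exact: measurable_itv. Qed.
Hint Resolve measurable_torus_dom : core.

Lemma mu_torus_dom : mu D = (2 * pi)%:E.
Proof.
by rewrite lebesgue_measure_itv /= lte_fin twopi_gt0 -EFinB subr0.
Qed.

Lemma mu_torus_lty : (mu D < +oo)%E.
Proof. by rewrite mu_torus_dom ltry. Qed.

Lemma mD_iD f : iD f -> mD f.
Proof. by case/integrableP => /measurable_EFinP. Qed.

Lemma mD_cont f : continuous f -> mD f.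
Proof. by move=> cf; apply: measurable_funTS; exact: continuous_measurable_fun. Qed.

Lemma iD_bnd f (B : R) : mD f -> (forall x, D x -> `|f x| <= B) -> iD f.
Proof.
move=> mf fB; apply: measurable_bounded_integrable => //; first exact: mu_torus_lty.
by exists B; split; [exact: num_real|move=> M BM x Dx /=; exact: le_trans (fB x Dx) (ltW BM)].
Qed.

Lemma iD_cont f : continuous f -> iD f.
Proof.
move=> cf; apply: continuous_compact_integrable; first exact: segment_compact.
exact: continuous_subspaceT.
Qed.

Lemma iD_cst (r : R) : iD (fun=> r).
Proof. by apply: iD_cont; exact: cst_continuous. Qed.

Lemma iD_le f g : mD f -> (forall x, D x -> `|f x| <= g x) -> iD g -> iD f.
Proof.
move=> mf fg ig; apply: le_integrable ig => //; first exact/measurable_EFinP.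
by move=> x Dx; rewrite /= lee_fin (le_trans (fg x Dx))// ler_norm.
Qed.

Lemma iD_ext f g : (forall x, D x -> f x = g x) -> iD f -> iD g.
Proof.
by move=> fg; apply: eq_integrable => // x; rewrite inE => Dx /=; rewrite fg.
Qed.

Lemma iD_D f g : iD f -> iD g -> iD (fun x => f x + g x).
Proof. by move=> h k; apply: eq_integrable (integrableD _ h k). Qed.

Lemma iD_Z r f : iD f -> iD (fun x => r * f x).
Proof. by move=> h; apply: eq_integrable (integrableZl _ r h). Qed.

Lemma iD_N f : iD f -> iD (fun x => - f x).
Proof. by move=> /(iD_Z (-1)); apply: iD_ext => x _; rewrite mulN1r. Qed.

Lemma iD_B f g : iD f -> iD g -> iD (fun x => f x - g x).
Proof. by move=> h k; apply: iD_D => //; exact: iD_N. Qed.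

Lemma iD_abs f : iD f -> iD (fun x => `|f x|).
Proof. exact: integrable_norm. Qed.

Lemma iD_sum (I : Type) (s : seq I) (P : pred I) (F : I -> R -> R) :
  (forall i, P i -> iD (F i)) -> iD (fun x => \sum_(i <- s | P i) F i x).
Proof.
move=> h; elim: s => [|i s ih].
  by apply: iD_ext (iD_cst 0) => x _; rewrite big_nil.
have [Pi|Pi] := boolP (P i).
  by apply: iD_ext (iD_D (h i Pi) ih) => x _; rewrite big_cons Pi.
by apply: iD_ext ih => x _; rewrite big_cons (negbTE Pi).
Qed.

Lemma II_ext f g : (forall x, D x -> f x = g x) -> II f = II g.
Proof. by move=> fg; apply: eq_Rintegral => x; rewrite inE => Dx; rewrite fg. Qed.

Lemma II_D f g : iD f -> iD g -> II (fun x => f x + g x) = II f + II g.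
Proof. exact: RintegralD. Qed.

Lemma II_B f g : iD f -> iD g -> II (fun x => f x - g x) = II f - II g.
Proof. exact: RintegralB. Qed.

Lemma II_Z r f : iD f -> II (fun x => r * f x) = r * II f.
Proof. by move=> h; exact: RintegralZl. Qed.

Lemma II_N f : iD f -> II (fun x => - f x) = - II f.
Proof.
by move=> h; rewrite -mulN1r -II_Z//; apply: II_ext => x _; rewrite mulN1r.
Qed.

Lemma II_cst r : II (fun=> r) = r * (2 * pi).
Proof. by rewrite /II Rintegral_cst//; congr (_ * _); exact: (congr1 fine mu_torus_dom). Qed.

Lemma II_ge0 f : (forall x, D x -> 0 <= f x) -> 0 <= II f.
Proof.
move=> h; apply: fine_ge0; apply: integral_ge0 => x Dx; rewrite lee_fin; exact: h.
Qed.

Lemma II_le f g : iD f -> iD g -> (forall x, D x -> f x <= g x) -> II f <= II g.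
Proof. exact: le_Rintegral. Qed.

Lemma II_abs f : iD f -> `|II f| <= II (fun x => `|f x|).
Proof. exact: le_normr_Rintegral. Qed.

Lemma II_sum (I : Type) (s : seq I) (P : pred I) (F : I -> R -> R) :
  (forall i, P i -> iD (F i)) ->
  II (fun x => \sum_(i <- s | P i) F i x) = \sum_(i <- s | P i) II (F i).
Proof.
move=> h; elim: s => [|i s ih].
  rewrite big_nil (@II_ext _ (fun=> 0)) ?II_cst ?mul0r// => x _.
  by rewrite big_nil.
rewrite big_cons -ih; case: ifP => Pi.
  rewrite -II_D; [|exact: h|exact: iD_sum].
  by apply: II_ext => x _; rewrite big_cons Pi.
by apply: II_ext => x _; rewrite big_cons Pi.
Qed.

Lemma EFin_II f : iD f -> ((II f)%:E = \int[mu]_(x in D) (f x)%:E)%E.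
Proof. by move=> h; rewrite /II /Rintegral fineK//; exact: integrable_fin_num. Qed.

(** Convergence is only asked inside the period: one application is to Fejer means of a continuous
    function that need not be periodic, for which it may fail at both ends. *)
Lemma II_dct (f_ : nat -> R -> R) f g : (forall n, mD (f_ n)) -> mD f -> iD g ->
  (forall x, 0 < x < 2 * pi -> f_ n x @[n --> \oo] --> f x) ->
  (forall n x, D x -> `|f_ n x| <= g x) ->
  II (fun x => `|f_ n x - f x|) @[n --> \oo] --> 0.
Proof.
move=> mf_ mf ig ff fg.
have ae1 : {ae mu, forall x, D x -> (EFin \o f_ n) x @[n --> \oo] --> (EFin \o f) x}.
  have N0 : mu ([set 0] `|` [set 2 * pi]) = 0%E.
    by apply: countable_lebesgue_measure0; apply: finite_set_countable; exact: finite_set2.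
  exists ([set 0] `|` [set 2 * pi]); split => //; first exact: measurableU.
  move=> x /= /not_implyP[]; rewrite /torus_dom /= in_itv /= => /andP[x0 x1] h.
  have [->|xn0] := eqVneq x 0; first by left.
  have [->|xn1] := eqVneq x (2 * pi); first by right.
  exfalso; apply: h; apply: cvg_EFin; [exact: nearW|apply: ff].
  by rewrite !lt_neqAle x0 x1 xn1 eq_sym xn0.
have ae2 : {ae mu, forall x n, D x -> (`|(EFin \o f_ n) x| <= (EFin \o g) x)%E}.
  by apply: aeW => x n Dx /=; rewrite lee_fin fg.
have m1 n : measurable_fun D (EFin \o f_ n).
  by apply/measurable_EFinP; exact: mf_.
have m2 : measurable_fun D (EFin \o f) by exact/measurable_EFinP.
have [_ h _] := @dominated_convergence _ _ R mu D measurable_torus_dom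
  (fun n => EFin \o f_ n) (EFin \o f) (EFin \o g) m1 m2 ae1 ig ae2.
have : fine (\int[mu]_(x in D) `|(f_ n x)%:E - (f x)%:E|)%E
  @[n --> \oo] --> 0 by exact: fine_cvg h.
by apply: cvg_trans; apply: near_eq_cvg; apply: nearW => n.
Qed.

Definition mC p := mD (fun x => complex.Re (p x)) /\ mD (fun x => complex.Im (p x)).
Definition cI p := iD (fun x => complex.Re (p x)) /\ iD (fun x => complex.Im (p x)).
Definition cC p := continuous (fun x => complex.Re (p x)) /\
  continuous (fun x => complex.Im (p x)).
Definition l2 p := mC p /\ iD (fun x => cabs (p x) ^+ 2).
Definition n2 p := II (fun x => cabs (p x) ^+ 2).
Definition CI p : R[i] := cintegral D p.

Lemma cabsE z : cabs z = Num.sqrt (complex.Re z ^+ 2 + complex.Im z ^+ 2) :> R.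
Proof. by case: z. Qed.

Lemma mD_ext f g : f =1 g -> mD f -> mD g.
Proof. by move=> /funext ->. Qed.

Lemma mC_cabs p : mC p -> mD (fun x => cabs (p x)).
Proof.
move=> [m1 m2]; have h : mD (fun x => complex.Re (p x) ^+ 2 + complex.Im (p x) ^+ 2).
  by apply: measurable_funD; apply: measurable_funX.
apply: (@mD_ext (Num.sqrt \o (fun x => complex.Re (p x) ^+ 2 + complex.Im (p x) ^+ 2))).
  by move=> x; rewrite /= cabsE.
apply: measurableT_comp => //; apply: continuous_measurable_fun.
exact: sqrt_continuous.
Qed.

Lemma mC_D p q : mC p -> mC q -> mC (fun x => p x + q x).
Proof.
move=> [p1 p2] [q1 q2]; split.
  by under eq_fun do rewrite cReD; exact: measurable_funD.
by under eq_fun do rewrite cImD; exact: measurable_funD.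
Qed.

Lemma mC_M p q : mC p -> mC q -> mC (fun x => p x * q x).
Proof.
move=> [p1 p2] [q1 q2]; split.
  by apply: mD_ext (measurable_funB (measurable_funM p1 q1) (measurable_funM p2 q2))
    => x; rewrite cReM.
by apply: mD_ext (measurable_funD (measurable_funM p1 q2) (measurable_funM p2 q1))
  => x; rewrite cImM.
Qed.

Lemma mC_J p : mC p -> mC (fun x => (cj (p x))).
Proof.
move=> [m1 m2]; split; first by apply: mD_ext m1 => x; case: (p x).
by apply: mD_ext (measurableT_comp (@oppr_measurable R setT) m2) => x /=; case: (p x).
Qed.

Lemma mC_R f : mD f -> mC (fun x => (f x)%:C).
Proof. by move=> m; split => //; exact: measurable_cst. Qed.

Lemma cC_mC p : cC p -> mC p.
Proof. by move=> [c1 c2]; split; exact: mD_cont. Qed.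

Lemma cC_cI p : cC p -> cI p.
Proof. by move=> [c1 c2]; split; exact: iD_cont. Qed.

Lemma cont_ext f g : f =1 g -> continuous f -> continuous g.
Proof. by move=> /funext ->. Qed.

Lemma cC_ext p q : p =1 q -> cC p -> cC q.
Proof. by move=> /funext ->. Qed.

Lemma contD f g : continuous f -> continuous g -> continuous (fun x => f x + g x).
Proof. by move=> cf cg x; apply: cvgD; [exact: cf|exact: cg]. Qed.

Lemma contM f g : continuous f -> continuous g -> continuous (fun x => f x * g x).
Proof. by move=> cf cg x; apply: cvgM; [exact: cf|exact: cg]. Qed.

Lemma contN f : continuous f -> continuous (fun x => - f x).
Proof. by move=> cf x; apply: cvgN; exact: cf. Qed.

Lemma cC_D p q : cC p -> cC q -> cC (fun x => p x + q x).
Proof.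
move=> [p1 p2] [q1 q2]; split.
  by apply: cont_ext (contD p1 q1) => x; rewrite cReD.
by apply: cont_ext (contD p2 q2) => x; rewrite cImD.
Qed.

Lemma cC_M p q : cC p -> cC q -> cC (fun x => p x * q x).
Proof.
move=> [p1 p2] [q1 q2]; split.
  by apply: cont_ext (contD (contM p1 q1) (contN (contM p2 q2))) => x; rewrite cReM.
by apply: cont_ext (contD (contM p1 q2) (contM p2 q1)) => x; rewrite cImM.
Qed.

Lemma cC_R f : continuous f -> cC (fun x => (f x)%:C).
Proof. by move=> cf; split => //; exact: cst_continuous. Qed.

Lemma cC_cst (z : R[i]) : cC (fun=> z).
Proof. by split; exact: cst_continuous. Qed.

Lemma cC_N p : cC p -> cC (fun x => - p x).
Proof.
by move=> /(cC_M (cC_cst (-1))); apply: cC_ext => x; rewrite mulN1r.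
Qed.

Lemma cC_B p q : cC p -> cC q -> cC (fun x => p x - q x).
Proof. by move=> cp /cC_N; exact: cC_D. Qed.

Lemma cC_sum (I : Type) (s : seq I) (P : pred I) (F : I -> R -> R[i]) :
  (forall i, cC (F i)) -> cC (fun x => \sum_(i <- s | P i) F i x).
Proof.
move=> h; elim: s => [|i s ih].
  by apply: cC_ext (cC_cst 0) => x; rewrite big_nil.
have [Pi|Pi] := boolP (P i).
  by apply: cC_ext (cC_D (h i) ih) => x; rewrite big_cons Pi.
by apply: cC_ext ih => x; rewrite big_cons (negbTE Pi).
Qed.

Lemma cont_cabs p : cC p -> continuous (fun x => cabs (p x)).
Proof.
move=> [c1 c2].
apply: (@cont_ext (Num.sqrt \o (fun x => complex.Re (p x) ^+ 2 + complex.Im (p x) ^+ 2))).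
  by move=> x; rewrite /= cabsE.
move=> x; apply: continuous_comp; last exact: sqrt_continuous.
by apply: contD; exact: contM.
Qed.

Lemma contX f n : continuous f -> continuous (fun x => f x ^+ n).
Proof. move=> cf x; exact: (continuous_comp (cf x) (@exprn_continuous _ n (f x))). Qed.

Lemma cC_l2 p : cC p -> l2 p.
Proof.
move=> cp; split; first exact: cC_mC.
by apply: iD_cont; apply: contX; exact: cont_cabs.
Qed.

Lemma l2_bnd p (B : R) : mC p -> (forall x, D x -> cabs (p x) <= B) -> l2 p.
Proof.
move=> mp pB; split => //; apply: (@iD_bnd _ (B ^+ 2)).
  by apply: measurable_funX; exact: mC_cabs.
move=> x Dx; rewrite ger0_norm ?sqr_ge0//.
by rewrite lerXn2r ?nnegrE ?cabs_ge0 ?(le_trans (cabs_ge0 (p x)))// ?pB.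
Qed.

Lemma iD_cabsM p q : l2 p -> l2 q -> iD (fun x => cabs (p x) * cabs (q x)).
Proof.
move=> [mp ip] [mq iq].
apply: (@iD_le _ (fun x => cabs (p x) ^+ 2 + cabs (q x) ^+ 2)).
- by apply: measurable_funM; exact: mC_cabs.
- move=> x Dx; rewrite ger0_norm ?mulr_ge0 ?cabs_ge0//.
  have := sqr_ge0 (cabs (p x) - cabs (q x)).
  by have := sqr_ge0 (cabs (p x)); have := sqr_ge0 (cabs (q x)); nra.
- exact: iD_D.
Qed.

Lemma cI_cabs p : mC p -> iD (fun x => cabs (p x)) -> cI p.
Proof.
move=> [m1 m2] ip; split.
  by apply: iD_le ip => // x _; exact: le_Re_cabs.
by apply: iD_le ip => // x _; exact: le_Im_cabs.
Qed.

Lemma iD_cabs p : cI p -> iD (fun x => cabs (p x)).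
Proof.
move=> [i1 i2]; apply: (@iD_le _ (fun x => `|complex.Re (p x)| + `|complex.Im (p x)|)).
- by apply: mC_cabs; split; exact: mD_iD.
- by move=> x _; rewrite ger0_norm ?cabs_ge0// cabs_le_ReIm.
- by apply: iD_D; exact: iD_abs.
Qed.

Lemma cI_M p q : l2 p -> l2 q -> cI (fun x => p x * q x).
Proof.
move=> hp hq; apply: cI_cabs; first by apply: mC_M; [case: hp|case: hq].
by apply: iD_ext (iD_cabsM hp hq) => x _; rewrite cabsM.
Qed.

Lemma l2_cI p : l2 p -> cI p.
Proof.
move=> hp; have := cI_M hp (cC_l2 (cC_cst 1)).
by rewrite (_ : (fun x => p x * 1) = p)//; apply/funext => x; rewrite mulr1.
Qed.

Lemma l2_ext p q : p =1 q -> l2 p -> l2 q.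
Proof. by move=> /funext ->. Qed.

Lemma l2_D p q : l2 p -> l2 q -> l2 (fun x => p x + q x).
Proof.
move=> [mp ip] [mq iq]; split; first exact: mC_D.
apply: (@iD_le _ (fun x => 2 * cabs (p x) ^+ 2 + 2 * cabs (q x) ^+ 2)).
- by apply: measurable_funX; apply: mC_cabs; exact: mC_D.
- move=> x Dx; rewrite ger0_norm ?sqr_ge0//.
  have := cabsD (p x) (q x); have := cabs_ge0 (p x + q x).
  have := sqr_ge0 (cabs (p x) - cabs (q x)).
  move: (cabs_ge0 (p x)) (cabs_ge0 (q x)); move: (cabs _) (cabs _) (cabs _) => a b c.
  by nra.
- by apply: iD_D; exact: iD_Z.
Qed.

Lemma l2_Z (z : R[i]) p : l2 p -> l2 (fun x => z * p x).
Proof.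
move=> [mp ip]; split; first by apply: mC_M => //; exact/cC_mC/cC_cst.
by apply: iD_ext (iD_Z (cabs z ^+ 2) ip) => x _; rewrite cabsM exprMn.
Qed.

Lemma l2_N p : l2 p -> l2 (fun x => - p x).
Proof. by move=> /(l2_Z (-1)); apply: l2_ext => x; rewrite mulN1r. Qed.

Lemma l2_B p q : l2 p -> l2 q -> l2 (fun x => p x - q x).
Proof. by move=> hp /l2_N; exact: l2_D. Qed.

Lemma l2_J p : l2 p -> l2 (fun x => (cj (p x))).
Proof.
move=> [mp ip]; split; first exact: mC_J.
by apply: iD_ext ip => x _; rewrite cabsJ.
Qed.

Lemma l2_Mc p q : l2 p -> cC q -> l2 (fun x => p x * q x).
Proof.
move=> [mp ip] cq; split; first by apply: mC_M => //; exact: cC_mC.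
have [B hB] : exists B, forall x, D x -> cabs (q x) <= B.
  have /compact_bounded[M [_ h]] := continuous_compact
    (continuous_subspaceT (cont_cabs cq)) (@segment_compact _ 0 (2 * pi)).
  exists (M + 1) => x Dx; rewrite -[leLHS]ger0_norm ?cabs_ge0//.
  by apply: (h (M + 1)); [rewrite ltrDl|exists x].
apply: (@iD_le _ (fun x => B ^+ 2 * cabs (p x) ^+ 2)).
- apply: measurable_funX; apply: mC_cabs; apply: mC_M => //; exact: cC_mC.
- move=> x Dx; rewrite ger0_norm ?sqr_ge0// cabsM exprMn mulrC ler_wpM2r ?sqr_ge0//.
  by rewrite lerXn2r ?nnegrE ?cabs_ge0 ?(le_trans (cabs_ge0 (q x)))// ?hB.
- exact: iD_Z.
Qed.

Lemma CI_ext p q : (forall x, D x -> p x = q x) -> CI p = CI q.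
Proof.
move=> pq; rewrite /CI /cintegral.
by congr (_ +i* _); apply: II_ext => x Dx; rewrite pq.
Qed.

Lemma Re_CI p : complex.Re (CI p) = II (fun x => complex.Re (p x)).
Proof. by []. Qed.
Lemma Im_CI p : complex.Im (CI p) = II (fun x => complex.Im (p x)).
Proof. by []. Qed.

Lemma cI_ext p q : (forall x, D x -> p x = q x) -> cI p -> cI q.
Proof.
by move=> pq [h1 h2]; split; [apply: iD_ext h1|apply: iD_ext h2] => x Dx; rewrite pq.
Qed.

Lemma cI_D p q : cI p -> cI q -> cI (fun x => p x + q x).
Proof.
move=> [p1 p2] [q1 q2]; split.
  by apply: iD_ext (iD_D p1 q1) => x _; rewrite cReD.
by apply: iD_ext (iD_D p2 q2) => x _; rewrite cImD.
Qed.

Lemma cI_Z (z : R[i]) p : cI p -> cI (fun x => z * p x).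
Proof.
move=> [p1 p2]; split.
  by apply: iD_ext (iD_B (iD_Z (complex.Re z) p1) (iD_Z (complex.Im z) p2)) => x _; rewrite cReM.
by apply: iD_ext (iD_D (iD_Z (complex.Re z) p2) (iD_Z (complex.Im z) p1)) => x _; rewrite cImM.
Qed.

Lemma CI_D p q : cI p -> cI q -> CI (fun x => p x + q x) = CI p + CI q.
Proof.
move=> [p1 p2] [q1 q2]; apply: ReImP; rewrite ?cReD ?cImD !(Re_CI, Im_CI) -II_D//.
  by apply: II_ext => x _; rewrite cReD.
by apply: II_ext => x _; rewrite cImD.
Qed.

Lemma CI_Z (z : R[i]) p : cI p -> CI (fun x => z * p x) = z * CI p.
Proof.
move=> [p1 p2]; apply: ReImP; rewrite ?cReM ?cImM !(Re_CI, Im_CI).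
  rewrite -!II_Z// -II_B; try exact: iD_Z.
  by apply: II_ext => x _; rewrite cReM.
rewrite -!II_Z// -II_D; try exact: iD_Z.
by apply: II_ext => x _; rewrite cImM.
Qed.

Lemma CI_N p : cI p -> CI (fun x => - p x) = - CI p.
Proof.
by move=> h; rewrite -mulN1r -CI_Z//; apply: CI_ext => x _; rewrite mulN1r.
Qed.

Lemma cI_N p : cI p -> cI (fun x => - p x).
Proof. by move=> /(cI_Z (-1)); apply: cI_ext => x _; rewrite mulN1r. Qed.

Lemma CI_B p q : cI p -> cI q -> CI (fun x => p x - q x) = CI p - CI q.
Proof. by move=> hp hq; rewrite CI_D ?CI_N//; exact: cI_N. Qed.

Lemma CI_J p : cI p -> CI (fun x => (cj (p x))) = (cj (CI p)).
Proof.
move=> [h1 h2]; apply: ReImP.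
  by rewrite /CI /cintegral /=; apply: II_ext => x _; case: (p x).
rewrite /CI /cintegral /= -[RHS]/(- II _) -II_N//; apply: II_ext => x _.
by case: (p x).
Qed.

Lemma cI_sum (I : Type) (s : seq I) (P : pred I) (F : I -> R -> R[i]) :
  (forall i, P i -> cI (F i)) -> cI (fun x => \sum_(i <- s | P i) F i x).
Proof.
move=> h; split.
  by under eq_fun do rewrite Re_sum; apply: iD_sum => i /h[].
by under eq_fun do rewrite Im_sum; apply: iD_sum => i /h[].
Qed.

Lemma CI_sum (I : Type) (s : seq I) (P : pred I) (F : I -> R -> R[i]) :
  (forall i, P i -> cI (F i)) ->
  CI (fun x => \sum_(i <- s | P i) F i x) = \sum_(i <- s | P i) CI (F i).
Proof.
move=> h; apply: ReImP; rewrite ?Re_sum ?Im_sum !(Re_CI, Im_CI).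
  rewrite -II_sum; last by move=> i /h[].
  by apply: II_ext => x _; rewrite Re_sum.
rewrite -II_sum; last by move=> i /h[].
by apply: II_ext => x _; rewrite Im_sum.
Qed.

Lemma CI_R f : CI (fun x => (f x)%:C) = (II f)%:C.
Proof. by apply: ReImP; rewrite ?Re_CI ?Im_CI //= II_cst mul0r. Qed.

Lemma cabs_CI p : cI p -> cabs (CI p) <= II (fun x => cabs (p x)).
Proof.
move=> cp; have [z0|z0] := eqVneq (cabs (CI p)) 0.
  by rewrite z0; apply: II_ge0 => x _; exact: cabs_ge0.
(* The unit factor [w] rotates the integral onto the positive real axis, after which only real parts
   are compared. *)
pose w := (cj (CI p)) / (cabs (CI p))%:C.
have e : w * CI p = (cabs (CI p))%:C.
  rewrite /w mulrAC [cj _ * _]mulrC mulCJ expr2 rmorphM mulfK//.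
  by rewrite fmorph_eq0.
have w1 : cabs w = 1 by rewrite cabsM cabsV cabsR ger0_norm ?cabs_ge0// cabsJ divff.
have -> : cabs (CI p) = II (fun x => complex.Re (w * p x)).
  by rewrite -Re_CI CI_Z// e.
have [ir _] := cI_Z w cp.
apply: II_le => //; first exact: iD_cabs.
move=> x _; rewrite (le_trans (ler_norm _))// (le_trans (le_Re_cabs _))//.
by rewrite cabsM w1 mul1r.
Qed.

Lemma n2_ge0 p : 0 <= n2 p.
Proof. by apply: II_ge0 => x _; exact: sqr_ge0. Qed.

Lemma n2_CI p : CI (fun x => p x * (cj (p x))) = (n2 p)%:C.
Proof. by rewrite /n2 -CI_R; apply: CI_ext => x _; rewrite mulCJ. Qed.

(** Cauchy-Schwarz in the form of Young's inequality: the parameter [l] is left free, and no square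
    root of a norm appears. *)
Lemma II_cabsM p q (l : R) : 0 < l -> l2 p -> l2 q ->
  II (fun x => cabs (p x) * cabs (q x)) <= l * n2 p + l^-1 * n2 q.
Proof.
move=> l0 hp hq; rewrite /n2 -!II_Z -?II_D; try (by case: hp); try (by case: hq); try (by apply: iD_Z; case: hp); try (by apply: iD_Z; case: hq).
apply: II_le; first exact: iD_cabsM.
  by apply: iD_D; apply: iD_Z; [case: hp|case: hq].
move=> x _; move: (cabs (p x)) (cabs (q x)) (cabs_ge0 (p x)) (cabs_ge0 (q x)) => a b a0 b0.
have : 0 <= l * (a - l^-1 * b) ^+ 2 by rewrite mulr_ge0 ?sqr_ge0// ltW.
have -> : l * (a - l^-1 * b) ^+ 2 = l * a ^+ 2 - 2 * (a * b) + l^-1 * b ^+ 2.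
  by field; rewrite gt_eqF.
by have := mulr_ge0 a0 b0; lra.
Qed.

Lemma n2_D p q : l2 p -> l2 q -> n2 (fun x => p x + q x) <= 2 * n2 p + 2 * n2 q.
Proof.
move=> hp hq; rewrite /n2 -!II_Z -?II_D; try (by case: hp); try (by case: hq); try (by apply: iD_Z; case: hp); try (by apply: iD_Z; case: hq).
apply: II_le; first by case: (l2_D hp hq).
  by apply: iD_D; apply: iD_Z; [case: hp|case: hq].
move=> x _; have := cabsD (p x) (q x); have := cabs_ge0 (p x + q x).
have := sqr_ge0 (cabs (p x) - cabs (q x)).
move: (cabs_ge0 (p x)) (cabs_ge0 (q x)); move: (cabs _) (cabs _) (cabs _) => a b c.
by nra.
Qed.

Lemma n2_ext p q : (forall x, D x -> p x = q x) -> n2 p = n2 q.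
Proof. by move=> pq; apply: II_ext => x Dx; rewrite pq. Qed.

Lemma L2_torus_l2 f : L2_torus f -> l2 (fun x => (f x)%:C).
Proof.
move=> [pf mf fi]; have m : mD f by exact: measurable_funTS.
split; first exact: mC_R.
suff h : iD (fun x => f x ^+ 2).
  by apply: iD_ext h => x _; rewrite cabsR real_normK// num_real.
apply/integrableP; split; first by apply/measurable_EFinP; exact: measurable_funX.
apply: le_lt_trans fi; rewrite le_eqVlt; apply/orP; left; apply/eqP.
by apply: eq_integral => x _ /=; rewrite ger0_norm// sqr_ge0.
Qed.

Lemma l2_L2_torus f : torus_fun f -> measurable_fun setT f ->
  l2 (fun x => (f x)%:C) -> L2_torus f.
Proof.
move=> pf mf [_ h]; split => //.
have {}h : iD (fun x => f x ^+ 2).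
  by apply: iD_ext h => x _; rewrite cabsR real_normK// num_real.
case/integrableP : h => _; apply: le_lt_trans.
rewrite le_eqVlt; apply/orP; left; apply/eqP.
by apply: eq_integral => x _ /=; rewrite ger0_norm// sqr_ge0.
Qed.

Definition te (n : int) (x : R) : R[i] := expi (n%:~R * x).

Lemma cont_lin (r : R) : continuous (fun x => r * x).
Proof. exact: mulrl_continuous. Qed.

Lemma cC_expi (r : R) : cC (fun x => expi (r * x)).
Proof.
split => x; apply: continuous_comp; do ?exact: cont_lin.
  exact: continuous_cos.
exact: continuous_sin.
Qed.

Lemma cC_te n : cC (te n). Proof. exact: cC_expi. Qed.

Lemma teD m n x : te (m + n) x = te m x * te n x.
Proof. by rewrite /te intrD mulrDl expiD. Qed.

Lemma teN n x : te (- n) x = (cj (te n x)).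
Proof. by rewrite /te mulrNz mulNr expiN. Qed.

Lemma te0 x : te 0 x = 1. Proof. by rewrite /te mul0r expi0. Qed.

Lemma cabs_te n x : cabs (te n x) = 1. Proof. exact: cabs_expi. Qed.

Lemma te_periodic n : periodic (te n) (2 * pi).
Proof. by move=> x; rewrite /te mulrDr expiD expi_2pi_int mulr1. Qed.

Lemma is_derive_eq1 f (x a b : R) : is_derive x (1 : R) f a -> a = b ->
  is_derive x (1 : R) f b.
Proof. by move=> h <-. Qed.

(** The interval is arbitrary because the coefficients of a BV function are estimated by integrating
    over each of the [|n|] periods of [te n], not only over the whole torus. *)
Lemma cint_te_period n (a b : R) : n != 0 -> a < b -> te n a = te n b ->
  cintegral `[a, b] (te n) = 0.
Proof.
move=> n0 ab E2.
have nR : (n%:~R : R) != 0 by rewrite intr_eq0.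
have hc : continuous (fun x : R => cos (n%:~R * x)) by case: (cC_te n).
have hs : continuous (fun x : R => sin (n%:~R * x)) by case: (cC_te n).
have dl (x : R) : is_derive x (1 : R) (fun y : R => n%:~R * y) n%:~R.
  have := is_deriveZ (n%:~R : R) (is_derive_id x (1 : R)).
  by move=> h; apply: is_derive_eq1 h _; rewrite /GRing.scale /= mulr1.
have ds (x : R) : is_derive x (1 : R) (fun y : R => n%:~R^-1 * sin (n%:~R * y)) (cos (n%:~R * x)).
  have := is_deriveZ (n%:~R^-1 : R) (is_derive1_comp (is_derive_sin (n%:~R * x)) (dl x)).
  by move=> h; apply: is_derive_eq1 h _; rewrite /GRing.scale /= mulrCA mulVf// mulr1.
have dc (x : R) : is_derive x (1 : R) (fun y : R => - n%:~R^-1 * cos (n%:~R * y)) (sin (n%:~R * x)).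
  have := is_deriveZ (- n%:~R^-1 : R) (is_derive1_comp (is_derive_cos (n%:~R * x)) (dl x)).
  by move=> h; apply: is_derive_eq1 h _; rewrite /GRing.scale /= mulNr mulNr mulrN opprK mulrCA mulVf// mulr1.
have FTC (F f : R -> R) : (forall x, is_derive x (1 : R) F (f x)) -> continuous f ->
    \int[mu]_(x in `[a, b]) f x = F b - F a.
  move=> dF cf; have cF : continuous F.
    move=> x; apply: differentiable_continuous; apply/derivable1_diffP.
    by have [] := dF x.
  rewrite /Rintegral (@continuous_FTC2 _ _ F) -?EFinB//.
  - exact: continuous_subspaceT.
  - split => [x _||]; first by have [] := dF x.
    + by apply: cvg_at_right_filter; exact: cF.
    + by apply: cvg_at_left_filter; exact: cF.
  - by move=> x _; rewrite derive1E; have [_ ->] := dF x.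
move: E2; rewrite /te /expi => /eqP; rewrite eq_complex /= => /andP[/eqP E2c /eqP E2s].
apply: ReImP; rewrite /cintegral /=.
  by rewrite (FTC _ _ ds)// E2s subrr.
by rewrite (FTC _ _ dc)// E2c subrr.
Qed.

Lemma CI_te n : CI (te n) = if n == 0 then (2 * pi)%:C else 0.
Proof.
case: eqVneq => [->|n0].
  rewrite (@CI_ext _ (fun=> 1%:C)); last by move=> x _; rewrite te0.
  by rewrite CI_R II_cst mul1r.
apply: cint_te_period => //; first exact: twopi_gt0.
by rewrite -[in RHS](add0r (2 * pi)) te_periodic.
Qed.

Lemma II_oo f : iD f -> II f = \int[mu]_(x in `]0, 2 * pi[) f x.
Proof.
move=> fi; rewrite /II /torus_dom -Rintegral_itv_obnd_cbnd; last first.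
  by apply: integrableS fi => //; exact: subset_itv_oc_cc.
rewrite -Rintegral_itv_bndo_bndc//.
by apply: integrableS fi => //; exact: subset_itv_oo_cc.
Qed.

Lemma II_le_oo f g : iD f -> iD g -> (forall x, 0 < x < 2 * pi -> f x <= g x) -> II f <= II g.
Proof.
move=> fi gi fg; rewrite !II_oo//; apply: le_Rintegral => //.
- by apply: integrableS fi => //; exact: subset_itv_oo_cc.
- by apply: integrableS gi => //; exact: subset_itv_oo_cc.
Qed.

Lemma iD_indic (A : set R) f : measurable A -> iD f -> iD (fun x => \1_A x * f x).
Proof.
move=> mA fi; apply: iD_le (iD_abs fi).
  by apply: measurable_funM; [exact: measurable_indic|exact: mD_iD].
by move=> x _; rewrite normrM indicE ler_piMl// normr_nat lern1 leq_b1.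
Qed.

Lemma II_indic (A : set R) f : A `<=` D ->
  II (fun x => \1_A x * f x) = \int[mu]_(x in A) f x.
Proof.
move=> AD; rewrite -[in RHS](setIidr AD) Rintegral_mkcondr.
apply: II_ext => x _; rewrite /patch indicE.
by case: ifP => _; rewrite ?mul1r ?mul0r.
Qed.

Lemma II_indic_itv (a b : R) : a <= b -> II (fun x => \1_(`]a, b[%classic) x) <= b - a.
Proof.
move=> ab; rewrite -lee_fin EFin_II; last first.
  apply: (@iD_bnd _ 1); first exact: measurable_indic.
  by move=> x _; rewrite indicE normr_nat lern1 leq_b1.
rewrite integral_indic//; apply: (@le_trans _ _ (mu `]a, b[)).
  by apply: le_measure; rewrite ?inE//; exact: measurableI.
by rewrite lebesgue_measure_itv /= lte_fin; case: ifPn => h; rewrite ?EFinB// lee_fin subr_ge0.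
Qed.

(** Orthogonality. The frequencies [k i] may repeat, so that it applies to products of trigonometric
    sums indexed by tuples. *)
Lemma CI_trig (I : Type) (s : seq I) (P : pred I) (a : I -> R[i]) (k : I -> int) :
  CI (fun x => \sum_(i <- s | P i) a i * te (k i) x) =
  (2 * pi)%:C * \sum_(i <- s | P i && (k i == 0)) a i.
Proof.
rewrite CI_sum; last by move=> i _; apply: cI_Z; exact/cC_cI/cC_te.
rewrite mulr_sumr big_mkcondr /=; apply: eq_bigr => i _.
rewrite CI_Z; last exact/cC_cI/cC_te.
by rewrite CI_te; case: ifP => _; rewrite ?mulr0// mulrC.
Qed.

End TorusIntegral.
#[global] Hint Resolve measurable_torus_dom : core.

(** * Fejer means and completeness *)

Section Completeness.
Variable R : realType.
Notation mu := (@lebesgue_measure R).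
Notation D := (@torus_dom R).
Implicit Types (f : R -> R) (s : seq int) (a b : int -> R[i]).

Definition tp s a (x : R) : R[i] := \sum_(n <- s) a n * te n x.

Lemma cC_tp s a : cC (tp s a).
Proof. by apply: cC_sum => n; apply: cC_M; [exact: cC_cst|exact: cC_te]. Qed.

Lemma l2_tp s a : l2 (tp s a). Proof. exact: cC_l2 (cC_tp s a). Qed.

Lemma coef_tp s a m : uniq s ->
  CI (fun x => tp s a x * te (- m) x) = (2 * pi)%:C * (if m \in s then a m else 0).
Proof.
move=> us; rewrite (@CI_ext _ _ (fun x => \sum_(n <- s) a n * te (n - m) x)).
  rewrite CI_trig -(sum_eq1 _ _ us); congr (_ * _).
  by apply: eq_bigl => n /=; rewrite subr_eq0.
by move=> x _; rewrite mulr_suml; apply: eq_bigr => n _; rewrite teD mulrA.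
Qed.

Lemma CI_tpJ (F : R -> R[i]) s a : l2 F ->
  CI (fun x => F x * (cj (tp s a x)))
    = \sum_(m <- s) (cj (a m)) * CI (fun x => F x * te (- m) x).
Proof.
move=> lF; have cI_ m : cI (fun x => F x * te (- m) x).
  by apply: cI_M => //; exact/cC_l2/cC_te.
rewrite (@CI_ext _ _ (fun x => \sum_(m <- s) (cj (a m)) * (F x * te (- m) x))).
  by rewrite CI_sum => [|m _]; [apply: eq_bigr => m _; rewrite CI_Z|exact: cI_Z].
move=> x _; rewrite /tp cj_sum mulr_sumr; apply: eq_bigr => m _.
by rewrite cjM teN mulrCA.
Qed.

Lemma complexR_inj (x y : R) : x%:C = y%:C -> x = y.
Proof. by case. Qed.

Lemma n2_tp s a : uniq s -> n2 (tp s a) = 2 * pi * \sum_(n <- s) cabs (a n) ^+ 2.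
Proof.
move=> us; apply: complexR_inj; rewrite -n2_CI CI_tpJ; last exact: l2_tp.
rewrite rmorphM /= rmorph_sum mulr_sumr /= big_seq [RHS]big_seq.
by apply: eq_bigr => m ms; rewrite coef_tp// ms mulrCA -mulCJ [cj _ * _]mulrC.
Qed.

(** [fourier_coef] for complex-valued functions, such as the square of a partial sum. *)
Definition fc (F : R -> R[i]) (n : int) : R[i] :=
  (2 * pi)^-1%:C * CI (fun x => F x * te (- n) x).

Lemma fcE F n : CI (fun x => F x * te (- n) x) = (2 * pi)%:C * fc F n.
Proof. by rewrite /fc mulrA -rmorphM /= divff ?mul1r// gt_eqF// twopi_gt0. Qed.

Lemma fourier_coefE f n : fourier_coef f n = fc (fun x => (f x)%:C) n.
Proof.
rewrite /fourier_coef /fc; congr (_ * _); apply: CI_ext => x _.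
by rewrite /te mulrNz mulNr.
Qed.

(** Completing the square. For [b = fc F] this is Bessel's identity; in general it shows that no
    other coefficients do better. *)
Lemma n2_sub_tp (F : R -> R[i]) s b : l2 F -> uniq s ->
  n2 (fun x => F x - tp s b x) = n2 F +
  2 * pi * \sum_(n <- s) (cabs (fc F n - b n) ^+ 2 - cabs (fc F n) ^+ 2).
Proof.
move=> lF us; apply: complexR_inj.
have lP := l2_tp s b.
have := n2_CI (fun x => F x - tp s b x).
rewrite (@CI_ext _ _ (fun x => (F x * (cj (F x)) - F x * (cj (tp s b x)))
   - ((cj (F x * (cj (tp s b x)))) - tp s b x * (cj (tp s b x))))); last first.
  by move=> x _; rewrite cjB cjM cjK; ring.
move=> <-; have i1 := cI_M lF (l2_J lF); have i2 := cI_M lF (l2_J lP).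
have i3 : cI (fun x => (cj (F x * (cj (tp s b x))))).
  apply: cI_ext (cI_M lP (l2_J lF)) => x _; rewrite cjM cjK mulrC//.
have i4 := cI_M lP (l2_J lP).
have h12 := cI_D i1 (cI_N i2); have h34 := cI_D i3 (cI_N i4).
rewrite !CI_B//; try exact: cI_D (cI_N _).
rewrite CI_J// !n2_CI CI_tpJ// n2_tp// cj_sum CRD !CRM !CR_sum.
rewrite -addrA -opprD !mulr_sumr -sumrB -big_split -sumrN; congr (_ + _).
apply: eq_bigr => m _ /=.
rewrite fcE; move: (fc F m) => c.
rewrite !cjM cjK CRB -!mulCJ cjB cjR.
ring.
Qed.

Lemma bessel (F : R -> R[i]) N : l2 F ->
  n2 (fun x => F x - tp (zs N) (fc F) x) =
  n2 F - 2 * pi * \sum_(n <- zs N) cabs (fc F n) ^+ 2.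
Proof.
move=> lF; rewrite n2_sub_tp ?uniq_zs// -mulrN -sumrN; congr (_ + _ * _).
by apply: eq_bigr => n _; rewrite subrr cabs0 expr0n /= sub0r.
Qed.

Lemma bessel_le (F : R -> R[i]) N : l2 F ->
  2 * pi * \sum_(n <- zs N) cabs (fc F n) ^+ 2 <= n2 F.
Proof. by move=> lF; rewrite -subr_ge0 -bessel// n2_ge0. Qed.

(** Allowing [N <= L] lets one good trigonometric polynomial control all later partial sums. *)
Lemma best_approx (F : R -> R[i]) N L b : l2 F -> (N <= L)%N ->
  n2 (fun x => F x - tp (zs L) (fc F) x) <= n2 (fun x => F x - tp (zs N) b x).
Proof.
move=> lF NL; rewrite bessel// n2_sub_tp ?uniq_zs// sumrB mulrBr.
have h1 : \sum_(n <- zs N) cabs (fc F n) ^+ 2 <= \sum_(n <- zs L) cabs (fc F n) ^+ 2.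
  apply: ler_sum_sub => [|||i _ _]; rewrite ?uniq_zs ?sqr_ge0// => i.
  by rewrite !mem_zs => h _; rewrite (leq_trans h).
have h2 : 0 <= \sum_(n <- zs N) cabs (fc F n - b n) ^+ 2.
  by apply: sumr_ge0 => i _; exact: sqr_ge0.
have p0 := twopi_ge0 R.
have := ler_wpM2l p0 h1; have := mulr_ge0 p0 h2; lra.
Qed.

Lemma tp_group (I : Type) (r : seq I) (k : I -> int) (c : I -> R[i]) s x : uniq s ->
  (forall i, k i \in s) ->
  \sum_(i <- r) c i * te (k i) x = tp s (fun n => \sum_(i <- r | n == k i) c i) x.
Proof.
move=> us ks; rewrite /tp; under [RHS]eq_bigr do rewrite mulr_suml big_mkcond /=.
rewrite exchange_big /=; apply: eq_bigr => i _; rewrite -big_mkcond.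
by rewrite (sum_eq1 (k i) (fun n => c i * te n x) us) ks.
Qed.

(** [N.+1] times the Fejer kernel, in the form that is visibly nonnegative and expands into a double
    sum of exponentials. *)
Definition fejer N (t : R) : R := cabs (\sum_(j < N.+1) te j%:Z t) ^+ 2.

Lemma fejerE N (x y : R) : (fejer N (x - y))%:C =
  \sum_(j < N.+1) \sum_(l < N.+1) te (j%:Z - l%:Z) x * te (l%:Z - j%:Z) y.
Proof.
rewrite /fejer -mulCJ cj_sum mulr_suml; apply: eq_bigr => j _.
rewrite mulr_sumr; apply: eq_bigr => l _.
rewrite -teN -teD /te -expiD; congr expi.
by rewrite !intrD !mulrNz; ring.
Qed.

Lemma cont_fejer N (x : R) : continuous (fun y => fejer N (x - y)).
Proof.
have : cC (fun y => (fejer N (x - y))%:C).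
  apply: (@cC_ext _ (fun y => \sum_(j < N.+1) \sum_(l < N.+1) te (j%:Z - l%:Z) x * te (l%:Z - j%:Z) y)).
    by move=> y; rewrite fejerE.
  by do 2 (apply: cC_sum => ?); apply: cC_M; [exact: cC_cst|exact: cC_te].
by case.
Qed.

Lemma CI_fejer N (x : R) (F : R -> R[i]) : l2 F ->
  CI (fun y => F y * (fejer N (x - y))%:C) =
  \sum_(j < N.+1) \sum_(l < N.+1) te (j%:Z - l%:Z) x *
    CI (fun y => F y * te (l%:Z - j%:Z) y).
Proof.
move=> lF.
have h (m : int) (z : R[i]) : cI (fun y => z * (F y * te m y)).
  by apply: cI_Z; apply: cI_M => //; exact/cC_l2/cC_te.
rewrite (@CI_ext _ _ (fun y => \sum_(j < N.+1) \sum_(l < N.+1)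
    te (j%:Z - l%:Z) x * (F y * te (l%:Z - j%:Z) y))).
  rewrite CI_sum => [|j _]; last by apply: cI_sum => l _.
  apply: eq_bigr => j _; rewrite CI_sum// ; apply: eq_bigr => l _.
  by rewrite CI_Z//; apply: cI_M => //; exact/cC_l2/cC_te.
move=> y _; rewrite fejerE mulr_sumr; apply: eq_bigr => j _.
by rewrite mulr_sumr; apply: eq_bigr => l _; rewrite mulrCA.
Qed.

Lemma II_fejer N (x : R) : II (fun y => fejer N (x - y)) = 2 * pi * N.+1%:R.
Proof.
apply: complexR_inj; rewrite -CI_R.
rewrite (@CI_ext _ _ (fun y => 1 * (fejer N (x - y))%:C)); last by move=> y _; rewrite mul1r.
rewrite CI_fejer; last exact/cC_l2/cC_cst.
rewrite rmorphM /= mulrC rmorph_nat -mulr_natr mul1r.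
rewrite -[X in _ = X%:R * _](card_ord N.+1) -sum1_card natr_sum mulr_suml.
apply: eq_bigr => j _; rewrite (bigD1 j)//= subrr te0 mul1r big1 ?addr0.
  by rewrite mul1r; rewrite (@CI_ext _ _ (te 0)) ?CI_te ?eqxx// => y _; rewrite mul1r.
move=> l lj; rewrite (@CI_ext _ _ (te (l%:Z - j%:Z))); last by move=> y _; rewrite mul1r.
rewrite CI_te ifF ?mulr0//; apply/negbTE; rewrite subr_eq0.
by apply: contra lj => /eqP[] h; apply/eqP/val_inj.
Qed.

(** The cosine shifts frequencies by one: [N] pairs [(j, j + 1)] survive, where the kernel alone has
    [N + 1] diagonal pairs. The relative defect [1 / N.+1] is the decay in the Korovkin argument. *)
Lemma II_fejer_cos N (x : R) :
  II (fun y => fejer N (x - y) * cos (x - y)) = 2 * pi * N%:R.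
Proof.
have c1 := cC_te R (-1).
have e : CI (fun y => te 1 x * te (-1) y * (fejer N (x - y))%:C) = (2 * pi * N%:R)%:C.
  rewrite CI_fejer; last by apply: cC_l2; apply: cC_M; [exact: cC_cst|].
  rewrite rmorphM /= mulrC rmorph_nat.
  have h (j l : nat) : te (j%:Z - l%:Z) x *
    CI (fun y => te 1 x * te (-1) y * te (l%:Z - j%:Z) y) =
    if (l == j.+1)%N then (2 * pi)%:C else 0.
    rewrite (@CI_ext _ _ (fun y => te 1 x * te (l%:Z - j%:Z - 1) y)); last first.
      by move=> y _; rewrite -mulrA -teD [- 1 + _]addrC.
    rewrite CI_Z; last exact/cC_cI/cC_te.
    rewrite CI_te mulrA -teD; case: eqP => [E|E]; last by rewrite mulr0 ifF//; lia.
    by rewrite (_ : j%:Z - l%:Z + 1 = 0) ?te0 ?mul1r ?ifT//; lia.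
  under eq_bigr => j _. under eq_bigr => l _ do rewrite h. over.
  rewrite big_ord_recr /= [X in _ + X]big1 ?addr0; last first.
    by move=> l _; rewrite ifF//; have := ltn_ord l; lia.
  rewrite -[X in _ = X%:R * _](card_ord N) -sum1_card natr_sum mulr_suml.
  apply: eq_bigr => j _; rewrite mul1r -big_mkcond /=.
  have jN : (j.+1 < N.+1)%N by rewrite ltnS ltn_ord.
  by rewrite (big_pred1 (Ordinal jN)) // => l; rewrite -val_eqE.
have := congr1 (@complex.Re R) e; rewrite Re_CI [RHS]/= => <-.
apply: II_ext => y _; rewrite cReM [X in _ - _ * X]/= mulr0 subr0 mulrC; congr (_ * _).
by rewrite /te -expiD /= mulrNz mulNr !mul1r.
Qed.


Definition Fejer_mean (F : R -> R[i]) N (x : R) : R[i] :=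
  ((2 * pi * N.+1%:R)^-1)%:C * CI (fun y => F y * (fejer N (x - y))%:C).

Lemma Fejer_mean_tp (F : R -> R[i]) N : l2 F ->
  exists b, forall x, Fejer_mean F N x = tp (zs N) b x.
Proof.
move=> lF.
pose k (p : 'I_N.+1 * 'I_N.+1) : int := p.1%:Z - p.2%:Z.
pose c (p : 'I_N.+1 * 'I_N.+1) := ((2 * pi * N.+1%:R)^-1)%:C * CI (fun y => F y * te (- k p) y).
exists (fun n => \sum_(i | n == k i) c i) => x.
rewrite -(tp_group (index_enum _)) ?uniq_zs//; last first.
  by move=> -[i j]; rewrite mem_zs /k /=; have := ltn_ord i; have := ltn_ord j; lia.
rewrite /Fejer_mean CI_fejer// pair_big mulr_sumr; apply: eq_bigr => p _.
have -> : CI (fun y => F y * te (p.2%:Z - p.1%:Z) y) = CI (fun y => F y * te (- k p) y).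
  by apply: CI_ext => y _; rewrite /k opprB.
by rewrite /c /k mulrCA mulrC.
Qed.

(** Used twice: to keep [1 - cos (x - y)] away from 0 for [y] far from [x], and to keep
    [1 - cos (n * h)] away from 0 on a dyadic block. *)
Lemma cos_lt1 (d t : R) : 0 < d -> d <= `|t| -> `|t| <= 2 * pi - d -> cos t <= cos d.
Proof.
move=> d0; wlog t0 : t / 0 <= t => [W|].
  have [/W//|t0] := leP 0 t; rewrite -cosN -(normrN t); apply: W.
  by rewrite oppr_ge0 ltW.
rewrite (ger0_norm t0) => dt td.
have p0 := pi_gt0 R.
have [tp|tp] := leP t pi.
  rewrite le_eqVlt; have [->|ne] := eqVneq t d; first by rewrite eqxx.
  apply/orP; right; rewrite ltr_cos ?in_itv /= ?t0 ?(ltW d0) ?(le_trans dt tp)//.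
  by rewrite lt_neqAle eq_sym ne.
have e : cos t = cos (2 * pi - t) by rewrite mulr_natl cosB cos2pi sin2pi; ring.
rewrite e le_eqVlt; have [->|ne] := eqVneq (2 * pi - t) d; first by rewrite eqxx.
apply/orP; right; rewrite ltr_cos ?in_itv /=; first by rewrite lt_neqAle eq_sym ne /=; lra.
- by apply/andP; split; lra.
- by apply/andP; split; lra.
Qed.

(* Korovkin: the Fejer mean of [e + C * (1 - cos (x - y))] is [e + C / N.+1]. *)
Lemma Fejer_mean_sub (f : R -> R) N (x e C : R) : continuous f ->
  (forall y, D y -> `|f y - f x| <= e + C * (1 - cos (x - y))) ->
  cabs (Fejer_mean (fun y => (f y)%:C) N x - (f x)%:C) <= e + C / N.+1%:R.
Proof.
move=> cf H.
have w0 : 0 < 2 * pi * N.+1%:R :> R by rewrite mulr_gt0 ?ltr0Sn// twopi_gt0.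
have cfj := @cont_fejer N x.
have cs : continuous (fun y : R => cos (x - y)).
  move=> y; apply: continuous_comp; last exact: continuous_cos.
  by apply: cvgB; [exact: cvg_cst|exact: cvg_id].
have -> : Fejer_mean (fun y => (f y)%:C) N x - (f x)%:C =
  ((2 * pi * N.+1%:R)^-1)%:C * CI (fun y => ((f y - f x) * fejer N (x - y))%:C).
  rewrite /Fejer_mean (@CI_ext _ _ (fun y => (f y * fejer N (x - y))%:C)); last first.
    by move=> y _; rewrite CRM.
  rewrite !CI_R -!CRM -CRB; congr (_%:C).
  rewrite (@II_ext _ (fun y => (f y - f x) * _) (fun y => f y * fejer N (x - y) - f x * fejer N (x - y))); last first.
    by move=> y _; rewrite mulrBl.
  rewrite II_B; [|by apply: iD_cont; exact: contM|by apply: iD_Z; exact: iD_cont].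
  rewrite II_Z ?II_fejer; last exact: iD_cont.
  by rewrite mulrBr [_ * (f x * _)]mulrCA mulVf ?mulr1// gt_eqF.
rewrite cabsM cabsR gtr0_norm ?invr_gt0// mulrC ler_pdivrMr//.
rewrite CI_R cabsR (le_trans (II_abs _))//.
  by apply: iD_cont; apply: contM => //; apply: contD => //; exact: cst_continuous.
have i1 := iD_cont cfj.
have i2 : iD (fun y => fejer N (x - y) * cos (x - y)) by apply: iD_cont; exact: contM.
apply: (@le_trans _ _ (II (fun y => (e + C) * fejer N (x - y) - C * (fejer N (x - y) * cos (x - y))))).
  apply: II_le.
  - apply: iD_abs; apply: iD_cont; apply: contM => //; apply: contD => //; exact: cst_continuous.
  - by apply: iD_B; exact: iD_Z.
  - move=> y Dy; rewrite normrM [`|fejer _ _|]ger0_norm ?sqr_ge0//.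
    have := ler_wpM2r (sqr_ge0 _ : 0 <= fejer N (x - y)) (H y Dy); lra.
rewrite II_B ?II_Z ?II_fejer ?II_fejer_cos//; try exact: iD_Z.
rewrite le_eqVlt; apply/orP; left; apply/eqP.
have -> : N%:R = N.+1%:R - 1 :> R by rewrite -natr1 addrK.
have : N.+1%:R != 0 :> R by rewrite pnatr_eq0.
by move: (N.+1%:R) => a a0; field.
Qed.

Lemma Fejer_mean_cvg (f : R -> R) (K x : R) : continuous f ->
  (forall y, `|f y| <= K) -> 0 < x < 2 * pi ->
  cabs (Fejer_mean (fun y => (f y)%:C) N x - (f x)%:C) @[N --> \oo] --> 0.
Proof.
move=> cf fK /andP[x0 x1]; have p0 := pi_gt0 R.
have K0 : 0 <= K by rewrite (le_trans _ (fK 0)).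
apply/cvgrPdist_le => e e0.
have e20 : 0 < e / 2 by rewrite divr_gt0.
have /cvgrPdist_le/(_ _ e20)/nbhs_ballP[d0 /= d0p hd0] := cf x.
(* [f] need not be periodic, so [x - y] must also stay at distance [d] from [2 * pi] and [- 2 * pi],
   where the cosine returns to 1; hence the bounds by [x] and [2 * pi - x]. *)
pose d := Num.min (d0 / 2) (Num.min x (2 * pi - x)).
have dp : 0 < d by rewrite !lt_min x0 divr_gt0//= subr_gt0.
have [dd dx dpx] : [/\ d <= d0 / 2, d <= x & d <= 2 * pi - x].
  by rewrite /d !ge_min !lexx !orbT.
have cd1 : cos d < 1.
  rewrite -cos0 ltr_cos ?in_itv /= ?lexx ?(ltW p0)//.
  by apply/andP; split; lra.
(* [C * (1 - cos d)] equals [2 * K], the trivial bound on the increments of [f]. *)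
pose C := 2 * K / (1 - cos d).
have C0 : 0 <= C by rewrite divr_ge0 ?mulr_ge0// subr_ge0 ltW.
have H y : D y -> `|f y - f x| <= e / 2 + C * (1 - cos (x - y)).
  rewrite /torus_dom /= in_itv /= => /andP[y0 y1].
  have [h|h] := ltP `|x - y| d.
    apply: (@le_trans _ _ (e / 2)); last first.
      by rewrite lerDl mulr_ge0// subr_ge0 cos_le1.
    rewrite distrC; apply: hd0; rewrite /ball /= (lt_le_trans h)// (le_trans dd)//; lra.
  have c1 : cos (x - y) <= cos d.
    by apply: cos_lt1 => //; rewrite ler_norml; apply/andP; split; lra.
  apply: (@le_trans _ _ (2 * K)).
    by rewrite (le_trans (ler_normB _ _))// mulrDl mul1r lerD.
  have : 2 * K <= C * (1 - cos (x - y)).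
    rewrite /C mulrAC ler_pdivlMr ?subr_gt0// ler_wpM2l ?mulr_ge0//; lra.
  by move: e20; lra.
have hN : C / N.+1%:R @[N --> \oo] --> 0.
  rewrite -(mulr0 C); apply: cvgM; [exact: cvg_cst|exact: cvg_harmonic].
have /cvgrPdist_le/(_ _ e20) [M _ hM] := hN.
exists M => // N MN; rewrite /= sub0r normrN ger0_norm ?cabs_ge0//.
apply: (le_trans (Fejer_mean_sub N cf H)).
have h2 : C / N.+1%:R <= e / 2.
  by have := hM N MN; rewrite /= sub0r normrN ger0_norm// divr_ge0.
by rewrite [leRHS](splitr e) lerD2l.
Qed.

Lemma Fejer_mean_bnd (f : R -> R) (K : R) N x : continuous f ->
  (forall y, `|f y| <= K) -> cabs (Fejer_mean (fun y => (f y)%:C) N x - (f x)%:C) <= 2 * K.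
Proof.
move=> cf fK; have := @Fejer_mean_sub f N x (2 * K) 0 cf.
rewrite mul0r addr0; apply => y _; rewrite mul0r addr0.
by rewrite (le_trans (ler_normB _ _))// mulrDl mul1r lerD.
Qed.

Lemma Fejer_mean_n2 (f : R -> R) (K : R) : continuous f -> (forall y, `|f y| <= K) ->
  n2 (fun x => (f x)%:C - Fejer_mean (fun y => (f y)%:C) N x) @[N --> \oo] --> 0.
Proof.
move=> cf fK; have lf : l2 (fun y => (f y)%:C) by apply: cC_l2; exact: cC_R.
have cF N : cC (Fejer_mean (fun y => (f y)%:C) N).
  by have [b /funext ->] := Fejer_mean_tp N lf; exact: cC_tp.
have cG N : cC (fun x => (f x)%:C - Fejer_mean (fun y => (f y)%:C) N x).
  by apply: cC_B => //; exact: cC_R.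
pose h N x := cabs ((f x)%:C - Fejer_mean (fun y => (f y)%:C) N x) ^+ 2.
have ch N : continuous (h N) by apply: contX; exact: cont_cabs.
have : II (fun x => `|h N x - 0|) @[N --> \oo] --> 0.
  apply: (@II_dct _ h (fun=> 0) (fun=> (2 * K) ^+ 2)).
  - by move=> N; exact: mD_cont.
  - exact: measurable_cst.
  - exact: iD_cst.
  - move=> x hx; rewrite /h; under eq_fun do rewrite cabsBC expr2.
    by rewrite -(mulr0 0); apply: cvgM; exact: (Fejer_mean_cvg cf fK).
  - move=> N x _; rewrite ger0_norm ?sqr_ge0//.
    rewrite lerXn2r ?nnegrE ?cabs_ge0 ?mulr_ge0 ?(le_trans _ (fK 0))//.
    by rewrite cabsBC; exact: Fejer_mean_bnd.
apply: cvg_trans; apply: near_eq_cvg; apply: nearW => N /=.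
by apply: II_ext => x _; rewrite subr0 ger0_norm// sqr_ge0.
Qed.

Definition clip (K x : R) : R := Num.max (- K) (Num.min x K).

Lemma clip_bnd K x : 0 <= K -> `|clip K x| <= K.
Proof. by move=> K0; rewrite ler_norml /clip le_max lexx /= ge_max ge_min lexx orbT andbT; lra. Qed.

Lemma clip_id K x : `|x| <= K -> clip K x = x.
Proof. by rewrite ler_norml /clip => /andP[h1 h2]; rewrite min_l// max_r. Qed.

Lemma clip_lip K x y : 0 <= K -> `|clip K x - clip K y| <= `|x - y|.
Proof.
move=> K0; rewrite /clip; have [h1|h1] := leP x K; have [h2|h2] := leP y K.
all: try (have [h3|h3] := leP (- K) x); try (have [h4|h4] := leP (- K) y).
all: try (have [h5|h5] := leP (- K) K); try lra.
all: have := ler_norm (x - y); have := ler_norm (y - x); rewrite (distrC y) => ? ?.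
all: by rewrite ler_norml; apply/andP; split; lra.
Qed.

Lemma clip_le K x : 0 <= K -> `|x - clip K x| <= `|x|.
Proof.
move=> K0; have [h|h] := leP `|x| K; first by rewrite clip_id// subrr normr0.
move: h; rewrite /clip; have [h1|h1] := leP x K; have [h2|h2] := leP (- K) x;
  have [h3|h3] := leP (- K) K; try lra.
all: have := ler_norm x; have := ler_norm (- x); rewrite normrN => ? ? ?.
all: by rewrite ler_norml; apply/andP; split; lra.
Qed.

Lemma continuous_clip K : continuous (clip K).
Proof.
have [K0|K0] := ltP K 0.
  have e : clip K = fun=> - K.
    by apply/funext => x; rewrite /clip max_l// ge_min (@le_trans _ _ 0 K (- K)) ?orbT; lra.
  by rewrite e; exact: cst_continuous.
move=> x; apply/cvgrPdist_le => d d0.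
have /cvgrPdist_le/(_ _ d0) : id @ x --> x by exact: cvg_id.
by apply: filterS => y; apply: le_trans; exact: clip_lip.
Qed.

(* Clipping a continuous L^1 approximant of the clipped function turns L^1 into L^2. *)
Lemma l2_density (f : R -> R) (e : R) : l2 (fun x => (f x)%:C) -> 0 < e ->
  exists (h : R -> R) (K : R), [/\ continuous h, forall x, `|h x| <= K &
    n2 (fun x => (f x)%:C - (h x)%:C) < e].
Proof.
move=> lf e0; have [mf _] := lf; have {}mf : mD f := mf.1.
have i2 : iD (fun x => f x ^+ 2).
  by apply: iD_ext lf.2 => x _; rewrite cabsR real_normK// num_real.
have mc (K : R) : mD (fun x => clip K (f x)).
  by apply: measurableT_comp => //; apply: continuous_measurable_fun; exact: continuous_clip.
have [K K0 hK] : exists2 K : R, 0 < K & n2 (fun x => (f x)%:C - (clip K (f x))%:C) < e / 4.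
  pose h (N : nat) x := (f x - clip N.+1%:R (f x)) ^+ 2.
  have : II (fun x => `|h N x - 0|) @[N --> \oo] --> 0.
    apply: (@II_dct _ h (fun=> 0) (fun x => f x ^+ 2)) => //.
    - move=> N; apply: (@measurable_funX _ _ _ _ (fun x => f x - clip N.+1%:R (f x)) 2).
    exact: (measurable_funB mf (mc _)).
    - exact: measurable_cst.
    - move=> x _; apply: cvg_near_cst; near=> N.
      rewrite /h clip_id ?subrr ?expr0n//; near: N.
      have := @archi_boundP R `|f x| (normr_ge0 _); set M := Num.bound _ => hM.
      by exists M => // N MN /=; rewrite (le_trans (ltW hM))// ler_nat ltnW.
    - move=> N x _; rewrite ger0_norm ?sqr_ge0// /h.
      rewrite -[leLHS]real_normK ?num_real// -[leRHS]real_normK ?num_real//.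
      by rewrite lerXn2r ?nnegrE// clip_le.
  move=> /cvgrPdist_lt/(_ (e / 4)); rewrite divr_gt0// => /(_ isT)[N _ /(_ N (leqnn N))].
  rewrite /= sub0r normrN ger0_norm; last by apply: II_ge0.
  move=> hN; exists N.+1%:R => //; apply: le_lt_trans hN.
  rewrite le_eqVlt; apply/orP; left; apply/eqP; apply: II_ext => x _.
  by rewrite -CRB cabsR subr0 real_normK ?num_real// ger0_norm// sqr_ge0.
have ic : iD (fun x => clip K (f x)).
  by apply: (@iD_bnd _ _ K) => // x _; apply: clip_bnd; exact: ltW.
have [g_ [cg ig]] := approximation_continuous_integrable (@measurable_torus_dom R) (@mu_torus_lty R) ic.
move=> hg; have {}hg : fine (\int[mu]_(z in D) `|(clip K (f z) - g_ n z)%:E|)%E @[n --> \oo] --> 0.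
  exact: fine_cvg hg.
have eK : 0 < e / 4 / (2 * K) by rewrite !divr_gt0// mulr_gt0.
move/cvgrPdist_lt : hg => /(_ _ eK)[N _ /(_ N (leqnn N))].
rewrite /= sub0r normrN; set I1 := fine _ => hI.
exists (fun x => clip K (g_ N x)), K; split.
- move=> x; apply: continuous_comp; [exact: cg|exact: continuous_clip].
- by move=> x; apply: clip_bnd; exact: ltW.
have cgc : continuous (fun x => clip K (g_ N x)).
  by move=> x; apply: continuous_comp; [exact: cg|exact: continuous_clip].
pose A x := (f x)%:C - (clip K (f x))%:C.
pose B x := (clip K (f x))%:C - (clip K (g_ N x))%:C.
have lc : l2 (fun x => (clip K (f x))%:C).
  apply: (@l2_bnd _ _ K); first exact: mC_R.
  by move=> x _; rewrite cabsR; apply: clip_bnd; exact: ltW.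
have lB : l2 B by apply: l2_B => //; apply: cC_l2; exact: cC_R.
have lA : l2 A by exact: l2_B.
have -> : n2 (fun x => (f x)%:C - (clip K (g_ N x))%:C) = n2 (fun x => A x + B x).
  by apply: n2_ext => x _; rewrite /A /B addrA subrK.
apply: (le_lt_trans (n2_D lA lB)).
have iI : iD (fun x => `|clip K (f x) - g_ N x|).
  by apply: iD_abs; apply: iD_B => //; exact: iD_cont.
have hB : n2 B <= 2 * K * I1.
  rewrite (_ : I1 = II (fun x => `|clip K (f x) - g_ N x|)) //.
  rewrite -II_Z//; apply: II_le; [by case: lB|exact: iD_Z|move=> x _].
  rewrite /B -CRB cabsR expr2 ler_pM//.
    by rewrite (le_trans (ler_normB _ _))// mulrDl mul1r lerD// clip_bnd// ltW.
  have := @clip_lip K (clip K (f x)) (g_ N x) (ltW K0).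
  by rewrite (@clip_id K (clip K (f x)))// clip_bnd// ltW.
have : 2 * K * I1 < e / 4.
  rewrite mulrC -ltr_pdivlMr ?mulr_gt0//.
  by apply: le_lt_trans hI; rewrite ler_norm.
by rewrite -/A in hK; lra.
Unshelve. all: by end_near. Qed.

(** [f] is close to a bounded continuous [h], and [h] to one of its Fejer means, a trigonometric
    polynomial of degree [N]. By [best_approx] all partial sums of [f] from [N] on are at least as
    close. *)
Lemma completeness (f : R -> R) (e : R) : l2 (fun x => (f x)%:C) -> 0 < e ->
  exists L0, forall L, (L0 <= L)%N ->
  n2 (fun x => (f x)%:C - tp (zs L) (fourier_coef f) x) < e.
Proof.
move=> lf e0; have [h [K [ch hK hn]]] := l2_density lf (divr_gt0 e0 (ltr0n _ 4)).
have lh : l2 (fun x => (h x)%:C) by apply: cC_l2; exact: cC_R.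
have /cvgrPdist_lt/(_ _ (divr_gt0 e0 (ltr0n R 4)))[N _ /(_ N (leqnn N))] := Fejer_mean_n2 ch hK.
rewrite /= sub0r normrN ger0_norm ?n2_ge0// => hF.
exists N => L NL; have [b hb] := Fejer_mean_tp N lh.
rewrite (_ : fourier_coef f = fc (fun x => (f x)%:C)); last by apply/funext => n; rewrite fourier_coefE.
apply: (le_lt_trans (best_approx b lf NL)).
have l1 : l2 (fun x => (f x)%:C - (h x)%:C) by exact: l2_B.
have l2' : l2 (fun x => (h x)%:C - tp (zs N) b x) by apply: l2_B => //; exact: l2_tp.
rewrite (@n2_ext _ _ (fun x => ((f x)%:C - (h x)%:C) + ((h x)%:C - tp (zs N) b x))); last first.
  by move=> x _; rewrite addrA subrK.
apply: (le_lt_trans (n2_D l1 l2')).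
move: hF; rewrite (@n2_ext _ _ (fun x => (h x)%:C - tp (zs N) b x)); last by move=> x _; rewrite hb.
by move=> hF; lra.
Qed.

End Completeness.

(** * Functions of bounded variation *)

Section PeriodicBV.
Variable R : realType.
Notation mu := (@lebesgue_measure R).
Notation D := (@torus_dom R).
Implicit Types (f g : R -> R).

Lemma periodic_int (T : Type) (f : R -> T) (k : int) x :
  (forall y, f (y + 2 * pi) = f y) -> f (x + k%:~R * (2 * pi)) = f x.
Proof.
move=> pf; have h (n : nat) y : f (y + n%:R * (2 * pi)) = f y.
  elim: n y => [|n ih] y; first by rewrite mul0r addr0.
  by rewrite -natr1 mulrDl mul1r addrA pf ih.
case: k => n; first exact: h.
rewrite NegzE mulrNz mulNr -[RHS](h n.+1).
by rewrite -[in LHS](h n.+1) subrK h.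
Qed.

Definition tmod (x : R) : R := x - (Num.floor (x / (2 * pi)))%:~R * (2 * pi).

Lemma tmod_dom x : 0 <= tmod x < 2 * pi.
Proof.
have p0 := twopi_gt0 R.
rewrite /tmod subr_ge0 -ler_pdivlMr// floor_le_tmp ltrBlDr.
rewrite -[X in _ < X + _]mul1r -mulrDl addrC -ltr_pdivrMr//.
have := floorD1_gt (x / (2 * pi)); rewrite intrD /=; exact.
Qed.

Lemma tmodE (T : Type) (f : R -> T) x :
  (forall y, f (y + 2 * pi) = f y) -> f (tmod x) = f x.
Proof.
move=> pf; rewrite -(periodic_int (Num.floor (x / (2 * pi))) (tmod x) pf).
by rewrite /tmod subrK.
Qed.

Lemma measurable_periodic f : torus_fun f -> mD f -> measurable_fun setT f.
Proof.
move=> pf mf; rewrite (_ : f = f \o tmod); last by apply/funext => x /=; rewrite tmodE.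
apply: (@measurable_comp _ _ _ _ _ _ D) => //; first exact: measurable_torus_dom.
  by move=> _ [x _ <-]; rewrite /torus_dom /= in_itv /=; have /andP[-> /ltW ->] := tmod_dom x.
apply: measurable_funB => //; apply: measurable_funM => //.
apply: nondecreasing_measurable => // x y xy.
by rewrite ler_int; apply: le_floor; rewrite ler_pM2r// invr_gt0 twopi_gt0.
Qed.

Section BV.
Variable g : R -> R.
Hypothesis gBV : BV_torus g.
Let pg : torus_fun g := gBV.1.
Let bg : bounded_variation 0 (2 * pi) g := gBV.2.

(** Clamping to the period turns the negative variation, monotone on [[0, 2 * pi]], into a function
    monotone on the whole line. *)
Let cl (x : R) : R := Num.min (Num.max x 0) (2 * pi).

Let cl_nd : {homo cl : x y / x <= y}.
Proof. by move=> x y xy; rewrite /cl le_min !ge_min ge_max !le_max xy !lexx !orbT. Qed.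

Let cl_in x : cl x \in `[0, 2 * pi].
Proof. by rewrite in_itv /= /cl le_min twopi_ge0 le_max lexx orbT ge_min lexx orbT. Qed.

Let cl_id x : D x -> cl x = x.
Proof. by rewrite /torus_dom /= in_itv /= /cl => /andP[h1 h2]; rewrite max_l// min_l. Qed.

Lemma BV_mD : mD g.
Proof.
have bN : bounded_variation 0 (2 * pi) (\- g) by exact/bounded_variationN.
pose P x := fine (neg_tv 0 (\- g) (cl x)); pose N x := fine (neg_tv 0 g (cl x)).
have mP : measurable_fun D P.
  apply: nondecreasing_measurable => // x y xy.
  by apply: (fine_neg_tv_nondecreasing bN (cl_in x) (cl_in y)); exact: cl_nd.
have mN : measurable_fun D N.
  apply: nondecreasing_measurable => // x y xy.
  by apply: (fine_neg_tv_nondecreasing bg (cl_in x) (cl_in y)); exact: cl_nd.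
apply: eq_measurable_fun (measurable_funB mP mN) => x; rewrite inE => Dx.
rewrite /P /N /= cl_id//.
by rewrite (bounded_variation_pos_neg_tvE bg)// ; move: Dx; rewrite /torus_dom /= in_itv.
Qed.

Definition tvf x : R := fine (total_variation 0 x g).

(** Every quantitative use of bounded variation goes through this domination by the increments of
    one monotone function. *)
Lemma tvf_le x y : 0 <= x -> x <= y -> y <= 2 * pi -> `|g y - g x| <= tvf y - tvf x.
Proof.
move=> x0 xy y1; have y0 := le_trans x0 xy.
have bx := bounded_variationl x0 (le_trans xy y1) bg.
have by_ := bounded_variationl y0 y1 bg.
have bxy := bounded_variationr x0 xy by_.
have fx := (bounded_variationP _ x0).1 bx.
have fxy := (bounded_variationP _ xy).1 bxy.
rewrite /tvf (total_variationD g x0 xy) fineD// addrAC subrr add0r -lee_fin fineK//.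
exact: total_variation_ge.
Qed.

Lemma BV_bounded : exists B : R, forall x, `|g x| <= B.
Proof.
exists (`|g 0| + tvf (2 * pi)) => x; rewrite -(tmodE x pg).
have /andP[h0 h1] := tmod_dom x; move: (tmod x) h0 h1 => y y0 y1.
rewrite -[g y](subrK (g 0)) addrC (le_trans (ler_normD _ _))// lerD2l.
have := tvf_le (lexx 0) y0 (ltW y1); have := tvf_le y0 (ltW y1) (lexx _).
have t0 : tvf 0 = 0 by rewrite /tvf total_variationxx.
by have := normr_ge0 (g (2 * pi) - g y); rewrite t0; lra.
Qed.

Lemma BV_l2 : l2 (fun x => (g x)%:C).
Proof.
have [B hB] := BV_bounded; apply: (@l2_bnd _ _ B); first by apply: mC_R; exact: BV_mD.
by move=> x _; rewrite cabsR.
Qed.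

Lemma BV_L2_torus : L2_torus g.
Proof.
apply: l2_L2_torus => //; last exact: BV_l2.
by apply: measurable_periodic => //; exact: BV_mD.
Qed.

(* Cut the period into [`|n|] periods of [te n]: on each of them [g] may be replaced
   by its value at the left end, at the cost of its variation there. *)
Lemma BV_fourier_coef : exists2 C : R, 0 <= C & forall n : int, n != 0 ->
  cabs (fourier_coef g n) <= C / `|n%:~R|.
Proof.
have t0 : 0 <= tvf (2 * pi).
  have := tvf_le (lexx 0) (twopi_ge0 R) (lexx _).
  have -> : tvf 0 = 0 by rewrite /tvf total_variationxx.
  by rewrite subr0; exact: le_trans.
exists (tvf (2 * pi)) => // n n0.
pose N := `|n|%N; have N0 : (0 < N)%N by rewrite absz_gt0.
have NR : 0 < N%:R :> R by rewrite ltr0n.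
pose h : R := 2 * pi / N%:R; have h0 : 0 < h by rewrite divr_gt0 ?twopi_gt0.
have hN : N%:R * h = 2 * pi by rewrite /h mulrC divfK// gt_eqF.
have nh : te n h = 1.
  rewrite /te; have -> : (n%:~R : R) * h = (sgz n)%:~R * (2 * pi).
    by rewrite -hN [RHS]mulrA; congr (_ * h); rewrite [in LHS](intEsg n) intrM.
  exact: expi_2pi_int.
pose a j : R := j%:R * h.
have aS j : a j.+1 = a j + h by rewrite /a -natr1 mulrDl mul1r.
have a0 j : 0 <= a j by rewrite mulr_ge0 ?ler0n// ltW.
have aN j : (j <= N)%N -> a j <= 2 * pi.
  by move=> jN; rewrite -hN ler_pM2r// ler_nat.
pose A j : set R := `[a j, a j.+1[%classic.
have mA j : measurable (A j) by exact: measurable_itv.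
have AD j : (j < N)%N -> A j `<=` D.
  move=> jN x; rewrite /A /torus_dom /= !in_itv /= => /andP[h1 h2].
  by rewrite (le_trans (a0 j))//= (le_trans (ltW h2))// aN.
pose s x := \sum_(j < N) \1_(A j) x * g (a j).
pose b x := \sum_(j < N) \1_(A j) x * (tvf (a j.+1) - tvf (a j)).
have iA j (c : R) : iD (fun x => \1_(A j) x * c).
  by apply: iD_indic => //; exact: iD_cst.
have ib : iD b by apply: iD_sum => j _; exact: iA.
have is_ : iD s by apply: iD_sum => j _; exact: iA.
(* The right end [2 * pi] lies in no half-open cell, hence the open interval. *)
have gs x : 0 < x < 2 * pi -> `|g x - s x| <= b x.
  move=> /andP[x0 x1]; pose j := Num.truncn (x / h).
  have xh : 0 <= x / h by rewrite divr_ge0 ?ltW.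
  have /andP[j1 j2] := truncn_itv xh.
  have Aj : A j x.
    by rewrite /A /= in_itv /= /a -ler_pdivlMr// j1 -ltr_pdivrMr.
  have jN : (j < N)%N.
    rewrite -(ltr_nat R); apply: (le_lt_trans j1).
    by rewrite ltr_pdivrMr// hN.
  have Ai i : i != j -> \1_(A i) x = 0 :> R.
    move=> ij; rewrite indicE memNset// /A /= in_itv /= => /andP[i1 i2].
    move/eqP : ij; apply; apply/eqP; rewrite eq_sym.
    have := truncn_def (x := x / h) (n := i); rewrite -/j => -> //.
    by rewrite ler_pdivlMr// ltr_pdivrMr// i1.
  have Aj1 : \1_(A j) x = 1 :> R by rewrite indicE mem_set.
  have e (F : nat -> R) : \sum_(i < N) \1_(A i) x * F i = F j.
    rewrite (bigD1 (Ordinal jN))//= Aj1 mul1r big1 ?addr0// => i ij.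
    by rewrite Ai ?mul0r//; apply: contra ij => /eqP ij; apply/eqP/val_inj.
  rewrite /s /b (e (fun i => g (a i))) (e (fun i => tvf (a i.+1) - tvf (a i))).
  move: Aj; rewrite /A /= in_itv /= => /andP[h1 h2].
  apply: (le_trans (tvf_le (a0 j) h1 (ltW x1))); rewrite lerD2r.
  have := tvf_le (ltW x0) (ltW h2) (aN _ jN).
  by have := normr_ge0 (g (a j.+1) - g x); lra.
have ls : l2 (fun x => (s x)%:C).
  have bs x : `|s x| <= \sum_(j < N) `|g (a j)|.
    rewrite (le_trans (ler_norm_sum _ _ _))//; apply: ler_sum => j _.
    by rewrite normrM indicE normr_nat ler_piMl// lern1 leq_b1.
  apply: (@l2_bnd _ _ (\sum_(j < N) `|g (a j)|)); first by apply: mC_R; exact: mD_iD.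
  by move=> x _; rewrite cabsR.
have lg := BV_l2.
have ltn : l2 (te (R := R) (- n)) by exact/cC_l2/cC_te.
(* [s] is constant on each cell, and a cell is a full period of the exponential. *)
have CIs : CI (fun x => (s x)%:C * te (- n) x) = 0.
  rewrite (@CI_ext _ _ (fun x => \sum_(j < N) (g (a j))%:C * ((\1_(A j) x)%:C * te (- n) x))); last first.
    move=> x _; rewrite CR_sum mulr_suml; apply: eq_bigr => j _.
    by rewrite CRM mulrA [X in X * _]mulrC.
  have lA j : l2 (fun x => (\1_(A j) x)%:C).
    apply: (@l2_bnd _ _ 1); first by apply: mC_R; exact: measurable_indic.
    by move=> x _; rewrite cabsR indicE normr_nat lern1 leq_b1.
  rewrite CI_sum => [|j _]; last by apply: cI_Z; exact: cI_M.
  apply: big1 => j _; rewrite CI_Z; last exact: cI_M.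
  have jN := ltn_ord j.
  have -> : CI (fun x => (\1_(A j) x)%:C * te (- n) x) = cintegral `[a j, a j.+1] (te (- n)).
    have [c1 c2] := cC_te R (- n).
    have sub : A j `<=` `[a j, a j.+1]%classic by move=> x; rewrite /A /= !in_itv /= => /andP[-> /ltW ->].
    have ci (F : R -> R) : continuous F ->
        mu.-integrable (A j) (EFin \o F).
      move=> cF; apply: integrableS (iD_cont cF) => //; [exact: measurable_torus_dom|exact: mA|exact: AD].
    apply: ReImP; rewrite ?Re_CI ?Im_CI.
      rewrite /cintegral [RHS]/= -Rintegral_itv_bndo_bndc; last exact: ci.
      rewrite -II_indic; last exact: AD.
      by apply: II_ext => x _; rewrite cReM /= mul0r subr0.
    rewrite /cintegral [RHS]/= -Rintegral_itv_bndo_bndc; last exact: ci.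
    rewrite -II_indic; last exact: AD.
    by apply: II_ext => x _; rewrite cImM /= mul0r addr0.
  rewrite cint_te_period ?mulr0 ?oppr_eq0//; first by rewrite aS ltrDl.
  by rewrite aS /te mulrDr expiD -!/(te _ _) teN [X in _ * X]teN nh cj1 mulr1.
rewrite fourier_coefE /fc.
have -> : CI (fun x => (g x)%:C * te (- n) x) = CI (fun x => ((g x)%:C - (s x)%:C) * te (- n) x).
  rewrite [RHS](@CI_ext _ _ (fun x => (g x)%:C * te (- n) x - (s x)%:C * te (- n) x)); last first.
    by move=> x _; rewrite mulrBl.
  by rewrite CI_B ?CIs ?subr0//; exact: cI_M.
rewrite cabsM cabsR ger0_norm ?invr_ge0 ?twopi_ge0//.
have c1 : cI (fun x => ((g x)%:C - (s x)%:C) * te (- n) x) by apply: cI_M => //; exact: l2_B.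
have : II (fun x => cabs (((g x)%:C - (s x)%:C) * te (- n) x)) <= II b.
  apply: II_le_oo => //; first exact: iD_cabs.
  by move=> x hx; rewrite cabsM cabs_te mulr1 -CRB cabsR gs.
move=> /(le_trans (cabs_CI c1)) Hb.
have IIb : II b <= h * tvf (2 * pi).
  rewrite /b II_sum => [|j _]; last exact: iA.
  have -> : h * tvf (2 * pi) = \sum_(j < N) h * (tvf (a j.+1) - tvf (a j)).
    rewrite -mulr_sumr; congr (_ * _).
    rewrite -(big_mkord xpredT (fun j => tvf (a j.+1) - tvf (a j))) telescope_sumr//.
    by rewrite /a hN mul0r /tvf total_variationxx subr0.
  apply: ler_sum => j _; have jN := ltn_ord j.
  have -> : II (fun x => \1_(A j) x * (tvf (a j.+1) - tvf (a j)))
     = (tvf (a j.+1) - tvf (a j)) * h.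
    rewrite II_indic; last exact: AD.
    rewrite Rintegral_cst; last exact: mA.
    congr (_ * _).
    have muA : mu `[a j, a j.+1[%classic = h%:E.
      by rewrite lebesgue_measure_itv /= lte_fin aS ltrDl h0 -EFinB addrAC subrr add0r.
    exact: (congr1 fine muA).
  by rewrite mulrC.
apply: (@le_trans _ _ ((2 * pi)^-1 * (h * tvf (2 * pi)))).
  by rewrite ler_wpM2l ?invr_ge0 ?twopi_ge0// (le_trans Hb).
have -> : `|n%:~R| = N%:R :> R by rewrite -intr_norm -abszE.
have p0 := twopi_gt0 R.
have -> : (2 * pi)^-1 * (h * tvf (2 * pi)) = tvf (2 * pi) / N%:R.
  by rewrite /h -mulrA mulKf ?gt_eqF// mulrC.
by [].
Qed.

End BV.
End PeriodicBV.

(** * Box dimension and the L^1 modulus of continuity *)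

Section BoxDimension.
Variable R : realType.
Notation mu := (@lebesgue_measure R).
Notation D := (@torus_dom R).
Implicit Types (v : R -> R).

(** Induction on the number of centers: once a center [c] near the left end [a] is discarded with
    all its copies, the others still cover [[c + h, b]]. *)
Lemma cover_len (s : seq R) (a b h : R) : 0 < h ->
  (forall y, a <= y -> y <= b -> has (fun c => `|y - c| < h) s) ->
  b - a <= 2 * h * (size s)%:R.
Proof.
move=> h0; have [n] := ubnP (size s); elim: n s a => // n ih s a /ltnSE sn H.
have [ba|ab] := ltP b a.
  apply: (@le_trans _ _ 0); first by rewrite subr_le0 ltW.
  by rewrite mulr_ge0// mulr_ge0// ltW.
have /hasP[c cs] := H a (lexx a) ab; rewrite ltr_norml => /andP[c1 c2].
pose s' := [seq d <- s | d != c].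
have ss' : ((size s').+1 <= size s)%N.
  rewrite size_filter -(count_predC (pred1 c) s) -add1n leq_add2r.
  by rewrite -has_count has_pred1.
have : b - (c + h) <= 2 * h * (size s')%:R.
  apply: ih; first exact: leq_trans ss' sn.
  move=> y cy yb.
  have /hasP[d ds dy] := H y ltac:(lra) yb.
  apply/hasP; exists d => //; rewrite mem_filter ds andbT.
  by apply/eqP => dc; move: dy; rewrite dc ltr_norml => /andP[_]; lra.
have : 2 * h * (size s').+1%:R <= 2 * h * (size s)%:R.
  by rewrite ler_pM2l ?mulr_gt0// ler_nat.
rewrite -(natr1 (size s')) mulrDr mulr1; lra.
Qed.

Lemma torus_cont_bounded v : continuous_torus v -> exists2 B, 0 <= B & forall x, `|v x| <= B.
Proof.
move=> [pv cv].
have /compact_bounded[M [_ h]] := continuous_compact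
    (continuous_subspaceT cv) (@segment_compact _ 0 (2 * pi)).
exists (`|M| + 1) => [|x]; first by rewrite addr_ge0.
rewrite -(tmodE x pv); apply: h; first by rewrite (le_lt_trans (ler_norm _))// ltrDl.
by exists (tmod x) => //=; rewrite in_itv /=; have /andP[-> /ltW ->] := tmod_dom x.
Qed.

(* The graph over [x, x + h] joins the heights [v x] and [v (x + h)], so this vertical
   range is covered by the discs whose centers lie within [2 * h] of [x]. *)
Lemma covered_increment v (c : nat -> R * R) (N : nat) (h x : R) : continuous v ->
  graph_torus v `<=` \bigcup_(i in `I_N) disc (c i) h -> 0 < h ->
  0 <= x -> x + h <= 2 * pi ->
  `|v (x + h) - v x| <= 2 * h * \sum_(i < N) \1_(`](c i).1 - 2 * h, (c i).1 + 2 * h[%classic) x.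
Proof.
move=> cv cov h0 x0 xh.
pose P (i : nat) : bool := `|(c i).1 - x| < 2 * h.
pose s := [seq (c i).2 | i <- iota 0 N & P i].
have -> : \sum_(i < N) \1_(`](c i).1 - 2 * h, (c i).1 + 2 * h[%classic) x = (size s)%:R :> R.
  rewrite size_map size_filter -sum1_count natr_sum [RHS]big_mkcond /=.
  rewrite -(big_mkord xpredT (fun i => \1_(`](c i).1 - 2 * h, (c i).1 + 2 * h[%classic) x)).
  rewrite /index_iota subn0; apply: eq_bigr => i _; rewrite indicE.
  rewrite (_ : (x \in _) = P i); first by case: (P i).
  apply/idP/idP; rewrite inE /= in_itv /= /P ltr_norml.
    by move=> /andP[? ?]; apply/andP; split; lra.
  by move=> /andP[? ?]; apply/andP; split; lra.
have key y : Num.min (v x) (v (x + h)) <= y <= Num.max (v x) (v (x + h)) ->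
    has (fun d => `|y - d| < h) s.
  move=> hy; have xxh : x <= x + h by rewrite lerDl ltW.
  have [|z zx vz] := @IVT R v x (x + h) y xxh _ hy; first exact: continuous_subspaceT.
  move: zx; rewrite in_itv /= => /andP[z1 z2].
  have : graph_torus v (z, y).
    split => //=; rewrite /torus_dom /= in_itv /= (le_trans x0 z1)/=; lra.
  move=> /cov[i /= iN]; rewrite /disc /= => hd.
  have q0 : 0 <= (z - (c i).1) ^+ 2 + (y - (c i).2) ^+ 2 by rewrite addr_ge0// sqr_ge0.
  have e (t : R) : t ^+ 2 <= (z - (c i).1) ^+ 2 + (y - (c i).2) ^+ 2 -> `|t| < h.
    by move=> ht; apply: le_lt_trans hd; rewrite -sqrtr_sqr ler_wsqrtr.
  have e1 : `|z - (c i).1| < h by apply: e; rewrite lerDl sqr_ge0.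
  have e2 : `|y - (c i).2| < h by apply: e; rewrite lerDr sqr_ge0.
  apply/hasP; exists (c i).2 => //; apply/mapP; exists i => //.
  rewrite mem_filter mem_iota add0n iN leq0n !andbT /P.
  by move: e1; rewrite !ltr_norml => /andP[? ?]; apply/andP; split; lra.
have := @cover_len s (Num.min (v x) (v (x + h))) (Num.max (v x) (v (x + h))) h h0.
have -> : Num.max (v x) (v (x + h)) - Num.min (v x) (v (x + h)) = `|v (x + h) - v x|.
  by have [w|w] := leP (v x) (v (x + h)); [rewrite ger0_norm ?subr_ge0|rewrite ltr0_norm ?subr_lt0// opprB].
by apply => y y1 y2; apply: key; rewrite y1.
Qed.

Lemma cont_shift v h : continuous v -> continuous (fun x => v (x + h)).
Proof.
move=> cv x; apply: continuous_comp; last exact: cv.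
by apply: cvgD; [exact: cvg_id|exact: cvg_cst].
Qed.

(** Each disc counts for the [x] in an interval of length [4 * h], at the price [2 * h], whence the
    8. The term [2 * B * h] pays for the last stretch of length [h], where [x + h] leaves the domain
    of the graph. *)
Lemma covered_modulus v (c : nat -> R * R) (N : nat) (h B : R) : continuous v ->
  (forall x, `|v x| <= B) ->
  graph_torus v `<=` \bigcup_(i in `I_N) disc (c i) h -> 0 < h -> h <= 1 ->
  II (fun x => `|v (x + h) - v x|) <= 8 * h ^+ 2 * N%:R + 2 * B * h.
Proof.
move=> cv vB cov h0 h1.
have B0 : 0 <= B by rewrite (le_trans _ (vB 0)).
pose I i := `](c i).1 - 2 * h, (c i).1 + 2 * h[%classic.
pose J : set R := `]2 * pi - h, 2 * pi[%classic.
have iI (A : set R) : measurable A -> iD (\1_A : R -> R).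
  move=> mA; apply: iD_ext (iD_indic mA (iD_cst 1)) => x _; by rewrite mulr1.
have iI1 i : iD (\1_(I i) : R -> R) by apply: iI; exact: measurable_itv.
have iJ : iD (\1_J : R -> R) by apply: iI; exact: measurable_itv.
have iS : iD (fun x => \sum_(i < N) \1_(I i) x) by apply: iD_sum => i _; exact: iI1.
apply: (@le_trans _ _ (II (fun x => 2 * h * (\sum_(i < N) \1_(I i) x) + 2 * B * \1_J x))).
  apply: II_le_oo.
  - apply: iD_abs; apply: iD_B; apply: iD_cont => //; exact: cont_shift.
  - by apply: iD_D; exact: iD_Z.
  move=> x /andP[x0 x1].
  have [xh|xh] := leP (x + h) (2 * pi).
    apply: (le_trans (covered_increment cv cov h0 (ltW x0) xh)).
    by rewrite lerDl mulr_ge0 ?mulr_ge0// indicE ler0n.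
  have -> : \1_J x = 1 :> R.
    by rewrite indicE mem_set// /J /= in_itv /= x1 andbT; lra.
  rewrite mulr1 (@le_trans _ _ (2 * B))//.
    by rewrite (le_trans (ler_normB _ _))// mulrDl mul1r lerD.
  rewrite lerDr; apply: mulr_ge0; first by rewrite mulr_ge0// ltW.
  by apply: sumr_ge0 => i _; rewrite indicE ler0n.
rewrite II_D; [|exact: iD_Z|exact: iD_Z].
rewrite II_Z// II_Z// II_sum//.
apply: lerD.
  have -> : 8 * h ^+ 2 * N%:R = 2 * h * (\sum_(i < N) 4 * h).
    by rewrite sumr_const card_ord -mulr_natr; ring.
  apply: ler_wpM2l; first by rewrite mulr_ge0// ltW.
  apply: ler_sum => i _; apply: (@le_trans _ _ (((c i).1 + 2 * h) - ((c i).1 - 2 * h))); last by lra.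
  by apply: II_indic_itv; lra.
apply: ler_wpM2l; first by rewrite mulr_ge0.
have : 2 * pi - h <= 2 * pi :> R by lra.
by move/II_indic_itv; lra.
Qed.

(** The slack 1 avoids discussing whether the infimum is attained. *)
Lemma covering_number_lty (E : set (R * R)) (h r : R) :
  (covering_number E h <= r%:E)%E ->
  exists (N : nat) (c : nat -> R * R), N%:R <= r + 1 /\ E `<=` \bigcup_(i in `I_N) disc (c i) h.
Proof.
move=> H; have : (covering_number E h < (r + 1)%:E)%E.
  by apply: (le_lt_trans H); rewrite lte_fin ltrDl.
by move=> /ereal_inf_lt[_ [N /= [c cov] <-]]; rewrite lte_fin => /ltW ?; exists N, c.
Qed.

Lemma covering_number_ge0 (E : set (R * R)) (h : R) : (0 <= covering_number E h)%E.
Proof. by apply: le_ereal_inf_tmp => _ [N _ <-]; rewrite lee_fin. Qed.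

(** A cover by about [h ^ (- gm)] discs of radius [h] gives a modulus of order [h ^ (2 - gm)]. Since
    [gm < 3/2], this is [h ^ (1/2 + sg)] with [sg = 3/2 - gm > 0]. *)
Lemma box_dim_modulus v : continuous_torus v ->
  (upper_box_dim (graph_torus v) < (3 / 2)%:E)%E ->
  exists sg C h0 : R, [/\ 0 < sg, sg <= 2^-1, 0 <= C, 0 < h0 & forall h, 0 < h -> h < h0 ->
    II (fun x => `|v (x + h) - v x|) <= C * h `^ (2^-1 + sg)].
Proof.
move=> ctv; have [pv cv] := ctv; have [B B0 vB] := torus_cont_bounded ctv.
rewrite /upper_box_dim /limf_esup => /ereal_inf_lt[_ [V /= Vn <-]] HV.
have [gm [gm1 gm2 Hg]] : exists gm : R, [/\ 1 <= gm, gm < 3 / 2 & forall h, V h ->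
    (lne (covering_number (graph_torus v) h) * ((ln h^-1)^-1)%:E <= gm%:E)%E].
  move: HV; set S := ereal_sup _ => HS.
  have ub h : V h -> (lne (covering_number (graph_torus v) h) * ((ln h^-1)^-1)%:E <= S)%E.
    by move=> Vh; apply: ereal_sup_ubound; exists h.
  (* [gm] is never taken below 1. This keeps [sg <= 1/2], so that the end term [2 * B * h] is
     absorbed, and it disposes of an infinite [S]. *)
  have [S1|S1] := leP S 1%:E.
    by exists 1; split => //; [lra|move=> h /ub /le_trans; exact].
  exists (fine S); have fS : S \is a fin_num.
    by rewrite fin_numElt (lt_trans _ S1) ?ltNyr//= (lt_trans HS)// ltry.
  by split; rewrite -?lee_fin -?lte_fin ?fineK// ltW.
have [h1 /= h1p H1] : \forall h \near (0:R)^'+, V h by exact: Vn.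
pose sg := 3 / 2 - gm.
(* [16 = 8 * 2]: the slack 1 of [covering_number_lty] is at most [h ^ (- gm)], so it at most doubles
   the count. *)
exists sg, (16 + 2 * B), (Num.min h1 1); split; rewrite /sg.
- by lra.
- by lra.
- by lra.
- by rewrite lt_min h1p /=.
move=> h h0; rewrite lt_min => /andP[hh1 hl1].
have Vh : V h by apply: H1 => //=; rewrite sub0r normrN gtr0_norm.
have := Hg h Vh; set cn := covering_number _ _ => Hc.
have L0 : 0 < ln h^-1 by rewrite ln_gt0// invf_gt1.
have cn0 : (0 <= cn)%E by exact: covering_number_ge0.
have Hr : (cn <= (h `^ (- gm))%:E)%E.
  move: Hc cn0; case: cn => [r||]; last 2 first.
  - by rewrite /= gt0_mulye ?lte_fin ?invr_gt0// leye_eq.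
  - by [].
  rewrite lee_fin => Hc r0; rewrite lee_fin.
  move: r0; rewrite le_eqVlt => /predU1P[<-|r0]; first exact: powR_ge0.
  move: Hc; rewrite lne_EFin ?gt_eqF// -EFinM lee_fin ler_pdivrMr// => Hc.
  rewrite -[r]lnK ?posrE// /powR gt_eqF// ler_expR.
  by rewrite lnV ?posrE// in Hc; lra.
have [N [c [Nr cov]]] := covering_number_lty Hr.
apply: (le_trans (covered_modulus cv vB cov h0 (ltW hl1))).
have e : h `^ (2^-1 + (3 / 2 - gm)) = h ^+ 2 * h `^ (- gm).
  rewrite -powR_mulrn ?(ltW h0)// -powRD; last by rewrite (gt_eqF h0) implybT.
  by congr (_ `^ _); rewrite /=; lra.
have hgm : 1 <= h `^ (- gm).
  by rewrite -(powRr0 h) ger_powR ?h0 ?(ltW hl1)//; lra.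
have hh : h <= h `^ (2^-1 + (3 / 2 - gm)).
  rewrite -[leLHS]powRr1 ?(ltW h0)// ger_powR ?h0 ?(ltW hl1)//; lra.
have hN : h ^+ 2 * N%:R <= 2 * h `^ (2^-1 + (3 / 2 - gm)).
  rewrite e mulrCA ler_wpM2l ?sqr_ge0//; lra.
have := ler_wpM2l B0 hh; move: hN; lra.
Qed.

End BoxDimension.

(** * Dyadic blocks *)

Section Synthesis.
Variable R : realType.
Notation mu := (@lebesgue_measure R).
Notation D := (@torus_dom R).
Implicit Types (v : R -> R) (s : seq int) (a c d : int -> R[i]).

Lemma ler_abs_sin (x : R) : `|sin x| <= `|x|.
Proof.
wlog x0 : x / 0 <= x => [W|].
  have [/W//|x0] := leP 0 x; rewrite -normrN -sinN -[leRHS]normrN.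
  by apply: W; rewrite oppr_ge0 ltW.
move: x0; rewrite le_eqVlt => /predU1P[<-|x0]; first by rewrite sin0.
have cs : {within `[0, x], continuous (@sin R)}.
  by apply: continuous_subspaceT; exact: continuous_sin.
have [c _] := MVT x0 (fun y _ => is_derive_sin y) cs.
rewrite sin0 !subr0 => ->; rewrite normrM ler_piMl//.
by rewrite ler_norml cos_geN1 cos_le1.
Qed.

Lemma expi_sub1_sqr (t : R) : cabs (expi t - 1) ^+ 2 = 2 * (1 - cos t).
Proof.
rewrite cabs_sqr cReD cImD cReN cImN /expi /= oppr0 addr0.
have := cos2Dsin2 t; lra.
Qed.

Lemma expi_sub1 (t : R) : cabs (expi t - 1) ^+ 2 <= t ^+ 2.
Proof.
rewrite expi_sub1_sqr; have e : t = (t / 2) *+ 2 by rewrite -mulr_natr divfK.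
rewrite {1}e cos_mulr2n.
have := ler_abs_sin (t / 2); rewrite -ler_sqr ?nnegrE// !real_normK ?num_real//.
have := cos2Dsin2 (t / 2); rewrite -mulr_natr expr_div_n; lra.
Qed.

Lemma expi_sub1_2 (t : R) : cabs (expi t - 1) <= 2.
Proof. by rewrite (le_trans (cabsB _ _))// cabs_expi cabs1; lra. Qed.

(** Open below and closed above: with [zs 1] the blocks then tile [zs (2 ^ K)], and
    [h = 2 ^ (- k - 1)] brings [h * |n|] into [(1/2, 1]]. *)
Definition blk (k : nat) : seq int := [seq n <- zs (2 ^ k.+1) | (2 ^ k < `|n|)%N].

Lemma mem_blk k (n : int) : (n \in blk k) = (2 ^ k < `|n| <= 2 ^ k.+1)%N.
Proof. by rewrite mem_filter mem_zs. Qed.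

Lemma uniq_blk k : uniq (blk k). Proof. exact/filter_uniq/uniq_zs. Qed.

Lemma size_blk k : (size (blk k) <= 5 * 2 ^ k)%N.
Proof.
rewrite size_filter (leq_trans (count_size _ _))// size_map size_iota expnS.
by have := expn_gt0 2 k; lia.
Qed.

Lemma sum_zs_blk (V : nmodType) K (F : int -> V) :
  \sum_(n <- zs (2 ^ K)) F n = \sum_(n <- zs 1) F n + \sum_(k < K) \sum_(n <- blk k) F n.
Proof.
elim: K => [|K ih]; first by rewrite big_ord0 addr0.
rewrite big_ord_recr /= addrA -ih -big_cat; apply: perm_big; apply: uniq_perm.
- exact: uniq_zs.
- rewrite cat_uniq !uniq_zs uniq_blk andbT /=; apply/hasPn => n.
  by rewrite mem_blk mem_zs; lia.
- move=> n; rewrite mem_cat !mem_zs mem_blk expnS; lia.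
Qed.

Lemma zs_sub_pow N : exists K, (N <= 2 ^ K)%N.
Proof. by exists N; exact/ltnW/ltn_expl. Qed.

Lemma sum_const_blk k (F : int -> R) (B : R) : 0 <= B ->
  (forall n, n \in blk k -> F n <= B) -> \sum_(n <- blk k) F n <= 5 * 2 ^+ k * B.
Proof.
move=> B0 FB; rewrite big_seq; apply: (@le_trans _ _ (\sum_(n <- blk k) B)).
  by rewrite [leRHS]big_seq; apply: ler_sum => n /FB.
rewrite big_const_seq count_predT iter_addr_0 -[B *+ _]mulr_natl ler_wpM2r//.
by rewrite -natrX -natrM ler_nat size_blk.
Qed.

Lemma finite_CS (I : Type) (r : seq I) (x : I -> R) : (forall i, 0 <= x i) ->
  (\sum_(i <- r) x i) ^+ 2 <= (size r)%:R * \sum_(i <- r) x i ^+ 2.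
Proof.
move=> x0; elim: r => [|i r ih]; first by rewrite !big_nil expr0n mul0r.
rewrite !big_cons /= -natr1.
have S0 : 0 <= \sum_(j <- r) x j by exact: sumr_ge0.
have Q0 : 0 <= \sum_(j <- r) x j ^+ 2 by apply: sumr_ge0 => j _; exact: sqr_ge0.
move: (\sum_(j <- r) x j) (\sum_(j <- r) x j ^+ 2) S0 Q0 ih => S Q S0 Q0 ih.
have xi := x0 i; have [r0|r0] := posnP (size r).
  move: ih; rewrite r0 mul0r => ih; have S00 : S = 0 by apply/eqP; rewrite -sqrf_eq0 eq_le ih sqr_ge0.
  by rewrite S00 addr0 add0r mul1r lerDl.
have n0 : 0 < (size r)%:R :> R by rewrite ltr0n.
move: (size r)%:R n0 ih => n n0 ih.
have h : 2 * S * x i <= Q + n * x i ^+ 2.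
  rewrite -(ler_pM2l n0); have := sqr_ge0 (S - n * x i); nra.
by nra.
Qed.

Lemma n2_trig (I : Type) (r : seq I) (b : I -> R[i]) (k : I -> int) :
  (n2 (fun x => \sum_(u <- r) b u * te (k u) x))%:C =
  (2 * pi)%:C * \sum_(u <- r) \sum_(w <- r | k u == k w) b u * cj (b w).
Proof.
rewrite -n2_CI.
rewrite (@CI_ext _ _ (fun x => \sum_(u <- r) \sum_(w <- r) b u * cj (b w) * te (k u - k w) x)); last first.
  move=> x _; rewrite mulr_suml; apply: eq_bigr => u _.
  rewrite cj_sum mulr_sumr; apply: eq_bigr => w _.
  by rewrite cjM teD teN; ring.
rewrite CI_sum => [|u _]; last by apply: cI_sum => w _; apply: cI_Z; exact/cC_cI/cC_te.
rewrite mulr_sumr; apply: eq_bigr => u _; rewrite CI_trig; congr (_ * _).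
by apply: eq_bigl => w; rewrite subr_eq0.
Qed.

Definition prs s : seq (int * int) := [seq (m, n) | m <- s, n <- s].

Lemma tp_sqr s a x : tp s a x * tp s a x =
  \sum_(u <- prs s) a u.1 * a u.2 * te (u.1 + u.2) x.
Proof.
rewrite big_allpairs /tp big_distrlr; apply: eq_bigr => m _; apply: eq_bigr => n _ /=.
by rewrite teD; ring.
Qed.

(** The exponent 4 makes this the squared L^2 norm of the square of [tp s a], hence a polynomial in
    the coefficients and their conjugates. *)
Definition n4 s a : R := II (fun x => cabs (tp s a x) ^+ 4).

Lemma n4_n2 s a : n4 s a = n2 (fun x => tp s a x * tp s a x).
Proof. by apply: II_ext => x _; rewrite cabsM -expr2 -exprM. Qed.

Lemma n4_quad s a : (n4 s a)%:C = (2 * pi)%:C *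
  \sum_(u <- prs s) \sum_(w <- prs s | u.1 + u.2 == w.1 + w.2)
     a u.1 * a u.2 * cj (a w.1 * a w.2).
Proof.
rewrite n4_n2 -n2_trig; congr (_%:C).
by apply: n2_ext => x _; rewrite tp_sqr.
Qed.

Lemma n4_ge0 s a : 0 <= n4 s a.
Proof. by rewrite n4_n2 n2_ge0. Qed.

(* The Fourier coefficients of [p ^ 2] live on [zs (2 * N)], and [sup `|F|] is at most
   their l^1 norm; Cauchy-Schwarz with [F = p ^ 2]. *)
Lemma sup_n4 N s a x : uniq s -> {subset s <= zs N} ->
  cabs (tp s a x) ^+ 4 <= (4 * N%:R + 1) * n4 s a.
Proof.
move=> us sN.
have [b hb] : exists b, forall y, tp s a y * tp s a y = tp (zs N.*2) b y.
  exists (fun n => \sum_(u <- prs s | n == u.1 + u.2) a u.1 * a u.2).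
  move=> y; rewrite tp_sqr big_seq_cond.
  pose k (u : int * int) := if u.1 + u.2 \in zs N.*2 then u.1 + u.2 else 0.
  have mk u : u \in prs s -> u.1 + u.2 \in zs N.*2.
    move=> /allpairsP[[m n] /= [ms ns ->]] /=.
    by have := sN m ms; have := sN n ns; rewrite !mem_zs; lia.
  transitivity (\sum_(u <- prs s) a u.1 * a u.2 * te (k u) y).
    by rewrite [RHS]big_seq_cond; apply: eq_bigr => u /andP[/mk h _]; rewrite /k h.
  rewrite (@tp_group _ _ (prs s) k (fun u => a u.1 * a u.2) (zs N.*2)) ?uniq_zs//.
    apply: eq_bigr => n _; congr (_ * _); rewrite big_seq_cond [RHS]big_seq_cond.
    apply: eq_bigl => u; have [us'|//] := boolP (u \in prs s).
    by rewrite /k mk.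
  by move=> u; rewrite /k; case: ifP => // _; rewrite mem_zs.
have e1 : cabs (tp s a x) ^+ 4 = cabs (tp (zs N.*2) b x) ^+ 2.
  by rewrite -hb cabsM -expr2 -exprM.
have e2 : n4 s a = 2 * pi * \sum_(n <- zs N.*2) cabs (b n) ^+ 2.
  by rewrite n4_n2 -n2_tp ?uniq_zs//; apply: n2_ext => y _; rewrite hb.
have p1 : 1 <= 2 * pi :> R by have := pi_ge2 R; lra.
rewrite e1 e2.
apply: (@le_trans _ _ ((\sum_(n <- zs N.*2) cabs (b n)) ^+ 2)).
  rewrite lerXn2r ?nnegrE ?cabs_ge0 ?sumr_ge0//; first by move=> i _; exact: cabs_ge0.
  apply: (le_trans (cabs_sum _ _ _)); apply: ler_sum => n _.
  by rewrite cabsM cabs_te mulr1.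
apply: (le_trans (finite_CS _ _)); first by move=> n; exact: cabs_ge0.
rewrite size_map size_iota.
have -> : (N.*2.*2.+1)%:R = 4 * N%:R + 1 :> R by rewrite -natr1 -!muln2 !natrM; lra.
rewrite ler_wpM2l ?addr_ge0 ?mulr_ge0//.
by rewrite ler_peMl// sumr_ge0// => n _; exact: sqr_ge0.
Qed.

Lemma te_cjE a s x : (forall n, a (- n) = cj (a n)) -> (forall n, (- n \in s) = (n \in s)) ->
  uniq s -> complex.Im (tp s a x) = 0.
Proof.
move=> aN sN us.
have : cj (tp s a x) = tp s a x.
  rewrite /tp cj_sum; rewrite [RHS](perm_big [seq - n | n <- s]) /=; last first.
    apply: uniq_perm => //; first by rewrite map_inj_uniq//; exact: oppr_inj.
    move=> n; apply/idP/mapP => [h|[m h ->]]; last by rewrite sN.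
    by exists (- n); rewrite ?sN ?opprK.
  by rewrite big_map; apply: eq_bigr => n _; rewrite cjM aN teN.
by move=> /(congr1 (@complex.Im R)); rewrite Im_cj; lra.
Qed.

Lemma cvg_unif_le (u : nat -> R) (l b : R) (N : nat) :
  u n @[n --> \oo] --> l -> (forall n, (N <= n)%N -> u n <= b) -> l <= b.
Proof.
move=> ul H; have cu : cvgn u by apply/cvg_ex; exists l.
by rewrite -(cvg_lim _ ul)//; apply: limr_le => //; exists N => // n /= /H.
Qed.

(** Only whole blocks are controlled, so convergence is obtained along the partial sums at powers of
    2. It is uniform because the block bounds form a geometric series; the symmetry of [d] makes the
    limit real. *)
Lemma synthesis d (A r : R) : 0 <= A -> 0 <= r -> r < 1 ->
  (forall n, d (- n) = cj (d n)) ->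
  (forall k x, cabs (tp (blk k) d x) <= A * r ^+ k) ->
  exists2 v : R -> R, continuous_torus v &
    forall K x, cabs ((v x)%:C - tp (zs (2 ^ K)) d x) <= A / (1 - r) * r ^+ K.
Proof.
move=> A0 r0 r1 dN Hd; have r1' : 0 < 1 - r by rewrite subr_gt0.
pose S K x := complex.Re (tp (zs (2 ^ K)) d x).
have SE K x : tp (zs (2 ^ K)) d x = (S K x)%:C.
  apply: ReImP => //=; rewrite te_cjE ?uniq_zs// => n; rewrite !mem_zs; lia.
have Sd K x : `|S K.+1 x - S K x| <= A * r ^+ K.
  have -> : S K.+1 x - S K x = complex.Re (tp (blk K) d x).
    rewrite /S -cReN -cReD; congr complex.Re.
    by rewrite /tp !sum_zs_blk big_ord_recr /=; ring.
  exact: le_trans (le_Re_cabs _) (Hd K x).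
(* The exact geometric difference [r ^ K - r ^ L] is kept so that the induction on [L] closes. *)
have Sg K L x : (K <= L)%N -> `|S L x - S K x| <= A / (1 - r) * (r ^+ K - r ^+ L).
  elim: L => [|L ih]; first by rewrite leqn0 => /eqP ->; rewrite !subrr normr0 mulr0.
  rewrite leq_eqVlt => /predU1P[->|]; first by rewrite !subrr normr0 mulr0.
  rewrite ltnS => /ih{}ih; rewrite -(subrK (S L x) (S L.+1 x)) -addrA.
  apply: (le_trans (ler_normD _ _)); apply: (le_trans (lerD (Sd L x) ih)).
  by rewrite le_eqVlt; apply/orP; left; apply/eqP; rewrite exprS; field; rewrite gt_eqF.
have Sg' K L x : (K <= L)%N -> `|S L x - S K x| <= A / (1 - r) * r ^+ K.
  move=> KL; apply: (le_trans (Sg K L x KL)); rewrite ler_wpM2l ?divr_ge0 ?(ltW r1')//.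
  by rewrite gerBl exprn_ge0.
have pos K : 0 <= A / (1 - r) * r ^+ K by rewrite mulr_ge0 ?divr_ge0 ?exprn_ge0// ltW.
have cS x : cvgn (fun K => S K x).
  apply/cauchy_cvgP/cauchy_exP => e e0.
  have : A / (1 - r) * r ^+ K @[K --> \oo] --> 0.
    rewrite -(mulr0 (A / (1 - r))); apply: cvgM; first exact: cvg_cst.
    by apply: cvg_expr; rewrite ger0_norm.
  move=> /cvgrPdist_lt/(_ e e0)[K _ /(_ K (leqnn K))].
  rewrite /= sub0r normrN ger0_norm ?pos// => hK.
  exists (S K x); exists K => // L /= KL; rewrite /ball /= distrC.
  exact: le_lt_trans (Sg' K L x KL) hK.
pose v x := limn (fun K => S K x).
have vS K x : `|v x - S K x| <= A / (1 - r) * r ^+ K.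
  have h : `|S L x - S K x| @[L --> \oo] --> `|v x - S K x|.
    by apply: cvg_norm; apply: cvgB; [exact: cS|exact: cvg_cst].
  by apply: (cvg_unif_le h (N := K)) => L /Sg'.
have contS K : continuous (S K) by case: (cC_tp (zs (2 ^ K)) d).
exists v; last by move=> K x; rewrite SE -CRB cabsR.
split.
  move=> x; rewrite /v (_ : (fun K => S K (x + 2 * pi)) = (fun K => S K x))//.
  apply/funext => K; rewrite /S; congr complex.Re.
  by apply: eq_bigr => n _; rewrite te_periodic.
move=> x; apply/cvgrPdist_lt => e e0.
have e3 : 0 < e / 3 by rewrite divr_gt0.
have : A / (1 - r) * r ^+ K @[K --> \oo] --> 0.
  rewrite -(mulr0 (A / (1 - r))); apply: cvgM; first exact: cvg_cst.
  by apply: cvg_expr; rewrite ger0_norm.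
move=> /cvgrPdist_lt/(_ _ e3)[K _ /(_ K (leqnn K))].
rewrite /= sub0r normrN ger0_norm ?pos// => hK.
have /cvgrPdist_lt/(_ _ e3) := contS K x; apply: filterS => y hy.
have h1 := le_lt_trans (vS K x) hK; have h2 := le_lt_trans (vS K y) hK.
move: h1 h2 hy; rewrite !ltr_norml => /andP[? ?] /andP[? ?] /andP[? ?].
by apply/andP; split; lra.
Qed.

Lemma fc_unif (v : R -> R) d (e : nat -> R) : continuous v ->
  e K @[K --> \oo] --> 0 ->
  (forall K x, cabs ((v x)%:C - tp (zs (2 ^ K)) d x) <= e K) ->
  forall n, fc (fun x => (v x)%:C) n = d n.
Proof.
move=> cv e0 H n; have lv : l2 (fun x => (v x)%:C) by apply: cC_l2; exact: cC_R.
have lt_ := l2_tp (zs _) d; have lte := cC_l2 (cC_te R (- n)).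
have Hb K : (`|n| <= 2 ^ K)%N -> cabs (fc (fun x => (v x)%:C) n - d n) <= e K.
  move=> nK.
  have -> : fc (fun x => (v x)%:C) n - d n =
      (2 * pi)^-1%:C * CI (fun x => ((v x)%:C - tp (zs (2 ^ K)) d x) * te (- n) x).
    rewrite (@CI_ext _ _ (fun x => (v x)%:C * te (- n) x - tp (zs (2 ^ K)) d x * te (- n) x)); last first.
      by move=> x _; rewrite mulrBl.
    rewrite CI_B; [|exact: cI_M|exact: cI_M].
    rewrite coef_tp ?uniq_zs// mem_zs nK mulrBr mulrA -CRM mulVf ?mul1r//.
    by rewrite gt_eqF ?twopi_gt0.
  rewrite cabsM cabsR ger0_norm ?invr_ge0 ?twopi_ge0// mulrC ler_pdivrMr ?twopi_gt0//.
  have ci : cI (fun x => ((v x)%:C - tp (zs (2 ^ K)) d x) * te (- n) x).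
    by apply: cI_M => //; exact: l2_B.
  apply: (le_trans (cabs_CI ci)); rewrite -II_cst; apply: II_le.
  - exact: iD_cabs.
  - exact: iD_cst.
  - by move=> x _; rewrite cabsM cabs_te mulr1.
have [K0 hK0] := zs_sub_pow `|n|.
apply/eqP; rewrite -subr_eq0; apply/eqP; apply: cabs_eq0.
apply/eqP; rewrite eq_le cabs_ge0 andbT.
have h : - e K @[K --> \oo] --> 0 by rewrite -oppr0; exact: cvgN.
rewrite -oppr_ge0; apply: (cvg_unif_le h (N := K0)) => K KK0.
rewrite lerN2; apply: Hb; apply: (leq_trans hK0).
by rewrite leq_pexp2l.
Qed.

(** The half of Parseval's identity that rests on completeness. *)
Lemma n2_le_coefs (f : R -> R) (B : R) : l2 (fun x => (f x)%:C) ->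
  (forall N, \sum_(n <- zs N) cabs (fc (fun x => (f x)%:C) n) ^+ 2 <= B) ->
  n2 (fun x => (f x)%:C) <= 2 * pi * B.
Proof.
move=> lf HB; apply/ler_addgt0Pr => e e0.
have [L /(_ L (leqnn L))] := completeness lf e0.
rewrite (_ : fourier_coef f = fc (fun x => (f x)%:C)); last by apply/funext => n; rewrite fourier_coefE.
rewrite bessel//; have := ler_wpM2l (twopi_ge0 R) (HB L); lra.
Qed.

End Synthesis.

(** * The dichotomy for one function *)

Section Dichotomy.
Variable R : realType.
Notation mu := (@lebesgue_measure R).
Notation D := (@torus_dom R).
Implicit Types (v : R -> R) (s : seq int) (a c d : int -> R[i]).

(* The gain of the nonlinear part of the solution over the decay [`|n|^-1]. *)
Definition wt (n : int) : R := `|n%:~R| `^ 4^-1.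

Lemma wt_ge0 n : 0 <= wt n. Proof. exact: powR_ge0. Qed.

Lemma norm_int_ge1 (n : int) : n != 0 -> 1 <= `|n%:~R| :> R.
Proof. by move=> n0; rewrite -intr_norm ler1z; lia. Qed.

Lemma normr_int (n : int) : `|n%:~R| = (`|n|%N)%:R :> R.
Proof. by rewrite -intr_norm -abszE. Qed.

Lemma sum_inv_sqr_tail N L : (0 < N)%N ->
  \sum_(n <- zs L | (N < `|n|)%N) ((n%:~R : R) ^+ 2)^-1 <= 2 / N%:R.
Proof.
move=> N0; have NR : 0 < N%:R :> R by rewrite ltr0n.
have [LN|NL] := leqP L N.
  rewrite big_seq_cond big_pred0 ?divr_ge0 ?ltW// => n.
  by rewrite mem_zs; apply/negbTE; lia.
suff h M : \sum_(n <- zs (N + M) | (N < `|n|)%N) ((n%:~R : R) ^+ 2)^-1 <= 2 / N%:R - 2 / (N + M)%:R.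
  rewrite -(subnKC (ltnW NL)); apply: (le_trans (h _)).
  by rewrite gerBl divr_ge0.
elim: M => [|M ih].
  rewrite addn0 subrr big_seq_cond big_pred0// => n.
  by rewrite mem_zs; apply/negbTE; lia.
rewrite addnS big_mkcond sum_zsS -big_mkcond /= ifT; last by lia.
rewrite ifT; last by lia.
rewrite mulrNz sqrrN -mulr2n; apply: (le_trans (lerD (lexx _) ih)).
have -> : (((N + M).+1%:Z)%:~R : R) = (N + M)%:R + 1 by rewrite natr1.
have -> : ((N + M).+1%:R : R) = (N + M)%:R + 1 by rewrite natr1.
have a0 : 0 < (N + M)%:R :> R by rewrite ltr0n addn_gt0 N0.
move: ((N + M)%:R) a0 => b b0; rewrite -subr_ge0.
have -> : 2 / N%:R - 2 / (b + 1) - (((b + 1) ^+ 2)^-1 *+ 2 + (2 / N%:R - 2 / b))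
  = 2 / (b * (b + 1) ^+ 2).
  by field; rewrite !gt_eqF// ltr_wpDr.
by rewrite divr_ge0// mulr_ge0 ?sqr_ge0// ltW.
Qed.

(** The factors [k.+1] are the logarithms lost in the fourth moment bound; a geometric gain absorbs
    them. *)
Lemma sum_geom_lin (r : R) K : 0 <= r -> r < 1 ->
  \sum_(k < K) k.+1%:R * r ^+ k <= ((1 - r) ^+ 2)^-1.
Proof.
move=> r0 r1; have r1' : 0 < 1 - r by rewrite subr_gt0.
have geo n : \sum_(k < n) r ^+ k <= (1 - r)^-1.
  have -> : \sum_(k < n) r ^+ k = (1 - r ^+ n) / (1 - r).
    elim: n => [|n ih]; first by rewrite big_ord0 expr0 subrr mul0r.
    by rewrite big_ord_recr /= ih exprS; field; rewrite gt_eqF.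
  by rewrite -[leRHS]mul1r ler_wpM2r ?invr_ge0 ?(ltW r1')// gerBl exprn_ge0.
elim: K => [|K ih]; first by rewrite big_ord0 invr_ge0 sqr_ge0.
have -> : \sum_(k < K.+1) k.+1%:R * r ^+ k
  = \sum_(k < K.+1) r ^+ k + r * \sum_(k < K) k.+1%:R * r ^+ k.
  under eq_bigr do rewrite -natr1 mulrDl mul1r.
  rewrite big_split /= addrC; congr (_ + _).
  rewrite big_ord_recl mul0r add0r mulr_sumr; apply: eq_bigr => k _.
  by rewrite exprS /= mulrCA.
apply: (le_trans (lerD (geo _) (ler_wpM2l r0 ih))).
by rewrite le_eqVlt; apply/orP; left; apply/eqP; field; rewrite gt_eqF.
Qed.

(** Split at [|n| = M = 1 / h]. Below, [|te n h - 1| <= |n| * h] leaves at most [3 * M] terms of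
    size [C0 ^ 2 * h ^ 2]; above, [|te n h - 1| <= 2] and the tail of the inverse squares give
    [8 * C0 ^ 2 * h]. *)
Lemma sum_modulus d (C0 h : R) (M N : nat) : (0 < M)%N -> h = M%:R^-1 ->
  (forall n, n != 0 -> cabs (d n) <= C0 / `|n%:~R|) ->
  \sum_(n <- zs N) cabs ((te n h - 1) * d n) ^+ 2 <= 11 * C0 ^+ 2 * h.
Proof.
move=> M0 hM Hd; have MR : 0 < M%:R :> R by rewrite ltr0n.
have h0 : 0 < h by rewrite hM invr_gt0.
have Mh : M%:R * h = 1 by rewrite hM divff// gt_eqF.
rewrite (bigID (fun n => (M < `|n|)%N)) /= addrC.
have -> : 11 * C0 ^+ 2 * h = 3 * C0 ^+ 2 * h + 8 * C0 ^+ 2 * h by ring.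
have Hd2 n : n != 0 -> cabs (d n) ^+ 2 <= C0 ^+ 2 * (n%:~R ^+ 2)^-1.
  move=> n0; rewrite -exprVn -exprMn.
  have n1 : 0 < `|n%:~R| :> R by rewrite normr_gt0 intr_eq0.
  have C00 : 0 <= C0 / `|n%:~R| := le_trans (cabs_ge0 _) (Hd n n0).
  rewrite -[leRHS]real_normK ?num_real// normrM normrV ?unitfE ?intr_eq0//.
  have -> : `|C0| / `|n%:~R| = `|C0 / `|n%:~R| |.
    by rewrite normrM normrV ?unitfE ?normr_eq0 ?intr_eq0// normr_id.
  by rewrite real_normK ?num_real// lerXn2r ?nnegrE ?cabs_ge0//; exact: Hd.
apply: lerD.
  have -> : 3 * C0 ^+ 2 * h = 3 * M%:R * (C0 ^+ 2 * h ^+ 2).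
    transitivity (3 * C0 ^+ 2 * h * (M%:R * h)); [by rewrite Mh mulr1|ring].
  apply: (@le_trans _ _ (\sum_(n <- zs M) (C0 ^+ 2 * h ^+ 2))); last first.
    rewrite big_const_seq count_predT iter_addr_0 -[(C0 ^+ 2 * h ^+ 2) *+ _]mulr_natl.
    apply: ler_wpM2r; first by rewrite mulr_ge0 ?sqr_ge0.
    by rewrite size_zs -natrM ler_nat; lia.
  apply: (@le_trans _ _ (\sum_(n <- zs N | ~~ (M < `|n|)%N) (C0 ^+ 2 * h ^+ 2))).
    apply: ler_sum => n _; rewrite cabsM exprMn; have [->|n0] := eqVneq n 0.
      by rewrite te0 subrr cabs0 expr0n mul0r mulr_ge0 ?sqr_ge0.
    rewrite mulrC; apply: (@le_trans _ _ (C0 ^+ 2 * (n%:~R ^+ 2)^-1 * (n%:~R * h) ^+ 2)).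
      by apply: ler_pM; rewrite ?sqr_ge0 ?Hd2 ?expi_sub1.
    by rewrite exprMn -mulrA mulKf// sqrf_eq0 intr_eq0.
  apply: ler_sum_sub => [||i|i _ _]; [exact: uniq_zs|exact: uniq_zs| |by rewrite mulr_ge0 ?sqr_ge0].
  by rewrite !mem_zs -leqNgt andbT.
have -> : 8 * C0 ^+ 2 * h = 4 * C0 ^+ 2 * (2 / M%:R) by rewrite hM; ring.
apply: (le_trans _ (ler_wpM2l _ (sum_inv_sqr_tail N M0))); last by rewrite mulr_ge0 ?sqr_ge0.
rewrite mulr_sumr; apply: ler_sum => n Mn.
have n0 : n != 0 by lia.
have e4 : 2 ^+ 2 = 4 :> R by rewrite -natrX.
rewrite cabsM exprMn -[leRHS]mulrA; apply: ler_pM; [exact: sqr_ge0|exact: sqr_ge0| |exact: Hd2].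
by rewrite -e4 lerXn2r ?nnegrE ?cabs_ge0// expi_sub1_2.
Qed.

(** * A function with coefficients [d], a small perturbation of coefficients [c] that satisfy the
    fourth moment bound *)

Section OneFunction.
Variables (v : R -> R) (c d : int -> R[i]) (C0 Q : R) (e : nat -> R).
Hypothesis ctv : continuous_torus v.
Hypothesis e0 : e K @[K --> \oo] --> 0.
Hypothesis Hv : forall K x, cabs ((v x)%:C - tp (zs (2 ^ K)) d x) <= e K.
Hypothesis C00 : 0 <= C0.
Hypothesis Q0 : 0 <= Q.
Hypothesis Hd : forall n, n != 0 -> cabs (d n) <= C0 / `|n%:~R|.
Hypothesis Hc : forall n, n != 0 -> cabs (c n) <= C0 / `|n%:~R|.
Hypothesis Hr : forall n, n != 0 -> cabs (d n - c n) <= C0 / (`|n%:~R| * wt n).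
Hypothesis Hq : forall k, n4 (blk k) c <= Q * (k.+1%:R ^+ 2 * (4 ^+ k)^-1).

Let cv : continuous v := ctv.2.
Let Dl (h x : R) : R := v (x + h) - v x.

Let cDl h : continuous (Dl h).
Proof. by apply: contD; [exact: cont_shift|exact: contN]. Qed.

Let lDl h : l2 (fun x => (Dl h x)%:C).
Proof. by apply: cC_l2; apply: cC_R; exact: cDl. Qed.

Lemma fc_increment h n : fc (fun x => (Dl h x)%:C) n = (te n h - 1) * d n.
Proof.
apply: (@fc_unif R (Dl h) (fun n => (te n h - 1) * d n) (fun K => e K + e K)) => //.
  by rewrite -(addr0 0); apply: cvgD.
move=> K x; have -> : (Dl h x)%:C - tp (zs (2 ^ K)) (fun n => (te n h - 1) * d n) x
  = ((v (x + h))%:C - tp (zs (2 ^ K)) d (x + h)) - ((v x)%:C - tp (zs (2 ^ K)) d x).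
  have -> : tp (zs (2 ^ K)) (fun n => (te n h - 1) * d n) x = tp (zs (2 ^ K)) d (x + h) - tp (zs (2 ^ K)) d x.
    rewrite /tp -sumrB; apply: eq_bigr => m _.
    by rewrite /te mulrDr expiD; ring.
  by rewrite /Dl CRB; ring.
by apply: (le_trans (cabsB _ _)); apply: lerD; exact: Hv.
Qed.

Lemma n2_increment k : n2 (fun x => (Dl (2 ^+ k.+1)^-1 x)%:C) <=
  2 * pi * (11 * C0 ^+ 2 * (2 ^+ k.+1)^-1).
Proof.
apply: n2_le_coefs => // N; under eq_bigr do rewrite fc_increment.
by apply: (@sum_modulus d C0 _ (2 ^ k.+1)) => //; rewrite ?expn_gt0// natrX.
Qed.

Let kap : R := 1 - cos (2^-1).

Lemma kappa_gt0 : 0 < kap.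
Proof.
rewrite subr_gt0 -[X in _ < X]cos0 ltr_cos ?invr_gt0// ?in_itv /= ?lexx ?pi_ge0//.
by have := pi_ge2 R; move=> ?; apply/andP; split; lra.
Qed.

Let Dk k : R := \sum_(n <- blk k) cabs (c n) ^+ 2.

(* Pairing the increment of [v] with the block of [c]; [1 - cos (n * h)] is bounded below
   on the block as [h * `|n|] lies in [1/2, 1]. *)
Lemma blk_lower k (h := (2 ^+ k.+1)^-1) :
  2 * pi * (kap * Dk k - 2 * \sum_(n <- blk k) cabs (d n - c n) * cabs (c n)) <=
  II (fun x => `|Dl h x| * cabs (tp (blk k) c x)).
Proof.
have lq := l2_tp (blk k) c.
have e1 : CI (fun x => (Dl h x)%:C * cj (tp (blk k) c x)) =
    (2 * pi)%:C * \sum_(n <- blk k) cj (c n) * ((te n h - 1) * d n).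
  rewrite CI_tpJ// mulr_sumr; apply: eq_bigr => n _.
  by rewrite fcE fc_increment mulrCA.
have ci : cI (fun x => (Dl h x)%:C * cj (tp (blk k) c x)) by apply: cI_M => //; exact: l2_J.
have : II (fun x => cabs ((Dl h x)%:C * cj (tp (blk k) c x))) =
    II (fun x => `|Dl h x| * cabs (tp (blk k) c x)).
  by apply: II_ext => x _; rewrite cabsM cabsR cabsJ.
move=> <-; apply: le_trans (cabs_CI ci).
rewrite e1 cabsM cabsR ger0_norm ?twopi_ge0// ler_wpM2l ?twopi_ge0//.
(* The real part of [te n h - 1] is never positive, so the sign is changed before passing to real
   parts. *)
apply: le_trans (le_Re_cabs _); rewrite -normrN; apply: le_trans (ler_norm _).
rewrite -cReN -sumrN Re_sum /Dk !mulr_sumr -sumrB.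
apply: ler_sum_mono => n nk _; have n0 : n != 0 by move: nk; rewrite mem_blk; lia.
have -> : - (cj (c n) * ((te n h - 1) * d n)) =
    (1 - te n h) * (cabs (c n) ^+ 2)%:C + (1 - te n h) * ((d n - c n) * cj (c n)).
  by rewrite -mulCJ; ring.
rewrite cReD; apply: lerD.
  rewrite cReM /= mulr0 subr0 ler_wpM2r ?sqr_ge0//.
  rewrite lerD2l lerN2.
  have nh : `|n%:~R * h| = `|n|%:R * h.
    by rewrite normrM normr_int [`|h|]ger0_norm// invr_ge0 exprn_ge0.
  have p2 := pi_ge2 R.
  have h0 : 0 < h by rewrite invr_gt0 exprn_gt0.
  have h2 : 2 ^+ k.+1 * h = 1 by rewrite /h divff// gt_eqF// exprn_gt0.
  have h2' : 2 ^+ k * h = 2^-1 by move: h2; rewrite exprS; lra.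
  move: nk; rewrite mem_blk => /andP[n1 n2].
  have m1 : 2 ^+ k * h <= `|n|%:R * h.
    by rewrite ler_pM2r// -natrX ler_nat ltnW.
  have m2 : `|n|%:R * h <= 2 ^+ k.+1 * h.
    by rewrite ler_pM2r// -natrX ler_nat.
  by apply: cos_lt1; rewrite ?invr_gt0// nh; lra.
apply: lerNnormlW; apply: (le_trans (le_Re_cabs _)).
rewrite cabsM cabsM cabsJ ler_wpM2r ?mulr_ge0 ?cabs_ge0//.
by rewrite cabsBC expi_sub1_2.
Qed.

(* Young twice: [p * q <= la * p + la^-1 * (p * q ^ 2)] and
   [p * q ^ 2 <= m * p ^ 2 + m^-1 * q ^ 4]. *)
Lemma blk_upper k (h := (2 ^+ k.+1)^-1) (la m : R) : 0 < la -> 0 < m ->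
  II (fun x => `|Dl h x| * cabs (tp (blk k) c x)) <=
  la * II (fun x => `|Dl h x|) + la^-1 * (m * n2 (fun x => (Dl h x)%:C) + m^-1 * n4 (blk k) c).
Proof.
move=> la0 m0; have cq := cont_cabs (cC_tp (blk k) c).
have cN : continuous (fun x => `|Dl h x|).
  by move=> x; apply: continuous_comp; [exact: cDl|exact: norm_continuous].
have i1 := iD_cont cN.
have i2 : iD (fun x => cabs (Dl h x)%:C ^+ 2) by case: (lDl h).
have i3 : iD (fun x => cabs (tp (blk k) c x) ^+ 4) by apply: iD_cont; exact: contX.
have j1 := iD_Z la i1; have j2 := iD_Z m i2; have j3 := iD_Z m^-1 i3.
have j4 := iD_D j2 j3; have j5 := iD_Z la^-1 j4.
rewrite /n2 /n4 -(II_Z m i2) -(II_Z m^-1 i3) -(II_D j2 j3) -(II_Z la^-1 j4) -(II_Z la i1) -(II_D j1 j5).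
apply: II_le; [by apply: iD_cont; exact: contM|exact: iD_D|].
move=> x _; rewrite cabsR.
move: `|Dl h x| (cabs (tp (blk k) c x)) (normr_ge0 (Dl h x)) (cabs_ge0 (tp (blk k) c x)) => p q p0 q0.
have a1 : p * q <= la * p + la^-1 * (p * q ^+ 2).
  rewrite -subr_ge0.
  have -> : la * p + la^-1 * (p * q ^+ 2) - p * q = la^-1 * p * ((la - q) ^+ 2 + la * q).
    by field; rewrite gt_eqF.
  by rewrite mulr_ge0 ?addr_ge0 ?sqr_ge0// mulr_ge0 ?invr_ge0// ltW.
apply: (le_trans a1); rewrite lerD2l ler_wpM2l ?invr_ge0 ?(ltW la0)//.
rewrite -subr_ge0.
have -> : m * p ^+ 2 + m^-1 * q ^+ 4 - p * q ^+ 2 = m^-1 * ((m * p - q ^+ 2) ^+ 2 + m * (p * q ^+ 2)).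
  by field; rewrite gt_eqF.
by rewrite mulr_ge0 ?addr_ge0 ?sqr_ge0 ?invr_ge0 ?mulr_ge0 ?sqr_ge0// ltW.
Qed.

(** On the block [1 / |n| <= 2 * h], so a term is at most [C0 ^ 2 * (4 * h ^ 2)] divided by [wt n],
    and there are at most [5 * 2 ^ k = 5 / (2 * h)] terms. The gain from [wt] is of order
    [h ^ (1/4)], which the cap [sg <= 1/2] turns into [h ^ (sg / 2)]. *)
Lemma blk_err k (h := (2 ^+ k.+1)^-1) (sg : R) : 0 < sg -> sg <= 2^-1 ->
  \sum_(n <- blk k) cabs (d n - c n) * cabs (c n) <= 20 * C0 ^+ 2 * (h * h `^ (sg / 2)).
Proof.
move=> s0 s1; have h0 : 0 < h by rewrite invr_gt0 exprn_gt0.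
have h2 : 2 ^+ k.+1 * h = 1 by rewrite /h divff// gt_eqF// exprn_gt0.
have h2' : 2 ^+ k * h = 2^-1 by move: h2; rewrite exprS; lra.
have h1 : h <= 1 by rewrite invf_le1 ?exprn_gt0// exprn_ege1// ler1n.
have k0 : 0 < 2 ^+ k :> R by rewrite exprn_gt0.
set z := h `^ (sg / 2).
have z0 : 0 <= z by exact: powR_ge0.
apply: (@le_trans _ _ (5 * 2 ^+ k * (C0 ^+ 2 * (4 * h ^+ 2) * (2 * z)))); last first.
  rewrite le_eqVlt; apply/orP; left; apply/eqP.
  have -> : 5 * 2 ^+ k * (C0 ^+ 2 * (4 * h ^+ 2) * (2 * z)) = 40 * (2 ^+ k * h) * C0 ^+ 2 * (h * z) by ring.
  by rewrite h2'; lra.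
apply: sum_const_blk => [|n nk]; first by rewrite !mulr_ge0 ?sqr_ge0// ltW.
have n0 : n != 0 by move: nk; rewrite mem_blk; lia.
move: (nk); rewrite mem_blk => /andP[n1 n2].
have m1 : 2 ^+ k <= `|n%:~R| :> R by rewrite normr_int -natrX ler_nat ltnW.
have m0 : 0 < `|n%:~R| :> R by rewrite (lt_le_trans k0).
have w1 : (2 * z)^-1 <= wt n.
  have hz : h `^ 4^-1 <= z by rewrite /z ger_powR//; lra.
  apply: (@le_trans _ _ ((2 ^+ k) `^ 4^-1)); last first.
    by rewrite /wt ge0_ler_powR// ?nnegrE ?(ltW k0) ?normr_ge0.
  have h40 : 0 < h `^ 4^-1 by exact: powR_gt0.
  apply: (@le_trans _ _ (2 * h `^ 4^-1)^-1).
    have hz2 : 2 * h `^ 4^-1 <= 2 * z by rewrite ler_pM2l.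
    rewrite lef_pV2 ?posrE//; first by rewrite mulr_gt0// (lt_le_trans h40).
    by rewrite mulr_gt0.
  have e2 : 2 ^+ k = (2 * h)^-1 by rewrite /h exprS; field; rewrite gt_eqF.
  have h20 : 0 <= 2 * h by rewrite mulr_ge0// ltW.
  rewrite e2 -(powR_inv1 h20) -powRrM (mulrC (-1)) powRrM powR_inv1 ?powR_ge0//.
  rewrite lef_pV2 ?posrE ?powR_gt0 ?mulr_gt0//.
  rewrite powRM ?(ltW h0)// ler_wpM2r ?(ltW h40)//.
  rewrite -[leRHS](powRr1 (_ : 0 <= 2))// ler_powR//; lra.
have zz : 0 < z by rewrite powR_gt0.
have w0 : 0 < wt n by apply: lt_le_trans w1; rewrite invr_gt0 mulr_gt0.
apply: (le_trans (ler_pM (cabs_ge0 _) (cabs_ge0 _) (Hr n0) (Hc n0))).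
have -> : C0 / (`|n%:~R| * wt n) * (C0 / `|n%:~R|) = C0 ^+ 2 * (`|n%:~R| ^+ 2)^-1 * (wt n)^-1.
  by field; rewrite !gt_eqF.
apply: ler_pM.
- by rewrite mulr_ge0 ?sqr_ge0// invr_ge0 sqr_ge0.
- by rewrite invr_ge0 ltW.
- rewrite ler_wpM2l ?sqr_ge0//.
  have -> : 4 * h ^+ 2 = ((2 ^+ k) ^+ 2)^-1 by rewrite /h (exprS 2 k); field; rewrite gt_eqF.
  by rewrite lef_pV2 ?posrE ?exprn_gt0// lerXn2r ?nnegrE ?(ltW k0)// ltW.
- by rewrite -[leRHS]invrK lef_pV2 ?posrE ?invr_gt0 ?mulr_gt0.
Qed.

(** A small dimension makes the mass [Dk k] of the block at most a constant times
    [k.+1 * h ^ (1 + sg / 2)]. The weight of H^(1/2 + de) costs about [h ^ (- 1 - 2 * de)] there, so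
    any [de < sg / 4] leaves a convergent series. *)
Lemma small_box_dim_sobolev : (upper_box_dim (graph_torus v) < (3 / 2)%:E)%E ->
  exists de B : R, 0 < de /\ forall N,
    \sum_(n <- zs N) (1 + n%:~R ^+ 2) `^ (2^-1 + de) * cabs (c n) ^+ 2 <= B.
Proof.
move=> /(box_dim_modulus ctv)[sg [C [h0 [s0 s1 Cp h0p HW]]]].
pose h (k : nat) : R := (2 ^+ k.+1)^-1.
have hp k : 0 < h k by rewrite invr_gt0 exprn_gt0.
have hl1 k : h k <= 1 by rewrite invf_le1 ?exprn_gt0// exprn_ege1// ler1n.
have kp := kappa_gt0; have pp := pi_gt0 R.
pose C2 := 2 * pi * (11 * C0 ^+ 2).
have C20 : 0 <= C2 by rewrite mulr_ge0 ?twopi_ge0// mulr_ge0 ?sqr_ge0.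
pose C3 := (C + C2 + 4 * Q + 80 * pi * C0 ^+ 2) / (2 * pi * kap).
have C30 : 0 <= C3.
  apply: divr_ge0; last by rewrite mulr_ge0 ?mulr_ge0 ?ltW.
  have : 0 <= pi * C0 ^+ 2 by rewrite mulr_ge0 ?sqr_ge0 ?ltW.
  by move=> hp'; rewrite -[80 * pi * _]mulrA !addr_ge0// mulr_ge0.
have step k : h k < h0 -> Dk k <= C3 * (k.+1%:R * (h k * h k `^ (sg / 2))).
  move=> hk; have := blk_lower k; have E := blk_err k s0 s1; rewrite -/(h k) in E *.
  set z := h k `^ (sg / 2) in E *; pose y := h k `^ 2^-1.
  have z0 : 0 < z by exact: powR_gt0.
  have y0 : 0 < y by exact: powR_gt0.
  have yy : y ^+ 2 = h k by rewrite -powR_mulrn ?powR_ge0// -powRrM mulVf ?powRr1// ltW.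
  have k1 : 1 <= k.+1%:R :> R by rewrite ler1n.
  (* With [y = h ^ (1/2)] and [z = h ^ (sg / 2)] the L^1 modulus is at most [C * y * z ^ 2], the
     squared L^2 modulus is of order [y ^ 2], and the fourth moment of order [k.+1 ^ 2 * y ^ 4]. The
     parameters [y / z] and [k.+1 * y] balance [blk_upper]: all its terms become at most of order
     [k.+1 * h * z]. *)
  have la0 : 0 < y / z by rewrite divr_gt0.
  have m0 : 0 < k.+1%:R * y by rewrite mulr_gt0.
  move=> /le_trans/(_ (blk_upper k la0 m0)); rewrite -/(h k).
  have W := HW _ (hp k) hk.
  have e1 : h k `^ (2^-1 + sg) = y * z ^+ 2.
    rewrite powRD; last by rewrite (gt_eqF (hp k)) implybT.
    by congr (_ * _); rewrite -powR_mulrn ?powR_ge0// -powRrM divfK.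
  rewrite e1 in W.
  have N2 := n2_increment k; rewrite -/(h k) in N2.
  have N4 := Hq k.
  have e4 : (4 ^+ k)^-1 = 4 * h k ^+ 2 :> R.
    have e22 : 2 ^+ 2 = 4 :> R by rewrite -natrX.
    rewrite -e22 -exprM mulnC exprM e22.
    by rewrite /h (exprS 2 k); field; rewrite expf_neq0.
  rewrite e4 in N4.
  move: (n2 _) (n4 _ _) (II _) W N2 N4 => n2D n4q W HWz N2 N4 HH.
  have b1 : y / z * W <= C * (h k * z).
    rewrite -yy; have -> : C * (y ^+ 2 * z) = y / z * (C * (y * z ^+ 2)).
      by field; rewrite gt_eqF.
    by rewrite ler_wpM2l// ltW.
  have b2 : (y / z)^-1 * (k.+1%:R * y * n2D + (k.+1%:R * y)^-1 * n4q) <=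
            k.+1%:R * (h k * z) * (C2 + 4 * Q).
    have -> : k.+1%:R * (h k * z) * (C2 + 4 * Q) = (y / z)^-1 *
       (k.+1%:R * y * (C2 * h k) + (k.+1%:R * y)^-1 * (Q * (k.+1%:R ^+ 2 * (4 * h k ^+ 2)))).
      by rewrite -yy; field; rewrite !gt_eqF// (lt_le_trans _ k1).
    rewrite ler_wpM2l ?invr_ge0 ?(ltW la0)//; apply: lerD.
      rewrite ler_wpM2l ?(ltW m0)//; apply: (le_trans N2).
      by rewrite /C2 le_eqVlt; apply/orP; left; apply/eqP; ring.
    by rewrite ler_wpM2l// invr_ge0 ltW.
  have hz0 : 0 < h k * z by rewrite mulr_gt0.
  have b3 : 2 * pi * kap * Dk k <= C * (h k * z) + k.+1%:R * (h k * z) * (C2 + 4 * Q)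
       + 4 * pi * (20 * C0 ^+ 2 * (h k * z)).
    have HE := ler_wpM2l (ltW pp) E.
    have HH' := le_trans HH (lerD b1 b2).
    move: HH' HE; rewrite mulrBr ![pi * (20 * _ * _)]mulrA.
    move: (\sum_(n <- _) _) (h k * z) (C0 ^+ 2) => S hz C02.
    move: (C * hz + _) (Dk k) => A D1 HH1 HE.
    have -> : 2 * pi * kap * D1 = (2 * pi * (kap * D1) - 2 * pi * (2 * S)) + 4 * (pi * S) by ring.
    have -> : 4 * pi * (20 * C02 * hz) = 4 * (pi * (20 * C02) * hz) by ring.
    by apply: lerD => //; rewrite ler_wpM2l.
  rewrite /C3 mulrAC ler_pdivlMr ?mulr_gt0// mulrC; apply: (le_trans b3).
  have c1 : C * (h k * z) <= C * (k.+1%:R * (h k * z)).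
    by rewrite ler_wpM2l// ler_peMl// ltW.
  have c2 : 4 * pi * (20 * C0 ^+ 2 * (h k * z)) <= 80 * pi * C0 ^+ 2 * (k.+1%:R * (h k * z)).
    have -> : 4 * pi * (20 * C0 ^+ 2 * (h k * z)) = 80 * pi * C0 ^+ 2 * (h k * z) by ring.
    apply: ler_wpM2l; first by rewrite mulr_ge0 ?sqr_ge0// mulr_ge0// ltW.
    by rewrite ler_peMl// ltW.
  have -> : (C + C2 + 4 * Q + 80 * pi * C0 ^+ 2) * (k.+1%:R * (h k * z)) = C * (k.+1%:R * (h k * z))
    + k.+1%:R * (h k * z) * (C2 + 4 * Q) + 80 * pi * C0 ^+ 2 * (k.+1%:R * (h k * z)) by ring.
  by apply: lerD c2; rewrite lerD2r.
(* Half of the admissible range [de < sg / 4]; the remaining factor [h ^ (sg / 4)] is the geometric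
   ratio [r]. *)
pose de := sg / 8; have de0 : 0 < de by rewrite divr_gt0.
pose r := (2^-1 : R) `^ (sg / 4).
have r0 : 0 <= r by exact: powR_ge0.
have r1 : r < 1.
  have e1 : 1 = (1 : R) `^ (sg / 4) by rewrite powR1.
  rewrite /r [ltRHS]e1 gt0_ltr_powR ?nnegrE ?invr_ge0 ?invf_lt1 ?ltr1n//.
  by rewrite divr_gt0.
pose F n : R := (1 + n%:~R ^+ 2) `^ (2^-1 + de) * cabs (c n) ^+ 2.
have F0 n : 0 <= F n by rewrite mulr_ge0 ?powR_ge0 ?sqr_ge0.
have stepF k : h k < h0 -> \sum_(n <- blk k) F n <= 2 * C3 * (k.+1%:R * r ^+ k).
  move=> hk; have := step k hk.
  have hn n : n \in blk k -> (1 + n%:~R ^+ 2) `^ (2^-1 + de) <= 2 * h k `^ (- 1 - sg / 4).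
    rewrite mem_blk => /andP[_ n2].
    have nh : `|n%:~R| <= (h k)^-1 by rewrite normr_int invrK -natrX ler_nat.
    have hk1 : 1 <= (h k)^-1 by rewrite invf_ge1.
    have n1 : 1 + n%:~R ^+ 2 <= 2 * ((h k)^-1) ^+ 2.
      have : n%:~R ^+ 2 <= ((h k)^-1) ^+ 2.
        rewrite -(real_normK (num_real (n%:~R : R))) lerXn2r ?nnegrE ?normr_ge0//.
        exact: le_trans hk1.
      have : 1 <= ((h k)^-1) ^+ 2 by rewrite exprn_ege1.
      by lra.
    apply: (@le_trans _ _ ((2 * ((h k)^-1) ^+ 2) `^ (2^-1 + de))).
      apply: ge0_ler_powR => //; first by rewrite addr_ge0// ltW.
        by rewrite nnegrE addr_ge0 ?sqr_ge0.
      by rewrite nnegrE mulr_ge0 ?sqr_ge0.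
    rewrite powRM ?sqr_ge0//; apply: ler_pM; rewrite ?powR_ge0//.
      rewrite -[leRHS](powRr1 (_ : 0 <= 2))// ler_powR ?ler1n// /de; lra.
    rewrite -powR_mulrn ?invr_ge0 ?(ltW (hp k))// -powR_inv1 ?(ltW (hp k))// -!powRrM.
    by rewrite le_eqVlt; apply/orP; left; apply/eqP; congr (_ `^ _); rewrite /de; lra.
  move=> HD; apply: (@le_trans _ _ (2 * h k `^ (- 1 - sg / 4) * Dk k)).
    rewrite /Dk mulr_sumr; apply: ler_sum_mono => n nk _.
    by rewrite /F ler_wpM2r ?sqr_ge0//; exact: hn.
  apply: (le_trans (ler_wpM2l _ HD)); first by rewrite mulr_ge0 ?powR_ge0.
  have e1 : h k `^ (- 1 - sg / 4) * (h k * h k `^ (sg / 2)) = r ^+ k.+1.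
    rewrite -[X in _ * (X * _)](powRr1 (ltW (hp k))).
    rewrite -!powRD ?(gt_eqF (hp k)) ?implybT//.
    rewrite /r -powR_mulrn ?powR_ge0// -powRrM /h -exprVn -powR_mulrn ?invr_ge0// -powRrM.
    by congr (_ `^ _); lra.
  have -> : 2 * h k `^ (- 1 - sg / 4) * (C3 * (k.+1%:R * (h k * h k `^ (sg / 2)))) =
     2 * C3 * (k.+1%:R * (h k `^ (- 1 - sg / 4) * (h k * h k `^ (sg / 2)))) by ring.
  rewrite e1; apply: ler_wpM2l; first by rewrite mulr_ge0.
  by apply: ler_wpM2l => //; rewrite exprS ler_piMl ?exprn_ge0// ltW.
(* The modulus is only known for [h < h0]; the finitely many blocks before [k0] go into the
   constant. *)
have [k0 hk0] : exists k0, forall k, (k0 <= k)%N -> h k < h0.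
  have : (2^-1 : R) ^+ k @[k --> \oo] --> 0.
    by apply: cvg_expr; rewrite ger0_norm ?invr_ge0// invf_lt1// ltr1n.
  move=> /cvgrPdist_lt/(_ h0 h0p)[k0 _ H]; exists k0 => k kk.
  have := H k.+1 (leqW kk); rewrite /= sub0r normrN ger0_norm ?exprn_ge0 ?invr_ge0//.
  by rewrite exprVn.
exists de, (\sum_(n <- zs 1) F n + (\sum_(k < k0) \sum_(n <- blk k) F n +
   2 * C3 * ((1 - r) ^+ 2)^-1)); split => // N.
have [K NK] := zs_sub_pow N.
apply: (@le_trans _ _ (\sum_(n <- zs (2 ^ (k0 + K))) F n)).
  apply: ler_sum_sub => [||i|i _ _]; [exact: uniq_zs|exact: uniq_zs| |exact: F0].
  rewrite !mem_zs => h1 _; rewrite (leq_trans h1)// (leq_trans NK)// leq_pexp2l//.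
  exact: leq_addl.
rewrite sum_zs_blk lerD2l.
rewrite big_split_ord /= lerD2l.
apply: (@le_trans _ _ (\sum_(i < K) 2 * C3 * ((k0 + i).+1%:R * r ^+ (k0 + i)))).
  by apply: ler_sum => i _; apply: stepF; apply: hk0; exact: leq_addr.
rewrite -mulr_sumr; apply: ler_wpM2l; first by rewrite mulr_ge0.
apply: le_trans (sum_geom_lin (k0 + K) r0 r1).
rewrite big_split_ord /= lerDr; apply: sumr_ge0 => i _.
by rewrite mulr_ge0 ?exprn_ge0.
Qed.

End OneFunction.
End Dichotomy.

(** * The fourth moment for almost every time *)

Section Strichartz.
Variable R : realType.
Notation mu := (@lebesgue_measure R).
Notation D := (@torus_dom R).
Implicit Types (s : seq int) (b : int -> R[i]).

Definition airy_coef b (t : R) (n : int) : R[i] := te (n ^+ 3) t * b n.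

(* Phases affine in [n] cancel, so a translation in [x] does not change the fourth moment. *)
Lemma n4_phase s b (al be : R) : n4 s (fun n => expi (al + n%:~R * be) * b n) = n4 s b.
Proof.
apply: complexR_inj; rewrite !n4_quad; congr (_ * _).
apply: eq_bigr => u _; apply: eq_bigr => w /eqP uw.
have -> : expi (al + u.1%:~R * be) * b u.1 * (expi (al + u.2%:~R * be) * b u.2) =
    expi (2 * al + (u.1 + u.2)%:~R * be) * (b u.1 * b u.2).
  have -> : 2 * al + (u.1 + u.2)%:~R * be = (al + u.1%:~R * be) + (al + u.2%:~R * be).
    by rewrite intrD; ring.
  by rewrite (expiD (al + _)); ring.
have -> : expi (al + w.1%:~R * be) * b w.1 * (expi (al + w.2%:~R * be) * b w.2) =
    expi (2 * al + (w.1 + w.2)%:~R * be) * (b w.1 * b w.2).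
  have -> : 2 * al + (w.1 + w.2)%:~R * be = (al + w.1%:~R * be) + (al + w.2%:~R * be).
    by rewrite intrD; ring.
  by rewrite (expiD (al + _)); ring.
rewrite uw [cj (expi _ * _)]cjM -expiN.
transitivity (expi (2 * al + (w.1 + w.2)%:~R * be) * expi (- (2 * al + (w.1 + w.2)%:~R * be)) *
   (b u.1 * b u.2 * cj (b w.1 * b w.2))); first by ring.
by rewrite expi_mulN mul1r.
Qed.

Let ph (u w : int * int) : int := u.1 ^+ 3 + u.2 ^+ 3 - (w.1 ^+ 3 + w.2 ^+ 3).

Let res (u w : int * int) : bool := (u.1 + u.2 == w.1 + w.2) && (ph u w == 0).

(** With [b = c + d - a] the difference of the sums of cubes factors as
    [- 3 * (c + d) * (c - a) * (c - b)]. *)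
Lemma resonant_pairs (u w : int * int) : u.1 + u.2 = w.1 + w.2 -> ph u w = 0 ->
  [\/ w = u, w = (u.2, u.1) | u.2 = - u.1 /\ w.2 = - w.1].
Proof.
case: u w => [a b] [c d]; rewrite /ph /= => E1 E2.
have [E0|E0] := eqVneq (a + b) 0; first by apply: Or33; split; lia.
have bE : b = c + d - a by rewrite -E1; ring.
have : (c + d) * ((c - a) * (c - b)) = 0.
  have E3 : - 3 * ((c + d) * ((c - a) * (c - b))) = a ^+ 3 + b ^+ 3 - (c ^+ 3 + d ^+ 3).
    by rewrite bE; ring.
  by move: E3; rewrite E2; lia.
rewrite -E1 => /eqP; rewrite !mulf_eq0 (negbTE E0) /= => /orP[]/eqP h.
  by apply: Or31; congr (_, _); lia.
by apply: Or32; congr (_, _); lia.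
Qed.

Lemma mem_prs s (u : int * int) : (u \in prs s) = (u.1 \in s) && (u.2 \in s).
Proof.
case: u => a b; apply/allpairsP/idP => [[[x y] /= [xs ys [-> ->]]]|/andP[h1 h2]].
  by rewrite xs ys.
by exists (a, b).
Qed.

Lemma uniq_prs s : uniq s -> uniq (prs s).
Proof. by move=> us; apply: allpairs_uniq => // -[a b] [c d]. Qed.

Lemma size_prs s : size (prs s) = (size s * size s)%N.
Proof. exact: size_allpairs. Qed.

Lemma resonant_count s (u : int * int) : uniq s ->
  (count (res u) (prs s)
    <= 2 + (u.2 == (- u.1)%R) * size s)%N.
Proof.
move=> us; rewrite -size_filter.
set f := [seq x <- _ | res u x]; have uf : uniq f by rewrite filter_uniq// uniq_prs.
have Hf w : w \in f -> [/\ [\/ w = u, w = (u.2, u.1) | u.2 = - u.1 /\ w.2 = - w.1] & w \in prs s].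
  by rewrite mem_filter => /andP[/andP[/eqP h1 /eqP h2] h3]; split => //; exact: resonant_pairs.
case: eqVneq => h.
  rewrite mul1n.
  apply: (@leq_trans (size (u :: (u.2, u.1) :: [seq (m, (- m)%R) | m <- s]))); last by rewrite /= size_map.
  apply: uniq_leq_size => // w /Hf[[->|->|[_ w2]] hw]; rewrite !inE ?eqxx ?orbT//.
  apply/orP; right; apply/orP; right; apply/mapP; exists w.1.
    by move: hw; rewrite mem_prs => /andP[].
  by case: (w) w2 => a b /= ->.
rewrite mul0n addn0; apply: (@uniq_leq_size _ _ [:: u; (u.2, u.1)]) => // w /Hf[[->|->|[w2 _]] _].
- by rewrite inE eqxx.
- by rewrite !inE eqxx orbT.
- by rewrite w2 eqxx in h.
Qed.

(** Every pair has at most two trivial partners. The partners of sum zero concern at most [size s]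
    pairs and add at most [size s] for each, so this family is no larger than the trivial one:
    [2 + 1 = 3]. *)
Lemma resonant_total s : uniq s ->
  (\sum_(u <- prs s) count (res u) (prs s)
    <= 3 * (size s * size s))%N.
Proof.
move=> us; apply: (@leq_trans (\sum_(u <- prs s) (2 + (u.2 == (- u.1)%R) * size s))).
  by apply: leq_sum => u _; exact: resonant_count.
rewrite big_split /= big_const_seq count_predT iter_addn_0 size_prs -big_distrl /=.
have h : (\sum_(u <- prs s) (u.2 == (- u.1)%R) <= size s)%N.
  rewrite big_allpairs /=; apply: (@leq_trans (\sum_(m <- s) 1)); last first.
    by rewrite big_const_seq count_predT iter_addn_0 mul1n.
  apply: leq_sum => m _.
  rewrite (eq_bigr (fun j => if pred1 (- m)%R j then 1 else 0))%N; last by move=> j _ /=; case: eqP.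
  by rewrite -big_mkcond sum1_count count_uniq_mem ?leq_b1.
have := leq_mul h (leqnn (size s)); lia.
Qed.

Lemma n4_airy_trig s b t : (n4 s (airy_coef b t))%:C =
  \sum_(p <- [seq (u, w) | u <- prs s, w <- prs s] | p.1.1 + p.1.2 == p.2.1 + p.2.2)
    ((2 * pi)%:C * (b p.1.1 * b p.1.2 * cj (b p.2.1 * b p.2.2))) * te (ph p.1 p.2) t.
Proof.
rewrite n4_quad mulr_sumr [RHS]big_mkcond big_allpairs /=; apply: eq_bigr => u _.
rewrite -big_mkcond mulr_sumr /=; apply: eq_bigr => w _.
rewrite /airy_coef /ph !cjM !teD teN teD cjM; ring.
Qed.

Lemma cont_n4_airy s b : continuous (fun t => n4 s (airy_coef b t)).
Proof.
have : cC (fun t => (n4 s (airy_coef b t))%:C).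
  apply: (cC_ext (fun t => esym (n4_airy_trig s b t))).
  by apply: cC_sum => p; apply: cC_M; [exact: cC_cst|exact: cC_te].
by case.
Qed.

(* Averaging in time leaves the quadruples with [p.1.1 + p.1.2 = p.2.1 + p.2.2] and equal
   sums of cubes. *)
Lemma II_n4_airy s b (be : R) : uniq s -> 0 <= be -> (forall n, n \in s -> cabs (b n) <= be) ->
  II (fun t => n4 s (airy_coef b t)) <= (2 * pi) ^+ 2 * be ^+ 4 * (3 * (size s)%:R ^+ 2).
Proof.
move=> us be0 bb.
have E : (II (fun t => n4 s (airy_coef b t)))%:C = (2 * pi)%:C *
  \sum_(p <- [seq (u, w) | u <- prs s, w <- prs s] |
     (p.1.1 + p.1.2 == p.2.1 + p.2.2) && (ph p.1 p.2 == 0))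
    ((2 * pi)%:C * (b p.1.1 * b p.1.2 * cj (b p.2.1 * b p.2.2))).
  by rewrite -CI_R -CI_trig; apply: CI_ext => t _; rewrite n4_airy_trig.
have I0 : 0 <= II (fun t => n4 s (airy_coef b t)) by apply: II_ge0 => t _; exact: n4_ge0.
rewrite -[leLHS]ger0_norm// -cabsR E cabsM cabsR ger0_norm ?twopi_ge0//.
have -> : (2 * pi) ^+ 2 * be ^+ 4 * (3 * (size s)%:R ^+ 2) =
    (2 * pi) * (2 * pi * be ^+ 4 * (3 * (size s * size s))%N%:R).
  by rewrite !natrM; ring.
rewrite ler_wpM2l ?twopi_ge0//.
apply: (le_trans (cabs_sum _ _ _)).
apply: (@le_trans _ _ (\sum_(p <- [seq (u, w) | u <- prs s, w <- prs s] |
     (p.1.1 + p.1.2 == p.2.1 + p.2.2) && (ph p.1 p.2 == 0)) (2 * pi * be ^+ 4))).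
  apply: ler_sum_mono => -[u w] /allpairsP[[u' w'] /= [hu hw [-> ->]]] _.
  move: hu hw; rewrite !mem_prs => /andP[u1 u2] /andP[w1 w2].
  rewrite cabsM cabsR ger0_norm ?twopi_ge0// ler_wpM2l ?twopi_ge0//.
  rewrite !cabsM cabsJ cabsM.
  have -> : be ^+ 4 = (be * be) * (be * be) by ring.
  by apply: ler_pM; rewrite ?mulr_ge0 ?cabs_ge0//; apply: ler_pM; rewrite ?cabs_ge0 ?bb.
rewrite big_const_seq iter_addr_0 -[_ *+ _]mulr_natr.
rewrite ler_wpM2l ?mulr_ge0 ?twopi_ge0 ?exprn_ge0 ?pi_ge0// ler_nat.
apply: leq_trans (resonant_total us).
by rewrite -sum1_count big_mkcond big_allpairs /=; apply: leq_sum => u _; rewrite -big_mkcond sum1_count.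
Qed.

Lemma n4_airy_periodic s b t : n4 s (airy_coef b (t + 2 * pi)) = n4 s (airy_coef b t).
Proof. by congr n4; apply/funext => n; rewrite /airy_coef te_periodic. Qed.

Lemma sum_inv_sqr_nat N : \sum_(k < N) ((k.+1%:R : R) ^+ 2)^-1 <= 2.
Proof.
case: N => [|N]; first by rewrite big_ord0.
apply: (@le_trans _ _ (2 - N.+1%:R^-1)); last by rewrite gerBl invr_ge0.
elim: N => [|N ih]; first by rewrite big_ord_recr big_ord0 /= expr1n; lra.
rewrite big_ord_recr /=; apply: (le_trans (lerD ih (lexx _))).
rewrite -[N.+2%:R]natr1; have : 0 < N.+1%:R :> R by [].
move: (N.+1%:R : R) => x x0; rewrite -subr_ge0.
have -> : 2 - (x + 1)^-1 - (2 - x^-1 + ((x + 1) ^+ 2)^-1) = (x * (x + 1) ^+ 2)^-1.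
  by field; rewrite !gt_eqF ?addr_gt0.
by rewrite invr_ge0 mulr_ge0 ?sqr_ge0// ltW.
Qed.

(** Translation invariance, from the uniqueness of the measure with the given values on
    intervals. *)
Lemma negligible_shift (A : set R) (a : R) : mu.-negligible A ->
  mu.-negligible [set x | A (x + a)].
Proof.
move=> [B [mB B0 AB]]; pose f : measurableTypeR R -> measurableTypeR R := fun x => x + a.
have mf : measurable_fun setT f by apply: measurable_funD.
exists (f @^-1` B); split; [by rewrite -[X in measurable X]setTI; exact: mf| |by move=> x /= /AB].
rewrite -B0; change (pushforward mu f B = mu B).
apply/esym/lebesgue_measure_unique => //= _ [[x y]] _ <-.
rewrite /pushforward (_ : f @^-1` _ = `]x - a, y - a]%classic); last first.
  by apply/seteqP; split => z /=; rewrite !in_itv /= /f ltrBlDr lerBrDr.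
rewrite !lebesgue_measure_itv /= !lte_fin ltrD2r; case: ifP => // _.
by rewrite -!EFinD; congr (_%:E); ring.
Qed.

Lemma ae_mono (P Q : R -> Prop) : (forall t, P t -> Q t) ->
  {ae mu, forall t, P t} -> {ae mu, forall t, Q t}.
Proof.
move=> PQ hP; have sub : ~` [set t | Q t] `<=` ~` [set t | P t] by move=> t /= nQ /PQ.
case: hP => B [mB B0 PB]; exists B; split => // t ht; exact: PB (sub t ht).
Qed.

Lemma ae_periodic (P : R -> Prop) : (forall t, P (t + 2 * pi) = P t) ->
  {ae mu, forall t, D t -> P t} -> {ae mu, forall t, P t}.
Proof.
move=> pP; rewrite /almost_everywhere => h; change (mu.-negligible (~` [set t | P t])).
pose A k := [set x : R | (~` [set t | D t -> P t]) (x + (k%:~R : R) * (2 * pi))].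
(* [(-1) ^ odd k * (k./2)] runs through all integers, which turns the union over periods into one
   over natural numbers. *)
have nA : mu.-negligible (\bigcup_k A ((-1) ^+ odd k * (k./2)%:Z)).
  by apply: negligible_bigcup => k; exact: negligible_shift.
apply: negligibleS nA.
move=> x /= nPx; pose k := - Num.floor (x / (2 * pi)).
have tE : x + k%:~R * (2 * pi) = tmod x by rewrite /tmod /k mulrNz mulNr.
have [j jk] : exists j, (-1) ^+ odd j * (j./2)%:Z = k.
  case: (intP k) => [|n|n]; first by exists 0.
    by exists n.+1.*2; rewrite odd_double doubleK expr0 mul1r.
  by exists (n.+1.*2.+1); rewrite /= odd_double uphalf_double expr1 mulN1r.
exists j => //; rewrite /A jk /= tE => H.
have := tmod_dom x => /andP[t0 t1].
apply: nPx; rewrite -(@tmodE R Prop P x pP); apply: H.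
by rewrite /torus_dom /= in_itv /= t0 ltW.
Qed.

(** Over a period of [t] the fourth moment of block [k] has mean of order [4 ^ (- k)]. Multiplied by
    [4 ^ k / k.+1 ^ 2] the moments have a summable sequence of means, so their sum over [k] is
    finite for almost every [t]; its value serves as [Q]. The factor [k.+1 ^ 2] is the whole
    loss. *)
Lemma strichartz_ae b (C : R) : 0 <= C -> (forall n, n != 0 -> cabs (b n) <= C / `|n%:~R|) ->
  {ae mu, forall t : R, exists2 Q, 0 <= Q &
     forall k, n4 (blk k) (airy_coef b t) <= Q * (k.+1%:R ^+ 2 * (4 ^+ k)^-1)}.
Proof.
move=> C0 Hb; apply: ae_periodic => [t|].
  by apply/propext; split => -[Q Q0 H]; exists Q => // k; move: (H k); rewrite n4_airy_periodic.
pose F k t : R := 4 ^+ k * (k.+1%:R ^+ 2)^-1 * n4 (blk k) (airy_coef b t).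
have cF k : continuous (F k).
  by apply: contM; [exact: cst_continuous|exact: cont_n4_airy].
have F0 k t : 0 <= F k t by rewrite mulr_ge0 ?n4_ge0// mulr_ge0 ?invr_ge0 ?sqr_ge0.
have iF k := iD_cont (cF k).
(* [75 = 3 * 5 ^ 2]: at most [3 * size ^ 2] resonant quadruples, in a block of at most [5 * 2 ^ k]
   frequencies. *)
pose G := (2 * pi) ^+ 2 * C ^+ 4 * 75.
have G0 : 0 <= G by rewrite mulr_ge0// mulr_ge0 ?sqr_ge0 ?exprn_ge0.
have IF k : II (F k) <= G * (k.+1%:R ^+ 2)^-1.
  rewrite II_Z; last by apply: iD_cont; exact: cont_n4_airy.
  have k0 : 0 < 2 ^+ k :> R by rewrite exprn_gt0.
  have h : II (fun t => n4 (blk k) (airy_coef b t)) <= G * (4 ^+ k)^-1.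
    apply: (le_trans (@II_n4_airy (blk k) b (C / 2 ^+ k) (uniq_blk k) _ _)).
    - by rewrite divr_ge0// ltW.
    - move=> n; rewrite mem_blk => /andP[n1 n2]; apply: (le_trans (Hb n _)); first by lia.
      have n1' : 2 ^+ k <= `|n%:~R| :> R by rewrite normr_int -natrX ler_nat ltnW.
      by rewrite ler_wpM2l// lef_pV2 ?posrE// (lt_le_trans k0).
    have sz : (size (blk k))%:R ^+ 2 <= (5 * 2 ^+ k) ^+ 2 :> R.
      rewrite lerXn2r ?nnegrE ?mulr_ge0 ?(ltW k0)//.
      by rewrite -natrX -natrM ler_nat size_blk.
    have e22 : 4 ^+ k = (2 ^+ k) ^+ 2 :> R.
      have e4 : 2 ^+ 2 = 4 :> R by rewrite -natrX.
      by rewrite -exprM mulnC exprM e4.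
    have -> : G * (4 ^+ k)^-1 = (2 * pi) ^+ 2 * (C / 2 ^+ k) ^+ 4 * (3 * (5 * 2 ^+ k) ^+ 2).
      by rewrite /G e22; field; rewrite gt_eqF.
    apply: ler_wpM2l; last by rewrite ler_wpM2l.
    by rewrite mulr_ge0 ?sqr_ge0// exprn_ge0// divr_ge0// ltW.
  have k40 : 0 < 4 ^+ k :> R by rewrite exprn_gt0.
  apply: (le_trans (ler_wpM2l _ h)); first by rewrite mulr_ge0 ?invr_ge0 ?sqr_ge0// ltW.
  have -> : 4 ^+ k * (k.+1%:R ^+ 2)^-1 * (G * (4 ^+ k)^-1) = G * (k.+1%:R ^+ 2)^-1 * (4 ^+ k * (4 ^+ k)^-1) by ring.
  by rewrite divff ?mulr1// gt_eqF.
pose f t : \bar R := (\sum_(k <oo) (F k t)%:E)%E.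
have mF k : measurable_fun D (fun t => (F k t)%:E) by apply/measurable_EFinP; exact: mD_iD.
have If : (\int[mu]_(t in D) f t <= (G * 2)%:E)%E.
  rewrite integral_nneseries//; last by move=> k t _; rewrite lee_fin.
    apply: lime_le.
      apply: is_cvg_nneseries => k _ _; apply: integral_ge0 => t _; rewrite lee_fin; exact: F0.
    apply: nearW => N.
    under eq_bigr do rewrite -EFin_II//.
    rewrite sumEFin lee_fin big_mkord; apply: (@le_trans _ _ (\sum_(k < N) G * (k.+1%:R ^+ 2)^-1)).
      by apply: ler_sum => k _; exact: IF.
    by rewrite -mulr_sumr ler_wpM2l// sum_inv_sqr_nat.
  exact: measurable_torus_dom.
have f0 t : D t -> (0 <= f t)%E by move=> _; apply: nneseries_ge0 => k _ _; rewrite lee_fin.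
have fint : mu.-integrable D f.
  apply/integrableP; split.
    apply: (@ge0_emeasurable_sum _ _ _ D (fun k t => (F k t)%:E) xpredT) => [k t _ _|k _].
      by rewrite lee_fin.
    exact: mF.
  under eq_integral => t; first (rewrite inE => Dt; rewrite gee0_abs; last exact: f0; over).
  by apply: le_lt_trans If _; rewrite ltry.
have faeD : {ae mu, forall t, D t -> f t \is a fin_num}.
  by apply: integrable_ae fint; exact: measurable_torus_dom.
apply: (ae_mono _ faeD) => t Ht Dt.
have := Ht Dt => fin; exists (fine (f t)); first exact/fine_ge0/f0.
move=> k.
have Fk : F k t <= fine (f t).
  rewrite -lee_fin fineK// /f (nneseries_split 0 k.+1)//; last by move=> j _; rewrite lee_fin.
  rewrite add0n big_mkord big_ord_recr /= addeAC leeDr//.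
  rewrite adde_ge0//; first by apply: sume_ge0 => j _; rewrite lee_fin.
  by apply: nneseries_ge0 => j _ _; rewrite lee_fin.
have k40 : 0 < 4 ^+ k :> R by rewrite exprn_gt0.
have k0 : 0 < k.+1%:R :> R by [].
have -> : n4 (blk k) (airy_coef b t) = F k t * (k.+1%:R ^+ 2 * (4 ^+ k)^-1).
  by rewrite /F; field; rewrite gt_eqF//= gt_eqF.
by rewrite ler_wpM2r// mulr_ge0 ?sqr_ge0// invr_ge0 ltW.
Qed.

End Strichartz.

(** * From Fourier coefficients to continuous representatives *)

Section Roughness.
Variable R : realType.
Notation mu := (@lebesgue_measure R).
Notation D := (@torus_dom R).
Implicit Types (g v : R -> R) (c d : int -> R[i]).

Lemma fc_cj g n : l2 (fun x => (g x)%:C) ->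
  fc (fun x => (g x)%:C) (- n) = cj (fc (fun x => (g x)%:C) n).
Proof.
move=> lg; rewrite /fc cjM cjR -CI_J; last by apply: cI_M => //; apply: cC_l2; exact: cC_te.
by congr (_ * _); apply: CI_ext => x _; rewrite cjM cjR -teN.
Qed.

Lemma in_sobolev_bound g (s B : R) : L2_torus g ->
  (forall N, \sum_(n <- zs N) (1 + n%:~R ^+ 2) `^ s * cabs (fourier_coef g n) ^+ 2 <= B) ->
  in_sobolev s g.
Proof.
move=> Lg H; split => //.
apply: (@le_lt_trans _ _ B%:E); last exact: ltry.
apply: ge_ereal_sup => _ [X [finX _]] <-.
rewrite fsbig_finite//= sumEFin lee_fin; pose N := (\sum_(i <- finmap.enum_fset (fset_set X)) `|i|)%N; apply: (le_trans _ (H N)).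
apply: ler_sum_sub => [||i iX _|i _ _].
- exact: finmap.fset_uniq.
- exact: uniq_zs.
- rewrite mem_zs andbT /N (big_rem i)//=; exact: leq_addr.
- by rewrite mulr_ge0 ?powR_ge0 ?sqr_ge0.
Qed.

(** A base below 2 is what matters: the sup bound of a block loses [2 ^ k] and the fourth moment
    gains [4 ^ k], so that [3/2] leaves the ratio [3/4]. The induction step holds once
    [k.+1 >= 5]. *)
Lemma succ_sqr_geom k : (k.+1%:R ^+ 2 : R) <= 5 * (3 / 2) ^+ k.
Proof.
elim: k => [|k ih]; first by rewrite expr0; lra.
have [k3|k3] := ltnP k 4.
  by move: k k3 {ih} => [|[|[|[|k]]]]// _; rewrite !exprS expr0; lra.
rewrite (exprS (3 / 2)) mulrCA; apply: le_trans (ler_wpM2l _ ih); last by lra.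
rewrite -[k.+2%:R]natr1; have : 5 <= k.+1%:R :> R by rewrite ler_nat.
move: (k.+1%:R : R) => x x5; rewrite -subr_ge0.
have -> : 3 / 2 * x ^+ 2 - (x + 1) ^+ 2 = 2^-1 * ((x - 5) ^+ 2 + 6 * (x - 5) + 3) by field.
by rewrite mulr_ge0// !addr_ge0 ?sqr_ge0 ?mulr_ge0 ?subr_ge0.
Qed.

Lemma pow4_root (x : R) : 0 <= x -> (x `^ 4^-1) ^+ 4 = x.
Proof. by move=> x0; rewrite -powR_mulrn ?powR_ge0// -powRrM mulVf ?powRr1. Qed.

(** Fourth powers are compared: [9 * 2 ^ k] from [sup_n4], times [Q * 5 * (3/2) ^ k / 4 ^ k], is
    [45 * Q * (3/4) ^ k]. *)
Lemma blk_sup_n4 c (Q x : R) k : 0 <= Q ->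
  n4 (blk k) c <= Q * (k.+1%:R ^+ 2 * (4 ^+ k)^-1) ->
  cabs (tp (blk k) c x) <= (45 * Q) `^ 4^-1 * ((3 / 4) `^ 4^-1) ^+ k.
Proof.
move=> Q0 H; have k2 : 0 < 2 ^+ k :> R by rewrite exprn_gt0.
rewrite -(@ler_pXn2r _ 4) ?nnegrE ?cabs_ge0 ?mulr_ge0 ?exprn_ge0 ?powR_ge0//.
rewrite exprMn -exprM (mulnC k) exprM !pow4_root ?mulr_ge0//.
apply: (le_trans (@sup_n4 R (2 ^ k.+1) (blk k) c x (uniq_blk k) _)).
  by move=> n; rewrite mem_blk mem_zs => /andP[].
have e4 : 4 ^+ k = 2 ^+ k * 2 ^+ k :> R by rewrite -exprMn; congr (_ ^+ _); lra.
have h1 : 4 * (2 ^ k.+1)%:R + 1 <= 9 * 2 ^+ k :> R.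
  rewrite natrX exprS; have : 1 <= 2 ^+ k :> R by rewrite exprn_ege1// ler1n.
  by lra.
apply: (@le_trans _ _ (9 * 2 ^+ k * (Q * (5 * (3 / 2) ^+ k * (4 ^+ k)^-1)))).
  apply: ler_pM => //; rewrite ?addr_ge0 ?mulr_ge0 ?n4_ge0//.
  apply: (le_trans H); rewrite ler_wpM2l// ler_wpM2r ?invr_ge0 ?exprn_ge0//.
  exact: succ_sqr_geom.
have -> : (3 / 4 : R) ^+ k = (3 / 2) ^+ k * (2 ^+ k)^-1.
  by rewrite -exprVn -exprMn; congr (_ ^+ _); lra.
by rewrite le_eqVlt e4; apply/orP; left; apply/eqP; field; rewrite gt_eqF.
Qed.

(** The l^1 bound decays like [2 ^ (- k / 4)]; it is weakened to the rate of [blk_sup_n4] so that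
    the two can be added. *)
Lemma blk_sup_err c d (C x : R) k : 0 <= C ->
  (forall n, n != 0 -> cabs (d n - c n) <= C / (`|n%:~R| * wt R n)) ->
  cabs (tp (blk k) (fun n => d n - c n) x) <= 5 * C * ((3 / 4) `^ 4^-1) ^+ k.
Proof.
move=> C0 H; have k2 : 0 < 2 ^+ k :> R by rewrite exprn_gt0.
have q0 : 0 < (2 ^+ k) `^ 4^-1 :> R by exact: powR_gt0.
apply: (le_trans (cabs_sum _ _ _)).
apply: (@le_trans _ _ (5 * 2 ^+ k * (C / (2 ^+ k * (2 ^+ k) `^ 4^-1)))).
  apply: sum_const_blk => [|n nk]; first by rewrite divr_ge0// mulr_ge0 ?powR_ge0// ltW.
  have n0 : n != 0 by move: nk; rewrite mem_blk; lia.
  move: nk; rewrite mem_blk => /andP[n1 n2].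
  have m1 : 2 ^+ k <= `|n%:~R| :> R by rewrite normr_int -natrX ler_nat ltnW.
  have m2 : (2 ^+ k) `^ 4^-1 <= wt R n.
    by rewrite /wt ge0_ler_powR// nnegrE ?normr_ge0// ltW.
  rewrite cabsM cabs_te mulr1; apply: (le_trans (H n n0)); rewrite ler_wpM2l//.
  rewrite lef_pV2 ?posrE ?mulr_gt0 ?(lt_le_trans k2 m1) ?(lt_le_trans q0 m2)//.
  by apply: ler_pM => //; rewrite ltW.
have -> : 5 * 2 ^+ k * (C / (2 ^+ k * (2 ^+ k) `^ 4^-1)) = 5 * C * ((2 ^+ k) `^ 4^-1)^-1.
  by field; rewrite !gt_eqF.
rewrite ler_wpM2l ?mulr_ge0//.
have -> : ((2 ^+ k : R) `^ 4^-1)^-1 = ((2^-1 : R) `^ 4^-1) ^+ k.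
  have -> : ((2^-1 : R) `^ 4^-1) ^+ k = ((2 ^+ k)^-1) `^ 4^-1.
    rewrite -exprVn -powR_mulrn ?powR_ge0// -powRrM mulrC powRrM.
    by rewrite powR_mulrn ?invr_ge0.
  apply: (mulfI (lt0r_neq0 q0)); rewrite divff ?lt0r_neq0//.
  by rewrite -powRM ?invr_ge0 ?(ltW k2)// divff ?lt0r_neq0// powR1.
rewrite lerXn2r ?nnegrE ?powR_ge0// ge0_ler_powR ?nnegrE ?invr_ge0//; lra.
Qed.

Lemma wt_ge1 (n : int) : n != 0 -> 1 <= wt R n.
Proof.
move=> n0; rewrite /wt -[leLHS](powRr0 `|n%:~R|) ler_powR// ?invr_ge0//.
exact: norm_int_ge1.
Qed.

(** Common to both flows. For Airy, [be] and the error are 0; for KdV, [be] is the translation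
    caused by the mean. The fourth moment hypothesis involves only [g] and [t], so the same times
    are good for both. *)
Lemma rough_graph g (t be C1 : R) d : BV_torus g -> ~ in_sobolev_half_plus g ->
  (exists2 Q : R, 0 <= Q & forall k, n4 (blk k) (airy_coef (fourier_coef g) t)
     <= Q * (k.+1%:R ^+ 2 * (4 ^+ k)^-1)) ->
  (forall n, d (- n) = cj (d n)) -> 0 <= C1 ->
  (forall n, n != 0 -> cabs (d n - te n be * airy_coef (fourier_coef g) t n)
     <= C1 / (`|n%:~R| * wt R n)) ->
  exists v, [/\ continuous_torus v, forall n, fourier_coef v n = d n &
    ((3 / 2)%:E <= upper_box_dim (graph_torus v))%E].
Proof.
move=> gBV rg [Q Q0 HQ] dN C10 Hr.
pose c n := te n be * airy_coef (fourier_coef g) t n.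
have cE n : cabs (c n) = cabs (fourier_coef g n) by rewrite !cabsM !cabs_te !mul1r.
have [C2 C20 H2] := BV_fourier_coef gBV.
have Hq k : n4 (blk k) c <= Q * (k.+1%:R ^+ 2 * (4 ^+ k)^-1).
  have -> : n4 (blk k) c = n4 (blk k) (airy_coef (fourier_coef g) t).
    rewrite -(n4_phase _ (airy_coef (fourier_coef g) t) 0 be).
    by congr n4; apply/funext => n; rewrite add0r.
  exact: HQ.
pose r : R := (3 / 4) `^ 4^-1.
have r0 : 0 <= r by exact: powR_ge0.
have r1 : r < 1.
  have e1 : 1 = (1 : R) `^ 4^-1 by rewrite powR1.
  by rewrite /r [ltRHS]e1 gt0_ltr_powR ?nnegrE ?invr_gt0//; lra.
pose A := (45 * Q) `^ 4^-1 + 5 * C1.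
have A0 : 0 <= A by rewrite addr_ge0 ?powR_ge0 ?mulr_ge0.
have Hsup k x : cabs (tp (blk k) d x) <= A * r ^+ k.
  have -> : tp (blk k) d x = tp (blk k) c x + tp (blk k) (fun n => d n - c n) x.
    by rewrite /tp -big_split; apply: eq_bigr => n _ /=; ring.
  rewrite mulrDl; apply: (le_trans (cabsD _ _)); apply: lerD; first exact: blk_sup_n4.
  exact: blk_sup_err.
have [v ctv Hv] := synthesis A0 r0 r1 dN Hsup.
have e0 : A / (1 - r) * r ^+ K @[K --> \oo] --> 0.
  rewrite -(mulr0 (A / (1 - r))); apply: cvgM; first exact: cvg_cst.
  by apply: cvg_expr; rewrite ger0_norm.
have fv n : fourier_coef v n = d n by rewrite fourier_coefE; apply: (fc_unif ctv.2 e0 Hv).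
exists v; split => //; rewrite leNgt; apply/negP => hd; apply: rg.
have C0 : 0 <= C1 + C2 by rewrite addr_ge0.
have inv0 (n : int) : 0 <= `|n%:~R|^-1 :> R by rewrite invr_ge0.
have Hc n : n != 0 -> cabs (c n) <= (C1 + C2) / `|n%:~R|.
  by move=> n0; rewrite cE; apply: (le_trans (H2 n n0)); rewrite ler_wpM2r// lerDr.
have Hdc n : n != 0 -> cabs (d n - c n) <= C1 / `|n%:~R|.
  move=> n0; apply: (le_trans (Hr n n0)).
  have n1 := norm_int_ge1 R n0; have w1 := wt_ge1 n0.
  have n1' := lt_le_trans ltr01 n1; have w1' := lt_le_trans ltr01 w1.
  rewrite ler_wpM2l// lef_pV2 ?posrE ?mulr_gt0// ler_peMr// ltW//.
have Hd n : n != 0 -> cabs (d n) <= (C1 + C2) / `|n%:~R|.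
  move=> n0; rewrite -(subrK (c n) (d n)) mulrDl; apply: (le_trans (cabsD _ _)).
  by apply: lerD; [exact: Hdc|rewrite cE; exact: H2].
have Hr' n : n != 0 -> cabs (d n - c n) <= (C1 + C2) / (`|n%:~R| * wt R n).
  move=> n0; apply: (le_trans (Hr n n0)); rewrite ler_wpM2r ?lerDl//.
  by rewrite invr_ge0 mulr_ge0 ?wt_ge0.
have [de [B [de0 HB]]] := small_box_dim_sobolev ctv e0 Hv C0 Q0 Hd Hc Hr' Hq hd.
exists (2^-1 + de); first by rewrite ltrDl.
apply: (@in_sobolev_bound _ _ B); first exact: BV_L2_torus.
move=> N; apply: le_trans (HB N); rewrite le_eqVlt; apply/orP; left; apply/eqP.
by apply: eq_bigr => n _; rewrite cE.
Qed.

Lemma continuous_L2_torus v : continuous_torus v -> L2_torus v.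
Proof.
move=> [pv cv]; apply: l2_L2_torus => //; first exact: continuous_measurable_fun.
by apply: cC_l2; exact: cC_R.
Qed.

Lemma airy_partialE g t N x : airy_partial g t N x = tp (zs N) (airy_coef (fourier_coef g) t) x.
Proof.
rewrite /airy_partial /tp sum_zs; apply: eq_bigr => k _ /=.
rewrite /airy_coef /te rmorphXn /= expiD (mulrC t); ring.
Qed.

Lemma airy_of_coefs g t v : continuous_torus v ->
  (forall n, fourier_coef v n = airy_coef (fourier_coef g) t n) -> is_airy g t v.
Proof.
move=> ctv H; split; first exact: continuous_L2_torus.
have lv : l2 (fun x => (v x)%:C) by apply: cC_l2; apply: cC_R; exact: ctv.2.
have E N : (\int[mu]_(x in D) (cabs (airy_partial g t N x - (v x)%:C) ^+ 2)%:E)%E =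
    (n2 (fun x => (v x)%:C - tp (zs N) (fourier_coef v) x))%:E.
  rewrite /n2 EFin_II; last by have [] := l2_B lv (l2_tp (zs N) (fourier_coef v)).
  apply: eq_integral => x _; rewrite airy_partialE cabsBC.
  by rewrite (_ : fourier_coef v = airy_coef (fourier_coef g) t)//; apply/funext.
rewrite (_ : (fun N => _) = (fun N => (n2 (fun x => (v x)%:C - tp (zs N) (fourier_coef v) x))%:E)); last first.
  by apply/funext => N; exact: E.
apply: cvg_EFin; first by apply: nearW.
apply/cvgrPdist_lt => e e0; have [L0 HL] := completeness lv e0.
exists L0 => // N /= /HL; rewrite sub0r normrN ger0_norm//; exact: n2_ge0.
Qed.

Lemma ae_eq_of_coefs (f v : R -> R) : L2_torus f -> L2_torus v ->
  (forall n, fourier_coef v n = fourier_coef f n) -> {ae mu, forall x, v x = f x}.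
Proof.
move=> Lf Lv H; have lf := L2_torus_l2 Lf; have lv := L2_torus_l2 Lv.
have ld : l2 (fun x => (v x - f x)%:C).
  by apply: l2_ext (l2_B lv lf) => x; rewrite CRB.
have cM (F : R -> R[i]) n : l2 F -> cI (fun x => F x * te (- n) x).
  by move=> lF; apply: cI_M => //; apply: cC_l2; exact: cC_te.
have z n : fc (fun x => (v x - f x)%:C) n = 0.
  have -> : fc (fun x => (v x - f x)%:C) n = fourier_coef v n - fourier_coef f n.
    rewrite !fourier_coefE /fc -mulrBr; congr (_ * _).
    rewrite -CI_B; [|exact: cM|exact: cM].
    by apply: CI_ext => x _; rewrite CRB mulrBl.
  by rewrite H subrr.
have n0 : n2 (fun x => (v x - f x)%:C) = 0.
  apply/eqP; rewrite eq_le n2_ge0 andbT -(mulr0 (2 * pi)).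
  apply: n2_le_coefs => // N; rewrite big1// => n _; by rewrite z cabs0 expr0n.
apply: ae_periodic => [x|].
  by apply/propext; rewrite (let: And3 h _ _ := Lf in h x) (let: And3 h _ _ := Lv in h x).
have m0 : measurable_fun D (fun x => ((v x - f x) ^+ 2)%:E).
  apply/measurable_EFinP; apply: measurable_funX; apply: measurable_funB.
    by case: Lv => _ h _; exact: measurable_funTS.
  by case: Lf => _ h _; exact: measurable_funTS.
have I0 : (\int[mu]_(x in D) `| ((v x - f x) ^+ 2)%:E | = 0)%E.
  rewrite -[RHS]/(0%:E) -n0 /n2 EFin_II; last by case: ld.
  by apply: eq_integral => x _; rewrite cabsR real_normK ?num_real//= ger0_norm ?sqr_ge0.
have mD := @measurable_torus_dom R.
have [B [mB B0 HB]] := (ae_eq_integral_abs mu mD m0).1 I0.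
exists B; split => // x /= nx; apply: HB => /= Hx; apply: nx => Dx.
have /= := Hx Dx; case => /eqP; rewrite sqrf_eq0 subr_eq0 => /eqP.
done.
Qed.

End Roughness.

(** * Bilinear and trilinear sums *)

Section Interactions.
Variable R : realType.

(** The zero frequency is left out: the mean is conserved and is treated as a drift. *)
Definition Zs (L : nat) : seq int := [seq n <- zs L | n != 0].

Lemma mem_Zs L n : (n \in Zs L) = (n != 0) && (`|n| <= L)%N.
Proof. by rewrite mem_filter mem_zs. Qed.

Lemma uniq_Zs L : uniq (Zs L). Proof. exact/filter_uniq/uniq_zs. Qed.

Lemma sum_ZsN (V : nmodType) L (F : int -> V) :
  \sum_(n <- Zs L) F (- n) = \sum_(n <- Zs L) F n.
Proof.
rewrite /Zs !big_filter (sum_zsN L (fun n => n != 0) F).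
by apply: eq_bigl => n; rewrite oppr_eq0.
Qed.

Section Sums.
Variables (L : nat) (V : nmodType).
Implicit Types (n : int).

(** The constraint is a conditional with default 0 rather than a range, so that the sums can be
    exchanged freely. *)
Definition S2 n (F : int -> int -> V) : V :=
  \sum_(p <- Zs L) \sum_(q <- Zs L) if p + q == n then F p q else 0.

Definition S3 n (F : int -> int -> int -> V) : V :=
  \sum_(a <- Zs L) \sum_(b <- Zs L) \sum_(c <- Zs L) if a + b + c == n then F a b c else 0.

Lemma S2_ext n F G : (forall p q, p \in Zs L -> q \in Zs L -> p + q = n -> F p q = G p q) ->
  S2 n F = S2 n G.
Proof.
move=> H; apply: eq_big_seq => p hp; apply: eq_big_seq => q hq.
by case: eqP => // h; exact: H.
Qed.

Lemma S3_ext n F G : (forall a b c, a \in Zs L -> b \in Zs L -> c \in Zs L ->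
  a + b + c = n -> F a b c = G a b c) -> S3 n F = S3 n G.
Proof.
move=> H; apply: eq_big_seq => a ha; apply: eq_big_seq => b hb; apply: eq_big_seq => c hc.
by case: eqP => // h; exact: H.
Qed.

Lemma S2_swap n F : S2 n F = S2 n (fun p q => F q p).
Proof.
rewrite /S2 exchange_big; apply: eq_bigr => p _; apply: eq_bigr => q _.
by rewrite addrC.
Qed.

Lemma S3_swap n F : S3 n F = S3 n (fun a b c => F a c b).
Proof.
apply: eq_bigr => a _; rewrite exchange_big; apply: eq_bigr => b _; apply: eq_bigr => c _.
by rewrite addrAC.
Qed.

Lemma S3_rot n F : S3 n F = S3 n (fun b c a => F a b c).
Proof.
rewrite /S3 exchange_big; apply: eq_bigr => b _ /=.
rewrite exchange_big; apply: eq_bigr => c _; apply: eq_bigr => a _.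
by rewrite -addrA addrC.
Qed.

Lemma S2_D n F G : S2 n (fun p q => F p q + G p q) = S2 n F + S2 n G.
Proof.
rewrite /S2 -big_split; apply: eq_bigr => p _; rewrite -big_split /=.
by apply: eq_bigr => q _; case: ifP; rewrite ?addr0.
Qed.

Lemma S3_D n F G : S3 n (fun a b c => F a b c + G a b c) = S3 n F + S3 n G.
Proof.
rewrite /S3 -big_split; apply: eq_bigr => p _; rewrite -big_split /=.
apply: eq_bigr => q _; rewrite -big_split /=.
by apply: eq_bigr => r _; case: ifP; rewrite ?addr0.
Qed.

(** The intermediate frequency [q] is eliminated, but its range survives as the condition
    [b + c \in Zs L]. This trace of the truncation later spoils the cancellation of the resonant
    terms. *)
Lemma S2_S2 n (G : int -> int -> int -> int -> V) :
  S2 n (fun p q => \sum_(b <- Zs L) \sum_(c <- Zs L) if b + c == q then G p q b c else 0) =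
  S3 n (fun a b c => if b + c \in Zs L then G a (b + c) b c else 0).
Proof.
apply: eq_bigr => a _.
transitivity (\sum_(q <- Zs L) \sum_(b <- Zs L) \sum_(c <- Zs L)
   if q == b + c then (if a + q == n then G a q b c else 0) else 0).
  apply: eq_bigr => q _; case: ifP => h.
    by apply: eq_bigr => b _; apply: eq_bigr => c _; rewrite eq_sym.
  by rewrite big1// => b _; rewrite big1// => c _; rewrite if_same.
rewrite exchange_big; apply: eq_bigr => b _ /=.
rewrite exchange_big; apply: eq_bigr => c _ /=.
rewrite -big_mkcond sum_eq1 ?uniq_Zs// addrA.
by case: ifP; case: ifP.
Qed.

End Sums.

Implicit Types (n a b c p q k j : int).

Lemma S2_Z (V : pzRingType) L (z : V) n F : S2 L n (fun p q => z * F p q) = z * S2 L n F.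
Proof.
rewrite /S2 mulr_sumr; apply: eq_bigr => p _; rewrite mulr_sumr; apply: eq_bigr => q _.
by case: ifP; rewrite ?mulr0.
Qed.

Lemma S3_Z (V : pzRingType) L (z : V) n F : S3 L n (fun a b c => z * F a b c) = z * S3 L n F.
Proof.
rewrite /S3 mulr_sumr; apply: eq_bigr => p _; rewrite mulr_sumr; apply: eq_bigr => q _.
by rewrite mulr_sumr; apply: eq_bigr => r _; case: ifP; rewrite ?mulr0.
Qed.

Lemma S2_le L n (F G : int -> int -> R) :
  (forall p q, p \in Zs L -> q \in Zs L -> p + q = n -> F p q <= G p q) ->
  S2 L n F <= S2 L n G.
Proof.
move=> H; apply: ler_sum_mono => p hp _; apply: ler_sum_mono => q hq _.
by case: eqP => // h; exact: H.
Qed.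

Lemma S3_le L n (F G : int -> int -> int -> R) :
  (forall a b c, a \in Zs L -> b \in Zs L -> c \in Zs L -> a + b + c = n ->
     F a b c <= G a b c) -> S3 L n F <= S3 L n G.
Proof.
move=> H; apply: ler_sum_mono => a ha _; apply: ler_sum_mono => b hb _.
by apply: ler_sum_mono => c hc _; case: eqP => // h; exact: H.
Qed.

Lemma cabs_S2 L n (F : int -> int -> R[i]) : cabs (S2 L n F) <= S2 L n (fun p q => cabs (F p q)).
Proof.
apply: (le_trans (cabs_sum _ _ _)); apply: ler_sum => p _.
apply: (le_trans (cabs_sum _ _ _)); apply: ler_sum => q _.
by case: ifP; rewrite ?cabs0.
Qed.

Lemma cabs_S3 L n (F : int -> int -> int -> R[i]) :
  cabs (S3 L n F) <= S3 L n (fun a b c => cabs (F a b c)).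
Proof.
apply: (le_trans (cabs_sum _ _ _)); apply: ler_sum => p _.
apply: (le_trans (cabs_sum _ _ _)); apply: ler_sum => q _.
apply: (le_trans (cabs_sum _ _ _)); apply: ler_sum => r _.
by case: ifP; rewrite ?cabs0.
Qed.

(** [iv 0 = 0], so excluded differences contribute nothing to the kernels. *)
Definition iv k : R := `|k%:~R|^-1.

Lemma iv_ge0 k : 0 <= iv k. Proof. by rewrite invr_ge0. Qed.

Lemma ivN k : iv (- k) = iv k. Proof. by rewrite /iv mulrNz normrN. Qed.

Lemma norm_iv k : k != 0 -> `|k%:~R| * iv k = 1.
Proof. by move=> k0; rewrite divff// normr_eq0 intr_eq0. Qed.

(* On [a + b + c = n] the differences [a - n] and [b - n] are [- (b + c)] and [- (c + a)]. *)
Definition ker n a b : R := iv (a - n) * iv (b - n) + iv (a - n) * iv (a + b)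
  + iv (b - n) * iv (a + b) + iv a * iv (a + b) + iv b * iv (a + b).

Lemma ker_ge0 n a b : 0 <= ker n a b.
Proof. by rewrite /ker !addr_ge0// mulr_ge0 ?iv_ge0. Qed.

(** For [al = |a|], [A = |a + b|], [B = |b + c|], [C = |c + a|]. In the product
    [(al + B) * (al + A)] only [al ^ 2] is not of the required form, and
    [2 * al ^ 2 <= al * (A + B + C)]. *)
Lemma kernel_bound_real (N al be A B C : R) : 0 < al -> 0 < A -> 0 < B -> 0 < C ->
  0 <= N -> 0 <= be -> N <= al + B -> be <= al + A -> 2 * al <= A + B + C ->
  N * be * (al^-1 * (A^-1 * B^-1 * C^-1)) <=
  2 * (A^-1 * B^-1 + B^-1 * C^-1 + A^-1 * C^-1 + al^-1 * C^-1).
Proof.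
move=> al0 A0 B0 C0 N0 be0 HN Hbe Hal.
have -> : 2 * (A^-1 * B^-1 + B^-1 * C^-1 + A^-1 * C^-1 + al^-1 * C^-1) =
   2 * (al * C + al * A + al * B + A * B) * (al^-1 * (A^-1 * B^-1 * C^-1)).
  by field; rewrite !gt_eqF.
rewrite ler_wpM2r ?mulr_ge0 ?invr_ge0 ?(ltW al0) ?(ltW A0) ?(ltW B0) ?(ltW C0)//.
apply: (le_trans (ler_pM N0 be0 HN Hbe)).
have h1 : 0 <= al * (A + B + C - 2 * al) by rewrite mulr_ge0 ?subr_ge0// ltW.
have h2 : 0 <= al * A by rewrite mulr_ge0 ?ltW.
have h3 : 0 <= al * B by rewrite mulr_ge0 ?ltW.
have h4 : 0 <= al * C by rewrite mulr_ge0 ?ltW.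
have h5 : 0 <= A * B by rewrite mulr_ge0 ?ltW.
by nra.
Qed.

(** * Pointwise bounds of the cubic weight by sums of products of two inverse distances *)

Section Kernel.
Variables (n a b c : int).
Hypotheses (E : a + b + c = n) (a0 : a != 0) (b0 : b != 0) (c0 : c != 0).
Hypotheses (A0 : a + b != 0) (B0 : b + c != 0) (C0 : c + a != 0).

Let P : R := iv (a + b) * iv (b + c) * iv (c + a).
Let gt0 k : k != 0 -> 0 < `|k%:~R| :> R.
Proof. by move=> k0; rewrite normr_gt0 intr_eq0. Qed.
Let nD (k j l : int) : (`|k| <= `|j| + `|l|)%N -> `|k%:~R| <= `|j%:~R| + `|l%:~R| :> R.
Proof. by rewrite !normr_int -natrD ler_nat. Qed.

Let kbc : ker n b c = iv (c + a) * iv (a + b) + iv (c + a) * iv (b + c)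
   + iv (a + b) * iv (b + c) + iv b * iv (b + c) + iv c * iv (b + c).
Proof.
have e1 : b - n = - (c + a) by rewrite -E; ring.
have e2 : c - n = - (a + b) by rewrite -E; ring.
by rewrite /ker e1 e2 !ivN.
Qed.

Let kac : ker n a c = iv (b + c) * iv (a + b) + iv (b + c) * iv (c + a)
   + iv (a + b) * iv (c + a) + iv a * iv (c + a) + iv c * iv (c + a).
Proof.
have e1 : a - n = - (b + c) by rewrite -E; ring.
have e2 : c - n = - (a + b) by rewrite -E; ring.
by rewrite /ker e1 e2 !ivN (addrC a c).
Qed.

Let kab : ker n a b = iv (b + c) * iv (c + a) + iv (b + c) * iv (a + b)
   + iv (c + a) * iv (a + b) + iv a * iv (a + b) + iv b * iv (a + b).
Proof.
have e1 : a - n = - (b + c) by rewrite -E; ring.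
have e2 : b - n = - (c + a) by rewrite -E; ring.
by rewrite /ker e1 e2 !ivN.
Qed.

(** [2 * n] is the sum of [a + b], [b + c] and [c + a], so that one of the three factors of [P] can
    be cancelled in each part. *)
Lemma kernel_a : `|n%:~R| * P <= ker n b c.
Proof.
have Hn : 2 * `|n%:~R| <= `|(a + b)%:~R| + `|(b + c)%:~R| + `|(c + a)%:~R| :> R.
  by rewrite !normr_int -natrM -!natrD ler_nat; lia.
have A1 := gt0 A0; have B1 := gt0 B0; have C1 := gt0 C0.
rewrite kbc /P /iv.
move: (`|n%:~R|) (`|(a + b)%:~R|) (`|(b + c)%:~R|) (`|(c + a)%:~R|) Hn A1 B1 C1 => N A B C Hn A1 B1 C1.
rewrite -!addrA; have : 0 <= `|b%:~R|^-1 / B + `|c%:~R|^-1 / B.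
  by rewrite addr_ge0// mulr_ge0 ?invr_ge0// ltW.
move: (_ / B + _) => z z0; rewrite !addrA -[leLHS]addr0; apply: lerD => //.
have -> : C^-1 / A + C^-1 / B + A^-1 / B = (A + B + C) * (A^-1 * B^-1 * C^-1).
  by field; rewrite !gt_eqF.
have h : 0 <= A^-1 * B^-1 * C^-1 by rewrite !mulr_ge0 ?invr_ge0 ?ltW.
by rewrite ler_wpM2r//; lra.
Qed.

(** [|n| <= |a| + |b + c| <= 2 * |a| * |b + c|] cancels two of the four factors at once. *)
Lemma kernel_boundary : `|n%:~R| * (iv a * P) <= 2 * ker n b c.
Proof.
have Hn : `|n%:~R| <= 2 * (`|a%:~R| * `|(b + c)%:~R|) :> R.
  rewrite !normr_int -!natrM ler_nat.
  have h1 : (0 < `|a|)%N by lia.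
  have h2 : (0 < `|(b + c)%R|)%N by lia.
  have h3 : (`|n| <= `|a| + `|(b + c)%R|)%N by lia.
  by nia.
have A1 := gt0 A0; have B1 := gt0 B0; have C1 := gt0 C0; have a1 := gt0 a0.
apply: (@le_trans _ _ (2 * (iv (c + a) * iv (a + b)))).
  rewrite /P /iv.
  move: (`|n%:~R|) (`|(a + b)%:~R|) (`|(b + c)%:~R|) (`|(c + a)%:~R|) (`|a%:~R|) Hn A1 B1 C1 a1 => N A B C al Hn A1 B1 C1 a1.
  have -> : 2 * (C^-1 / A) = 2 * (al * B) * (al^-1 * (A^-1 / B / C)).
    by field; rewrite !gt_eqF.
  by rewrite ler_wpM2r// !mulr_ge0 ?invr_ge0 ?ltW.
rewrite ler_wpM2l// kbc -!addrA lerDl !addr_ge0// mulr_ge0 ?iv_ge0//.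
Qed.

(** The factor [|b|] is the derivative lost when the time derivative falls on the frequency [b]. The
    gain [1 / |a|] alone cannot pay for it and for [|n|]; the sizes of the sums of two frequencies
    do. *)
Lemma kernel_b : `|n%:~R| * `|b%:~R| * (iv a * P) <= 2 * ker n a c.
Proof.
have A1 := gt0 A0; have B1 := gt0 B0; have C1 := gt0 C0; have a1 := gt0 a0.
have h1 : `|n%:~R| <= `|a%:~R| + `|(b + c)%:~R| :> R by apply: nD; lia.
have h2 : `|b%:~R| <= `|a%:~R| + `|(a + b)%:~R| :> R by apply: nD; lia.
have h3 : 2 * `|a%:~R| <= `|(a + b)%:~R| + `|(b + c)%:~R| + `|(c + a)%:~R| :> R.
  by rewrite !normr_int -natrM -!natrD ler_nat; lia.
apply: (le_trans (kernel_bound_real a1 A1 B1 C1 (normr_ge0 _) (normr_ge0 _) h1 h2 h3)).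
rewrite ler_wpM2l// kac -!/(iv _).
have : 0 <= iv c * iv (c + a) by rewrite mulr_ge0 ?iv_ge0.
by rewrite [iv (b + c) * iv (a + b)]mulrC; lra.
Qed.

Lemma kernel_c : `|n%:~R| * `|c%:~R| * (iv a * P) <= 2 * ker n a b.
Proof.
have A1 := gt0 A0; have B1 := gt0 B0; have C1 := gt0 C0; have a1 := gt0 a0.
have h1 : `|n%:~R| <= `|a%:~R| + `|(b + c)%:~R| :> R by apply: nD; lia.
have h2 : `|c%:~R| <= `|a%:~R| + `|(c + a)%:~R| :> R by apply: nD; lia.
have h3 : 2 * `|a%:~R| <= `|(c + a)%:~R| + `|(b + c)%:~R| + `|(a + b)%:~R| :> R.
  by rewrite !normr_int -natrM -!natrD ler_nat; lia.
have -> : P = iv (c + a) * iv (b + c) * iv (a + b) by rewrite /P; ring.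
apply: (le_trans (kernel_bound_real a1 C1 B1 A1 (normr_ge0 _) (normr_ge0 _) h1 h2 h3)).
rewrite ler_wpM2l// kab -!/(iv _).
have : 0 <= iv b * iv (a + b) by rewrite mulr_ge0 ?iv_ge0.
by rewrite [iv (b + c) * iv (c + a)]mulrC; lra.
Qed.

End Kernel.

(** * Bilinear and trilinear sums for a nonnegative sequence of finite l^2 mass *)

Section Estimates.
Variables (L : nat) (x : int -> R) (M : R).
Hypothesis x0 : forall k, 0 <= x k.
Hypothesis xM : \sum_(k <- Zs L) x k ^+ 2 <= M.

(** The bound that Young's inequality gives for the sum of [x k / |k - j|]: [M] is the mass and 4
    comes from the inverse squares. It also bounds each [x k]. *)
Let K := (M + 4) / 2.

Lemma mass_ge0 : 0 <= M.
Proof. by apply: le_trans xM; apply: sumr_ge0 => k _; exact: sqr_ge0. Qed.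

Let K0 : 0 <= K. Proof. by rewrite divr_ge0// addr_ge0// mass_ge0. Qed.

Lemma x_leK k : k \in Zs L -> x k <= K.
Proof.
move=> kL; have : x k ^+ 2 <= M.
  apply: le_trans xM; rewrite (big_rem k)//= lerDl.
  by apply: sumr_ge0 => j _; exact: sqr_ge0.
have := sqr_ge0 (x k - 1); rewrite /K sqrrB1; lra.
Qed.

Lemma sum_inv_dist_le j : \sum_(k <- Zs L) x k * iv (k - j) <= K.
Proof.
apply: (@le_trans _ _ (\sum_(k <- Zs L) (x k ^+ 2 / 2 + iv (k - j) ^+ 2 / 2))).
  apply: ler_sum => k _; have := sqr_ge0 (x k - iv (k - j)); rewrite sqrrB; lra.
rewrite big_split /= -!mulr_suml /K mulrDl; apply: lerD; first by rewrite ler_wpM2r.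
rewrite ler_wpM2r//; apply: le_trans (sum_inv_sqr_shift R L j).
apply: (@le_trans _ _ (\sum_(k <- Zs L) ((k - j)%:~R ^+ 2)^-1)).
  by apply: ler_sum => k _; rewrite /iv exprVn real_normK ?num_real.
by apply: ler_sum_sub => [||i iL _|i _ _]; rewrite ?uniq_Zs ?uniq_zs// ?invr_ge0 ?sqr_ge0//;
  move: iL; rewrite mem_Zs mem_zs andbT => /andP[].
Qed.

Lemma conv_mass m : S2 L m (fun j k => x j * x k) <= M.
Proof.
apply: (@le_trans _ _ (S2 L m (fun j k => x j ^+ 2 / 2 + x k ^+ 2 / 2))).
  by apply: S2_le => j k _ _ _; have := sqr_ge0 (x j - x k); rewrite sqrrB; lra.
have h : S2 L m (fun j k => x j ^+ 2 / 2) <= M / 2.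
  apply: (@le_trans _ _ (\sum_(j <- Zs L) x j ^+ 2 / 2)).
    apply: ler_sum => j _; rewrite -big_mkcond.
    apply: (@ler_sum1 _ _ _ _ (m - j)); rewrite ?uniq_Zs ?divr_ge0 ?sqr_ge0//.
    by move=> i _ /eqP <-; rewrite addrC addKr.
  by rewrite -mulr_suml ler_wpM2r.
by rewrite S2_D [X in _ + X]S2_swap; apply: (le_trans (lerD h h)); lra.
Qed.

(** The second center may depend on [p]: the choice [be p = - p] produces the factors
    [iv (p + q)]. *)
Lemma bilinear_le (al : int) (be : int -> int) :
  \sum_(p <- Zs L) \sum_(q <- Zs L) x p * x q * (iv (p - al) * iv (q - be p)) <= K ^+ 2.
Proof.
apply: (@le_trans _ _ (\sum_(p <- Zs L) x p * iv (p - al) * K)).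
  apply: ler_sum => p _.
  apply: (@le_trans _ _ (x p * iv (p - al) * \sum_(q <- Zs L) x q * iv (q - be p))).
    by rewrite mulr_sumr; apply: ler_sum => q _; rewrite le_eqVlt; apply/orP; left; apply/eqP; ring.
  by rewrite ler_wpM2l ?mulr_ge0 ?iv_ge0//; exact: sum_inv_dist_le.
by rewrite -mulr_suml expr2 ler_wpM2r//; exact: sum_inv_dist_le.
Qed.

Lemma ker_sum n : \sum_(a <- Zs L) \sum_(b <- Zs L) x a * x b * ker n a b <= 5 * K ^+ 2.
Proof.
pose s F := \sum_(a <- Zs L) \sum_(b <- Zs L) x a * x b * F a b.
have sw F : s F = s (fun a b => F b a).
  rewrite /s exchange_big; apply: eq_bigr => a _; apply: eq_bigr => b _.
  by rewrite (mulrC (x b)).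
have h1 := bilinear_le n (fun=> n).
have h2 := bilinear_le n (fun p => - p).
have h3 := bilinear_le 0 (fun p => - p).
have -> : \sum_(a <- Zs L) \sum_(b <- Zs L) x a * x b * ker n a b =
   s (fun a b => iv (a - n) * iv (b - n)) + s (fun a b => iv (a - n) * iv (b - - a)) +
   s (fun a b => iv (b - n) * iv (a - - b)) + s (fun a b => iv (a - 0) * iv (b - - a)) +
   s (fun a b => iv (b - 0) * iv (a - - b)).
  rewrite /s -!big_split; apply: eq_bigr => a _; rewrite /= -!big_split; apply: eq_bigr => b _.
  by rewrite /= /ker !opprK !subr0 (addrC b a); ring.
rewrite [s (fun a b => iv (b - n) * _)]sw [s (fun a b => iv (b - 0) * _)]sw.
have -> : 5 * K ^+ 2 = K ^+ 2 + K ^+ 2 + K ^+ 2 + K ^+ 2 + K ^+ 2 by ring.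
by do !apply: lerD.
Qed.

(** The third frequency is determined by the other two, so for [y] a sup bound is enough. This place
    is taken by the factor that carries the time derivative. *)
Lemma trilinear_le n (y : int -> R) (Y : R) : 0 <= Y -> (forall k, k \in Zs L -> 0 <= y k <= Y) ->
  S3 L n (fun a b c => x a * x b * y c * ker n a b) <= 5 * K ^+ 2 * Y.
Proof.
move=> Y0 Hy; apply: (@le_trans _ _ (\sum_(a <- Zs L) \sum_(b <- Zs L) x a * x b * ker n a b * Y)).
  apply: ler_sum => a _; apply: ler_sum => b _; rewrite -big_mkcond.
  have p0 : 0 <= x a * x b * ker n a b by rewrite !mulr_ge0 ?ker_ge0.
  apply: (@ler_sum1 _ _ _ _ (n - a - b)); rewrite ?uniq_Zs ?mulr_ge0 ?ker_ge0//.
    by move=> i _ /eqP <-; ring.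
  move=> /Hy/andP[_ hy] _; rewrite mulrAC ler_wpM2l//.
under eq_bigr do rewrite -mulr_suml.
by rewrite -mulr_suml ler_wpM2r//; exact: ker_sum.
Qed.

Definition nonres a b c := (a + b) * (b + c) * (c + a) != 0.

(** Up to constants, the amplitude after two integrations by parts: [1 / a] from the first and the
    inverse of the cubic phase from the second. *)
Definition cubic_weight a b c : R := iv a * (iv (a + b) * iv (b + c) * iv (c + a)).

Lemma cubw_ge0 a b c : 0 <= cubic_weight a b c.
Proof. by rewrite /cubic_weight !mulr_ge0 ?iv_ge0. Qed.

(** [y k] stands for the size of the time derivative at [k] divided by [|k|], and the three terms
    for its three positions. [25 = 5 * (1 + 2 + 2)], from [kernel_a], [kernel_b] and [kernel_c]. *)
Lemma cubic_bound n (y : int -> R) (Y : R) : 0 <= Y -> (forall k, k \in Zs L -> 0 <= y k <= Y) ->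
  S3 L n (fun a b c => if nonres a b c then `|n%:~R| * (`|a%:~R| * y a * x b * x c
    + `|b%:~R| * x a * y b * x c + `|c%:~R| * x a * x b * y c) * cubic_weight a b c else 0)
  <= 25 * K ^+ 2 * Y.
Proof.
move=> Y0 Hy.
have T := trilinear_le n Y0 Hy.
have T1 : S3 L n (fun a b c => x b * x c * y a * ker n b c) <= 5 * K ^+ 2 * Y by rewrite S3_rot.
have T2 : S3 L n (fun a b c => x a * x c * y b * ker n a c) <= 5 * K ^+ 2 * Y by rewrite S3_swap.
apply: (@le_trans _ _ (S3 L n (fun a b c => x b * x c * y a * ker n b c
   + 2 * (x a * x c * y b * ker n a c) + 2 * (x a * x b * y c * ker n a b)))); last first.
  by rewrite !S3_D !S3_Z; lra.
apply: S3_le => a b c aL bL cL E.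
have [[/andP[ya _] /andP[yb _]] /andP[yc _]] := (Hy a aL, Hy b bL, Hy c cL).
have f1 : 0 <= x b * x c * y a by rewrite !mulr_ge0.
have f2 : 0 <= x a * x c * y b by rewrite !mulr_ge0.
have f3 : 0 <= x a * x b * y c by rewrite !mulr_ge0.
have g1 := mulr_ge0 f1 (ker_ge0 n b c); have g2 := mulr_ge0 f2 (ker_ge0 n a c).
have g3 := mulr_ge0 f3 (ker_ge0 n a b).
case: ifPn => [nr|_]; last by rewrite !addr_ge0// mulr_ge0.
move: aL bL cL; rewrite !mem_Zs => /andP[a0 _] /andP[b0 _] /andP[c0 _].
move: nr; rewrite /nonres !mulf_eq0 !negb_or => /andP[/andP[A0 B0] C0].
have H1 := ler_wpM2l f1 (kernel_a E a0 b0 c0 A0 B0 C0).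
have H2 := ler_wpM2l f2 (kernel_b E a0 b0 c0 A0 B0 C0).
have H3 := ler_wpM2l f3 (kernel_c E a0 b0 c0 A0 B0 C0).
have e1 := norm_iv a0; rewrite /cubic_weight.
move: H1 H2 H3; move: (iv (a + b) * iv (b + c) * iv (c + a)) => P H1 H2 H3.
have -> : `|n%:~R| * (`|a%:~R| * y a * x b * x c + `|b%:~R| * x a * y b * x c +
     `|c%:~R| * x a * x b * y c) * (iv a * P) =
   x b * x c * y a * (`|n%:~R| * P) * (`|a%:~R| * iv a) +
   x a * x c * y b * (`|n%:~R| * `|b%:~R| * (iv a * P)) +
   x a * x b * y c * (`|n%:~R| * `|c%:~R| * (iv a * P)) by ring.
rewrite e1 mulr1; apply: lerD; last by rewrite [leRHS]mulrCA.
by apply: lerD => //; rewrite [leRHS]mulrCA.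
Qed.

Lemma cubic_boundary n :
  S3 L n (fun a b c => if nonres a b c then `|n%:~R| * (x a * x b * x c) * cubic_weight a b c else 0)
  <= 10 * K ^+ 3.
Proof.
have Hy k : k \in Zs L -> 0 <= x k <= K by move=> kL; rewrite x0 x_leK.
have T := trilinear_le n K0 Hy.
have T1 : S3 L n (fun a b c => x b * x c * x a * ker n b c) <= 5 * K ^+ 2 * K by rewrite S3_rot.
apply: (@le_trans _ _ (S3 L n (fun a b c => 2 * (x b * x c * x a * ker n b c)))); last first.
  rewrite S3_Z; have -> : 10 * K ^+ 3 = 2 * (5 * K ^+ 2 * K) by ring.
  by rewrite ler_wpM2l.
apply: S3_le => a b c aL bL cL E.
have f1 : 0 <= x b * x c * x a by rewrite !mulr_ge0.
case: ifPn => [nr|_]; last by rewrite mulr_ge0// mulr_ge0// ker_ge0.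
move: aL bL cL; rewrite !mem_Zs => /andP[a0 _] /andP[b0 _] /andP[c0 _].
move: nr; rewrite /nonres !mulf_eq0 !negb_or => /andP[/andP[A0 B0] C0].
have H1 := ler_wpM2l f1 (kernel_boundary E a0 b0 c0 A0 B0 C0).
rewrite [leRHS]mulrCA; apply: le_trans H1.
by rewrite /cubic_weight le_eqVlt; apply/orP; left; apply/eqP; ring.
Qed.

End Estimates.
End Interactions.

(** * Normal form identity *)

Section ComplexDerivative.
Variable R : realType.
Implicit Types (f g : R -> R[i]) (s : R) (l z : R[i]).

Definition iC : R[i] := 0 +i* 1.

Lemma cabs_iC : cabs iC = 1.
Proof. by rewrite /cabs /= expr0n expr1n add0r sqrtr1. Qed.

Lemma cabs_int (n : int) : cabs (n%:~R : R[i]) = `|n%:~R|.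
Proof. by rewrite -CR_int cabsR. Qed.

Lemma cabs_nat (n : nat) : cabs (n%:R : R[i]) = n%:R.
Proof. by rewrite -CR_nat cabsR normr_nat. Qed.

Definition cder f s l := is_derive s (1 : R) (fun x => complex.Re (f x)) (complex.Re l) /\
  is_derive s (1 : R) (fun x => complex.Im (f x)) (complex.Im l).

Lemma cder_eq f s l l' : cder f s l -> l = l' -> cder f s l'.
Proof. by move=> h <-. Qed.

Lemma cder_ext f g s l : f =1 g -> cder f s l -> cder g s l.
Proof. by move=> /funext ->. Qed.

Lemma cder_cst z s : cder (fun=> z) s 0.
Proof. by split; exact: is_derive_cst. Qed.

Lemma cder_D f g s l l' : cder f s l -> cder g s l' -> cder (fun x => f x + g x) s (l + l').
Proof.
move=> [f1 f2] [g1 g2]; split.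
  have := is_deriveD f1 g1; rewrite -cReD.
  by rewrite (_ : _ + _ = (fun x => complex.Re (f x + g x)))//; apply/funext => x /=; rewrite cReD.
have := is_deriveD f2 g2; rewrite -cImD.
by rewrite (_ : _ + _ = (fun x => complex.Im (f x + g x)))//; apply/funext => x /=; rewrite cImD.
Qed.

Lemma cder_M f g s l l' : cder f s l -> cder g s l' ->
  cder (fun x => f x * g x) s (l * g s + f s * l').
Proof.
move=> [f1 f2] [g1 g2]; split.
  have := is_deriveB (is_deriveM f1 g1) (is_deriveM f2 g2).
  rewrite (_ : _ - _ = (fun x => complex.Re (f x * g x))); last by apply/funext => x /=; rewrite cReM.
  by move=> h; apply: is_derive_eq1 h _; rewrite /GRing.scale /= cReD !cReM; ring.
have := is_deriveD (is_deriveM f1 g2) (is_deriveM f2 g1).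
rewrite (_ : _ + _ = (fun x => complex.Im (f x * g x))); last by apply/funext => x /=; rewrite cImM.
by move=> h; apply: is_derive_eq1 h _; rewrite /GRing.scale /= cImD !cImM; ring.
Qed.

Lemma cder_Z z f s l : cder f s l -> cder (fun x => z * f x) s (z * l).
Proof. by move=> h; apply: cder_eq (cder_M (cder_cst z s) h) _; rewrite mul0r add0r. Qed.

Lemma cder_B f g s l l' : cder f s l -> cder g s l' -> cder (fun x => f x - g x) s (l - l').
Proof.
move=> hf /(cder_Z (-1)); rewrite mulN1r => hg; apply: cder_ext (cder_D hf hg) => x.
by rewrite mulN1r.
Qed.

Lemma cder_sum (I : Type) (r : seq I) (F : I -> R -> R[i]) (dF : I -> R[i]) s :
  (forall i, cder (F i) s (dF i)) -> cder (fun x => \sum_(i <- r) F i x) s (\sum_(i <- r) dF i).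
Proof.
move=> h; elim: r => [|i r ih].
  by rewrite big_nil; apply: cder_ext (cder_cst 0 s) => x; rewrite big_nil.
by rewrite big_cons; apply: cder_ext (cder_D (h i) ih) => x; rewrite big_cons.
Qed.

Lemma cder_if (b : bool) f s l : cder f s l ->
  cder (fun x => if b then f x else 0) s (if b then l else 0).
Proof. by case: b => // _; exact: cder_cst. Qed.

Lemma cder_expi (r : R) s : cder (fun x => expi (r * x)) s (iC * r%:C * expi (r * s)).
Proof.
have dl : is_derive s (1 : R) (fun x => r * x) r.
  by have := is_deriveZ r (is_derive_id s (1 : R)); move=> h; apply: is_derive_eq1 h _; rewrite /GRing.scale /= mulr1.
split.
  have := is_derive1_comp (is_derive_cos (r * s)) dl.
  move=> h; apply: is_derive_eq1 h _; rewrite !cReM !cImM /=; ring.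
have := is_derive1_comp (is_derive_sin (r * s)) dl.
move=> h; apply: is_derive_eq1 h _; rewrite !cImM !cReM /=; ring.
Qed.

Lemma cder_te (k : int) s : cder (te k) s (iC * k%:~R * te k s).
Proof. by rewrite -CR_int; exact: cder_expi. Qed.

Lemma cder_S2 L n (F : int -> int -> R -> R[i]) dF s :
  (forall p q, cder (F p q) s (dF p q)) ->
  cder (fun x => S2 L n (fun p q => F p q x)) s (S2 L n dF).
Proof. by move=> h; do 2 apply: cder_sum => ?; exact: cder_if. Qed.

Lemma cder_S3 L n (F : int -> int -> int -> R -> R[i]) dF s :
  (forall a b c, cder (F a b c) s (dF a b c)) ->
  cder (fun x => S3 L n (fun a b c => F a b c x)) s (S3 L n dF).
Proof. by move=> h; do 3 apply: cder_sum => ?; exact: cder_if. Qed.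

Lemma derive_bound (f df : R -> R) (T be t : R) :
  (forall s, `|s| <= T -> is_derive s (1 : R) f (df s)) ->
  (forall s, `|s| <= T -> `|df s| <= be) -> `|t| <= T -> `|f t - f 0| <= be * `|t|.
Proof.
move=> hd hb ht.
have cf s : `|s| <= T -> {for s, continuous f}.
  by move=> hs; apply: differentiable_continuous; apply/derivable1_diffP; have [] := hd s hs.
have [t0|t0] := leP 0 t.
  have in0 s : s \in `[0, t] -> `|s| <= T.
    by rewrite in_itv /= => /andP[s0 st]; rewrite ger0_norm// (le_trans st)// -(ger0_norm t0).
  have [||c ct ->] := @MVT_segment R f df 0 t t0.
    move=> x xt; apply: hd; apply: in0; exact: subset_itv_oo_cc xt.
  - apply: continuous_in_subspaceT => x; rewrite inE => /in0; exact: cf.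
  - by rewrite subr0 normrM ler_wpM2r// hb// in0.
have in0 s : s \in `[t, 0] -> `|s| <= T.
  by rewrite in_itv /= => /andP[s0 st]; rewrite ler0_norm// (le_trans _ ht)// (ltr0_norm t0) lerN2.
have [||c ct] := @MVT_segment R f df t 0 (ltW t0).
  move=> x xt; apply: hd; apply: in0; exact: subset_itv_oo_cc xt.
- apply: continuous_in_subspaceT => x; rewrite inE => /in0; exact: cf.
- rewrite distrC => ->; rewrite sub0r normrM normrN ler_wpM2r// hb// in0//.
Qed.

(** The factor 2 comes from applying the mean value theorem to real and imaginary parts
    separately. *)
Lemma cder_bound f (df : R -> R[i]) (T be t : R) :
  (forall s, `|s| <= T -> cder f s (df s)) ->
  (forall s, `|s| <= T -> cabs (df s) <= be) -> `|t| <= T ->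
  cabs (f t - f 0) <= 2 * be * `|t|.
Proof.
move=> hd hb ht; apply: (le_trans (cabs_le_ReIm _)).
rewrite cReD cReN cImD cImN -mulrA mulr_natl mulr2n; apply: lerD.
  apply: (@derive_bound (fun s => complex.Re (f s)) (fun s => complex.Re (df s)) T be) => // s hs.
    by case: (hd s hs).
  exact: le_trans (le_Re_cabs _) (hb s hs).
apply: (@derive_bound (fun s => complex.Im (f s)) (fun s => complex.Im (df s)) T be) => // s hs.
  by case: (hd s hs).
exact: le_trans (le_Im_cabs _) (hb s hs).
Qed.

End ComplexDerivative.

(** * The two integrations by parts as an algebraic identity *)

Section NormalForm.
Variables (R : realType) (L : nat) (n : int).
Implicit Types (a b c p q k j : int) (v : int -> R -> R[i]) (V DV rh : int -> R[i]) (s : R).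
Local Notation Z := (Zs L).
Local Notation iC := (iC R).

Definition phi a b c : int := 3 * ((a + b) * (b + c) * (c + a)).

Definition nr a b c := (b + c \in Z) && nonres a b c.

(** The square of the solution at frequency [k] in the frame where the linear flow is removed: the
    phase is [p ^ 3 + q ^ 3 - k ^ 3]. *)
Definition quad (V : int -> R[i]) s k : R[i] := S2 L k (fun p q => te (- (3 * k * p * q)) s * (V p * V q)).

(* [bdyB] and [bdyC] come from integrating by parts in time the phases
   [p ^ 3 + q ^ 3 - n ^ 3 = - 3 * n * p * q] and [a ^ 3 + b ^ 3 + c ^ 3 - n ^ 3 = - phi a b c];
   [resC] collects the cubic terms with [phi = 0]. *)
Definition bdyB v s : R[i] := S2 L n (fun p q => (6 * p%:~R * q%:~R)^-1 *
  (te (- (3 * n * p * q)) s * (v p s * v q s))).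

Definition bdyC v s : R[i] := S3 L n (fun a b c => if nr a b c then
  (- (6 * a%:~R * (phi a b c)%:~R)^-1) * (te (- phi a b c) s * (v a s * v b s * v c s)) else 0).

(** [dB] and [dC] are the time derivatives of [bdyB] and [bdyC] with [DV] in place of the derivative
    of [V], so that the identity below is pure algebra at a fixed time. *)
Definition dB V DV s : R[i] := S2 L n (fun p q => (6 * p%:~R * q%:~R)^-1 *
  (iC * (- (3 * n * p * q))%:~R * te (- (3 * n * p * q)) s * (V p * V q)
   + te (- (3 * n * p * q)) s * (DV p * V q + V p * DV q))).

Definition dC V DV s : R[i] := S3 L n (fun a b c => if nr a b c then
  (- (6 * a%:~R * (phi a b c)%:~R)^-1) *
  (iC * (- phi a b c)%:~R * te (- phi a b c) s * (V a * V b * V c)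
   + te (- phi a b c) s * ((DV a * V b + V a * DV b) * V c + V a * V b * DV c)) else 0).

Definition resC V : R[i] := S3 L n (fun a b c =>
  if (b + c \in Z) && ~~ nonres a b c then iC / (6 * a%:~R) * (V a * V b * V c) else 0).

(** The part of [dC], with opposite sign, in which the derivative does not fall on the phase. *)
Definition nrC V DV s : R[i] := S3 L n (fun a b c => if nr a b c then
  (6 * a%:~R * (phi a b c)%:~R)^-1 *
  (te (- phi a b c) s * ((DV a * V b + V a * DV b) * V c + V a * V b * DV c)) else 0).

Definition rhoB V rh s : R[i] := S2 L n (fun p q =>
  (3 * p%:~R)^-1 * (te (- (3 * n * p * q)) s * (V p * rh q))).

Lemma cder_bdyB v dv s : (forall k, cder (v k) s (dv k)) ->
  cder (bdyB v) s (dB (fun k => v k s) dv s).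
Proof.
move=> h; apply: cder_S2 => p q; apply: cder_Z.
by apply: cder_M; [exact: cder_te|exact: cder_M].
Qed.

Lemma cder_bdyC v dv s : (forall k, cder (v k) s (dv k)) ->
  cder (bdyC v) s (dC (fun k => v k s) dv s).
Proof.
move=> h; apply: cder_S3 => a b c; apply: cder_if; apply: cder_Z.
by apply: cder_M; [exact: cder_te|apply: cder_M => //; exact: cder_M].
Qed.

Lemma intC_neq0 k : k != 0 -> (k%:~R : R[i]) != 0.
Proof. by rewrite intr_eq0. Qed.

Lemma Zs_neq0 k : k \in Z -> k != 0.
Proof. by rewrite mem_Zs => /andP[]. Qed.

Lemma phi_neq0 a b c : nonres a b c -> (phi a b c)%:~R != 0 :> R[i].
Proof. by rewrite /nonres /phi => h; rewrite intr_eq0 mulf_neq0. Qed.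

Section Identity.
Variables (V DV rh : int -> R[i]) (s : R).
Hypothesis nZ : n \in Z.
Hypothesis HDV : forall k, k \in Z ->
  DV k = - (iC * k%:~R / 2) * quad V s k + k%:~R * rh k.

(** The derivative of the phase, [- 3 * n * p * q], cancels the denominator [6 * p * q] and restores
    the quadratic term; the two remaining terms of the product rule are equal by symmetry in [p] and
    [q]. *)
Lemma dB_E : dB V DV s = - (iC * n%:~R / 2) * quad V s n +
  S2 L n (fun p q => (3 * p%:~R * q%:~R)^-1 * (te (- (3 * n * p * q)) s * (V p * DV q))).
Proof.
have -> : S2 L n (fun p q => (3 * p%:~R * q%:~R)^-1 * (te (- (3 * n * p * q)) s * (V p * DV q)))
  = S2 L n (fun p q => (6 * p%:~R * q%:~R)^-1 * (te (- (3 * n * p * q)) s * (V p * DV q))) +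
    S2 L n (fun p q => (6 * p%:~R * q%:~R)^-1 * (te (- (3 * n * p * q)) s * (DV p * V q))).
  rewrite [X in _ + X]S2_swap -S2_D; apply: S2_ext => p q pZ qZ _.
  have := intC_neq0 (Zs_neq0 pZ); have := intC_neq0 (Zs_neq0 qZ) => q0 p0.
  have -> : 3 * n * q * p = 3 * n * p * q by ring.
  by field; rewrite q0 p0.
rewrite /quad -S2_Z -!S2_D; apply: S2_ext => p q pZ qZ _.
have := intC_neq0 (Zs_neq0 pZ); have := intC_neq0 (Zs_neq0 qZ) => q0 p0.
rewrite mulrNz !intrM; field; by rewrite q0 p0.
Qed.

(** Inserting the equation for [DV q] with [q = b + c] cancels the denominator [q]. The phases add
    up because [n * a + b * c = (a + b) * (c + a)] when [a + b + c = n]. *)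
Lemma S2_DV : S2 L n (fun p q => (3 * p%:~R * q%:~R)^-1 * (te (- (3 * n * p * q)) s * (V p * DV q)))
  = rhoB V rh s - S3 L n (fun a b c => if b + c \in Z then
      iC / (6 * a%:~R) * (te (- phi a b c) s * (V a * V b * V c)) else 0).
Proof.
have -> : S2 L n (fun p q => (3 * p%:~R * q%:~R)^-1 * (te (- (3 * n * p * q)) s * (V p * DV q)))
  = rhoB V rh s + S2 L n (fun p q => \sum_(b <- Z) \sum_(c <- Z) if b + c == q then
      - (iC / (6 * p%:~R)) * (te (- (3 * n * p * q)) s * V p) *
       (te (- (3 * q * b * c)) s * (V b * V c)) else 0).
  rewrite -S2_D; apply: S2_ext => p q pZ qZ _.
  rewrite -/(S2 L q _) S2_Z -/(quad V s q) HDV//.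
  have := intC_neq0 (Zs_neq0 pZ); have := intC_neq0 (Zs_neq0 qZ) => q0 p0.
  by field; rewrite q0 p0.
congr (_ + _); rewrite S2_S2 -mulN1r -S3_Z; apply: S3_ext => a b c aZ bZ cZ E.
case: ifP => _; rewrite ?mulr0//.
have -> : te (- phi a b c) s = te (- (3 * n * a * (b + c))) s * te (- (3 * (b + c) * b * c)) s.
  by rewrite -teD; congr te; rewrite /phi -E; ring.
ring.
Qed.

(** The quadratic term is absorbed by [dB] and the nonresonant cubic terms by [dC]. What remains is
    a truncation error, resonant, or carries a time derivative inside a cubic term divided by its
    phase. *)
Lemma normal_form_identity : DV n - dB V DV s - dC V DV s =
  n%:~R * rh n - rhoB V rh s + resC V + nrC V DV s.
Proof.
rewrite dB_E S2_DV {1}HDV//.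
have -> : S3 L n (fun a b c => if b + c \in Z then
      iC / (6 * a%:~R) * (te (- phi a b c) s * (V a * V b * V c)) else 0)
   = resC V + (dC V DV s + nrC V DV s); last by ring.
rewrite -!S3_D; apply: S3_ext => a b c aZ bZ cZ E.
rewrite /nr; case: ifP => bc /=; last by rewrite !addr0.
have a0 := intC_neq0 (Zs_neq0 aZ).
have [h|h] := boolP (nonres a b c) => /=.
  have p0 := phi_neq0 h; rewrite mulrNz; field; by rewrite a0 p0.
have -> : phi a b c = 0 by move: h; rewrite /nonres negbK /phi => /eqP ->; rewrite mulr0.
rewrite oppr0 te0; ring.
Qed.

End Identity.
End NormalForm.

(** * Normal form estimates *)

Lemma absz_add_le (p q : int) : p != 0 -> q != 0 ->
  (`|(p + q)%R| <= 2 * (`|p| * `|q|))%N.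
Proof.
move=> p0 q0; have h1 : (0 < `|p|)%N by lia.
have h2 : (0 < `|q|)%N by lia.
have h3 : (`|(p + q)%R| <= `|p| + `|q|)%N by lia.
by nia.
Qed.

Section ResonantRow.
Variables (R : realType) (L : nat) (n : int) (V : int -> R[i]).
Implicit Types (a b c : int).
Local Notation Z := (Zs L).
Local Notation iC := (iC R).
Hypothesis nZ : n \in Z.
Hypothesis HJ : forall k, V (- k) = cj (V k).

Lemma notin_Zs a : n - a \notin Z -> a != n -> (L <= `|a| + `|n|)%N.
Proof.
rewrite mem_Zs negb_and negbK -ltnNge => /orP[/eqP h|h] an; last by lia.
by case/eqP: an; apply/eqP; rewrite eq_sym -subr_eq0 h.
Qed.

Lemma sum_pair_eq (x y : int) (g : R[i]) : x \in Z -> y \in Z ->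
  \sum_(b <- Z) \sum_(c <- Z) (if b == x then if c == y then g else 0 else 0) = g.
Proof.
move=> xZ yZ; transitivity (\sum_(b <- Z | b == x) \sum_(c <- Z | c == y) g).
  rewrite [RHS]big_mkcond; apply: eq_bigr => b _; case: ifP => _; last by rewrite big1.
  by rewrite -big_mkcond.
by rewrite sum_eq1 ?uniq_Zs// xZ sum_eq1 ?uniq_Zs// yZ.
Qed.

(** Since [b + c != 0], resonance means [b = - a], [c = n] or [c = - a], [b = n]. The two cases
    coincide for [a = - n], which the second summand therefore excludes. Reality of the solution
    turns [V a * V (- a)] into [|V a| ^ 2]. *)
Lemma resonant_row a : a \in Z ->
  \sum_(b <- Z) \sum_(c <- Z) (if a + b + c == n then
     if (b + c \in Z) && ~~ nonres a b c then iC / (6 * a%:~R) * (V a * V b * V c) else 0 else 0)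
  = (if n - a \in Z then iC / 6 * (V n * ((cabs (V a) ^+ 2)%:C / a%:~R)) else 0)
  + (if (n - a \in Z) && (a != - n) then iC / 6 * (V n * ((cabs (V a) ^+ 2)%:C / a%:~R)) else 0).
Proof.
move=> aZ; have a0 := Zs_neq0 aZ; have aC := intC_neq0 R a0.
have NaZ : - a \in Z by move: aZ; rewrite !mem_Zs oppr_eq0 abszN.
case: ifPn => [naZ|naZ] /=; last first.
  rewrite addr0 big1// => b _; rewrite big1// => c _; case: eqP => // E.
  by rewrite (_ : b + c = n - a) ?(negbTE naZ)// -E; ring.
have na0 := Zs_neq0 naZ.
set g := iC / 6 * _.
have gE : iC / (6 * a%:~R) * (V a * V (- a) * V n) = g.
  by rewrite /g HJ mulCJ; field.
rewrite -[X in _ = X + _](sum_pair_eq g NaZ nZ).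
have -> : (if a != - n then g else 0) = \sum_(b <- Z) \sum_(c <- Z)
   (if b == n then if c == - a then (if a != - n then g else 0) else 0 else 0).
  by rewrite sum_pair_eq.
rewrite -big_split; apply: eq_bigr => b _; rewrite -big_split; apply: eq_bigr => c _ /=.
have [E|E] := eqVneq (a + b + c) n; last first.
  have [hb|hb] := eqVneq b (- a); have [hc|hc] := eqVneq c n; rewrite ?add0r ?addr0//.
  - by case/eqP: E; rewrite hb hc; ring.
  - have [hn|hn] := eqVneq b n; rewrite // ; case: eqP => // hc'; case/eqP: E; rewrite hn hc'; ring.
  - have [hn|hn] := eqVneq b n; rewrite // ; case: eqP => // hc'; case/eqP: E; rewrite hn hc'; ring.
  - have [hn|hn] := eqVneq b n; rewrite // ; case: eqP => // hc'; case/eqP: E; rewrite hn hc'; ring.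
have bcE : b + c = n - a by rewrite -E; ring.
rewrite bcE naZ /= /nonres bcE.
have [hb|hb] := eqVneq b (- a).
  have hc : c = n by rewrite -E hb; ring.
  rewrite hb hc eqxx addrN !mul0r eqxx /= gE.
  case: eqP => [h1|_]; last by rewrite addr0.
  have -> : (a != - n) = false by rewrite -h1 opprK eqxx.
  by rewrite if_same addr0.
have [hc|hc] := eqVneq c (- a).
  have hn : b = n by rewrite -E hc; ring.
  rewrite hn hc eqxx addNr mulr0 eqxx /= add0r.
  have -> : a != - n by apply/eqP => h; case/eqP: hb; rewrite hn h opprK.
  by rewrite -gE; congr (_ * _); ring.
rewrite add0r if_same; case: ifPn => //; rewrite negbK !mulf_eq0 (negbTE na0) orbF => /orP[]/eqP h.
  by case/negP: hb; rewrite -addr_eq0 addrC; apply/eqP.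
by case/negP: hc; rewrite -addr_eq0; apply/eqP.
Qed.

End ResonantRow.

(** * Bounds for the normal form with a weight [w], to be used with [w = 1] and with [w = wt] *)

Section NormalFormBounds.
Variables (R : realType) (L : nat) (n : int) (w : int -> R) (M eps : R).
Implicit Types (a b c p q k j : int).
Local Notation Z := (Zs L).
Local Notation iC := (iC R).
Hypothesis nZ : n \in Z.
Hypothesis w1 : forall k, k != 0 -> 1 <= w k.
Hypothesis wge0 : forall k, 0 <= w k.
Hypothesis wD : forall j k, j != 0 -> k != 0 -> w (j + k) <= 2 * (w j * w k).
Hypothesis eps0 : 0 <= eps.

Section FixedTime.
Variables (v : int -> R -> R[i]) (DV rh : int -> R[i]) (s : R).
Let V k := v k s.
Hypothesis HDV : forall k, k \in Z ->
  DV k = - (iC * k%:~R / 2) * quad L V s k + k%:~R * rh k.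
Hypothesis HJ : forall k, V (- k) = cj (V k).
Hypothesis Hrh : forall k, k \in Z -> cabs (rh k) <= eps.
Hypothesis HM : \sum_(k <- Z) (w k * cabs (V k)) ^+ 2 <= M.

Let u k := cabs (V k).
Let x k := w k * u k.
Let K := (M + 4) / 2.
Let N : R := `|n%:~R|.

Let u0 k : 0 <= u k. Proof. exact: cabs_ge0. Qed.
Let x0 k : 0 <= x k. Proof. by rewrite mulr_ge0 ?wge0. Qed.
Let Nge0 : 0 <= N. Proof. exact: normr_ge0. Qed.
Let n0 : n != 0. Proof. exact: Zs_neq0 nZ. Qed.
Let N1 : 1 <= N. Proof. exact: norm_int_ge1. Qed.
Let wn1 : 1 <= w n. Proof. exact: w1. Qed.
Let xM : \sum_(k <- Z) x k ^+ 2 <= M := HM.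
Let M0 : 0 <= M := mass_ge0 xM.
Let K0 : 0 <= K. Proof. by rewrite divr_ge0// addr_ge0. Qed.
Let ux k : k \in Z -> u k <= x k.
Proof. by move=> /Zs_neq0 k0; rewrite /x ler_peMl// w1. Qed.

Let uM : \sum_(k <- Z) u k ^+ 2 <= M.
Proof.
apply: le_trans xM; apply: ler_sum_mono => k kZ _.
by rewrite lerXn2r ?nnegrE//; exact: ux.
Qed.

Let conv k := S2 L k (fun p q => u p * u q).
Let conv0 k : 0 <= conv k.
Proof. by apply: sumr_ge0 => p _; apply: sumr_ge0 => q _; case: ifP => // _; rewrite mulr_ge0. Qed.

Let wconv k : w k * conv k <= 2 * M.
Proof.
apply: (@le_trans _ _ (2 * S2 L k (fun p q => x p * x q))); last first.
  by rewrite ler_wpM2l//; exact: conv_mass.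
rewrite /conv -!S2_Z; apply: S2_le => p q /Zs_neq0 p0 /Zs_neq0 q0 <-.
apply: (le_trans (ler_wpM2r _ (wD p0 q0))); first by rewrite mulr_ge0.
by rewrite le_eqVlt /x; apply/orP; left; apply/eqP; ring.
Qed.

Let DVle a : a \in Z -> cabs (DV a) <= `|a%:~R| * (conv a / 2 + eps).
Proof.
move=> aZ; rewrite HDV//; apply: (le_trans (cabsD _ _)); rewrite mulrDr; apply: lerD.
  rewrite cabsM cabsN !cabsM cabs_iC mul1r cabsV cabs_int cabs_nat -mulrA ler_wpM2l// mulrC ler_wpM2r ?invr_ge0//.
  apply: (le_trans (cabs_S2 _ _ _)); apply: S2_le => p q _ _ _.
  by rewrite cabsM cabs_te mul1r cabsM.
by rewrite cabsM cabs_int ler_wpM2l// Hrh.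
Qed.

(** The denominator [p * q] pays for [|n|], as [|p + q| <= 2 * |p| * |q|] for nonzero integers, and
    [wD] distributes the weight over the two factors. *)
Lemma bdyB_le : N * w n * cabs (bdyB L n v s) <= M.
Proof.
apply: le_trans (conv_mass xM n).
apply: (le_trans (ler_wpM2l _ (cabs_S2 _ _ _))); first by rewrite mulr_ge0 ?normr_ge0 ?wge0.
rewrite -S2_Z; apply: S2_le => p q pZ qZ E.
have p0 := Zs_neq0 pZ; have q0 := Zs_neq0 qZ.
rewrite cabsM cabsV !cabsM cabs_te mul1r !cabs_int cabs_nat -/(V p) -/(V q) -/(u p) -/(u q).
have hN : N <= 2 * (`|p%:~R| * `|q%:~R|).
  by rewrite /N !normr_int -!natrM ler_nat -E; exact: absz_add_le.
have hw : w n <= 2 * (w p * w q) by rewrite -E; exact: wD.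
have pp : 0 < `|p%:~R| :> R by rewrite normr_gt0 intr_eq0.
have qq : 0 < `|q%:~R| :> R by rewrite normr_gt0 intr_eq0.
have i0 : 0 <= (6 * `|p%:~R| * `|q%:~R|)^-1 * (u p * u q).
  by rewrite mulr_ge0 ?invr_ge0 ?mulr_ge0.
apply: (le_trans (ler_wpM2r i0 (ler_pM (normr_ge0 _) (wge0 n) hN hw))).
have -> : 2 * (`|p%:~R| * `|q%:~R|) * (2 * (w p * w q)) * ((6 * `|p%:~R| * `|q%:~R|)^-1 * (u p * u q))
   = 2 / 3 * (x p * x q) by rewrite /x; field; rewrite !gt_eqF.
by rewrite ler_piMl ?mulr_ge0//; lra.
Qed.

Let w3 a b c : a \in Z -> b \in Z -> c \in Z -> a + b + c = n -> b + c != 0 ->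
  w n <= 4 * (w a * w b * w c).
Proof.
move=> /Zs_neq0 a0 /Zs_neq0 b0 /Zs_neq0 c0 E bc.
have h1 : w n <= 2 * (w a * w (b + c)) by rewrite -E -addrA; exact: wD.
apply: (le_trans h1).
have -> : 4 * (w a * w b * w c) = 2 * (w a * (2 * (w b * w c))) by ring.
by rewrite ler_wpM2l// ler_wpM2l// wD.
Qed.

Let den a b c : a \in Z -> nonres a b c ->
  cabs (6 * a%:~R * (phi a b c)%:~R : R[i])^-1 = cubic_weight R a b c / 18.
Proof.
move=> aZ h; rewrite cabsV !cabsM !cabs_int cabs_nat /phi !intrM !normrM /cubic_weight /iv.
have a0 : `|a%:~R| != 0 :> R by rewrite normr_eq0 intr_eq0 (Zs_neq0 aZ).
move: h; rewrite /nonres !mulf_eq0 !negb_or => /andP[/andP[A0 B0] C0].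
have h3 : `|3%:~R| = 3 :> R by rewrite normr_int.
rewrite h3; field.
by rewrite a0 !normr_eq0 !intr_eq0 A0 B0 C0.
Qed.

Lemma bdyC_le : N * w n * cabs (bdyC L n v s) <= 10 * K ^+ 3.
Proof.
apply: le_trans (@cubic_boundary R L x M x0 xM n).
apply: (le_trans (ler_wpM2l _ (cabs_S3 _ _ _))); first by rewrite mulr_ge0 ?normr_ge0 ?wge0.
rewrite -S3_Z; apply: S3_le => a b c aZ bZ cZ E.
have cw := cubw_ge0 R a b c.
rewrite /nr; have [h|h] := boolP (nonres a b c); last by rewrite andbF cabs0 mulr0.
have bc : b + c != 0 by move: h; rewrite /nonres !mulf_eq0 !negb_or => /andP[/andP[_ ->]].
rewrite andbT; case: ifP => _; last first.
  by rewrite cabs0 mulr0 mulr_ge0// mulr_ge0// !mulr_ge0.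
rewrite cabsM cabsN den// !cabsM cabs_te mul1r -/(V a) -/(V b) -/(V c) -/(u a) -/(u b) -/(u c).
have -> : N * w n * (cubic_weight R a b c / 18 * (u a * u b * u c)) = w n * (N * cubic_weight R a b c / 18 * (u a * u b * u c)) by ring.
have i0 : 0 <= N * cubic_weight R a b c / 18 * (u a * u b * u c).
  by rewrite !mulr_ge0 ?invr_ge0 ?normr_ge0.
apply: (le_trans (ler_wpM2r i0 (w3 aZ bZ cZ E bc))).
have -> : 4 * (w a * w b * w c) * (N * cubic_weight R a b c / 18 * (u a * u b * u c)) =
   2 / 9 * (N * (x a * x b * x c) * cubic_weight R a b c) by rewrite /x; field.
rewrite ler_piMl//; last by lra.
by apply: mulr_ge0 => //; rewrite !mulr_ge0.
Qed.

Lemma rhoB_le : cabs (rhoB L n V rh s) <= K * eps.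
Proof.
apply: (le_trans (cabs_S2 _ _ _)).
apply: (@le_trans _ _ (\sum_(p <- Z) u p * iv R (p - 0) * eps)); last first.
  by rewrite -mulr_suml ler_wpM2r//; exact: sum_inv_dist_le.
apply: ler_sum_mono => p pZ _; rewrite -big_mkcond subr0.
have i0 : 0 <= u p * iv R p * eps by rewrite !mulr_ge0 ?iv_ge0.
apply: (@ler_sum1 _ _ _ _ (n - p)); rewrite ?uniq_Zs//.
  by move=> i _ /eqP <-; rewrite addrC addKr.
move=> qZ _; rewrite cabsM cabsV !cabsM cabs_te mul1r cabs_int cabs_nat -/(u p).
have pp : 0 < `|p%:~R| :> R by rewrite normr_gt0 intr_eq0 (Zs_neq0 pZ).
apply: (@le_trans _ _ ((3 * `|p%:~R|)^-1 * (u p * eps))).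
  by rewrite ler_wpM2l ?invr_ge0 ?mulr_ge0// ler_wpM2l// Hrh.
have -> : (3 * `|p%:~R|)^-1 * (u p * eps) = 3^-1 * (u p * iv R p * eps).
  by rewrite /iv; field; rewrite gt_eqF.
by rewrite ler_piMl//; lra.
Qed.

(** The time derivative has two parts. The convolution part takes its share of the weight and gains
    [1 / (N * w n)]; the truncation error needs no gain, since [eps] will tend to 0. [50 = 25 * 2],
    the 2 coming from [wconv]. *)
Lemma nrC_le : cabs (nrC L n V DV s) <= 50 * K ^+ 2 * M / (N * w n) + 25 * K ^+ 2 * eps.
Proof.
have Nw : 0 < N * w n by rewrite mulr_gt0 ?(lt_le_trans ltr01).
have N0 : 0 < N by rewrite (lt_le_trans ltr01).
pose T (X y : int -> R) a b c := if nonres a b c then N * (`|a%:~R| * y a * X b * X c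
    + `|b%:~R| * X a * y b * X c + `|c%:~R| * X a * X b * y c) * cubic_weight R a b c else 0.
have wc k : 0 <= w k * conv k by rewrite mulr_ge0.
have T1 : S3 L n (T x (fun k => w k * conv k)) <= 25 * K ^+ 2 * (2 * M).
  by apply: (@cubic_bound R L x M x0 xM n) => [|k _]; [rewrite mulr_ge0|rewrite wc wconv].
have T2 : S3 L n (T u (fun=> eps)) <= 25 * K ^+ 2 * eps.
  by apply: (@cubic_bound R L u M u0 uM n) => [//|k _]; rewrite eps0 lexx.
have T0 X y a b c : (forall k, 0 <= X k) -> (forall k, 0 <= y k) -> 0 <= T X y a b c.
  move=> X0 y0; rewrite /T; case: ifP => // _; apply: mulr_ge0; last exact: cubw_ge0.
  by rewrite mulr_ge0 ?(ltW N0)// !addr_ge0// !mulr_ge0.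
have iNw : 0 <= (N * w n)^-1 by rewrite invr_ge0 ltW.
have iN : 0 <= N^-1 by rewrite invr_ge0 ltW.
apply: (le_trans (cabs_S3 _ _ _)).
apply: (@le_trans _ _ (S3 L n (fun a b c => (N * w n)^-1 * T x (fun k => w k * conv k) a b c
   + N^-1 * T u (fun=> eps) a b c))); last first.
  rewrite S3_D !S3_Z; apply: lerD.
    have -> : 50 * K ^+ 2 * M / (N * w n) = (N * w n)^-1 * (25 * K ^+ 2 * (2 * M)) by ring.
    by rewrite ler_wpM2l.
  apply: le_trans T2; rewrite ler_piMl ?invf_le1//.
  by do 3 (apply: sumr_ge0 => ? _); case: ifP => // _; exact: T0.
apply: S3_le => a b c aZ bZ cZ E; have cw := cubw_ge0 R a b c.
have Ta := T0 x (fun k => w k * conv k) a b c x0 wc.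
have Tb := T0 u (fun=> eps) a b c u0 (fun=> eps0).
rewrite /nr; have [h|h] := boolP (nonres a b c); last first.
  by rewrite andbF cabs0 addr_ge0// mulr_ge0.
have bc : b + c != 0 by move: h; rewrite /nonres !mulf_eq0 !negb_or => /andP[/andP[_ ->]].
rewrite andbT; case: ifP => _; last by rewrite cabs0 addr_ge0// mulr_ge0.
rewrite cabsM den// cabsM cabs_te mul1r; move: Ta Tb => _ _; rewrite /T h.
  set y := cubic_weight R a b c in cw *.
have D : cabs ((DV a * V b + V a * DV b) * V c + V a * V b * DV c) <=
   `|a%:~R| * (conv a / 2 + eps) * u b * u c + `|b%:~R| * (conv b / 2 + eps) * u a * u c
   + `|c%:~R| * (conv c / 2 + eps) * u a * u b.
  apply: (le_trans (cabsD _ _)); rewrite mulrDl; apply: lerD.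
    apply: (le_trans (cabsD _ _)); rewrite !cabsM -!/(u _); apply: lerD.
      by rewrite ler_wpM2r// ler_wpM2r// DVle.
    by rewrite (mulrC (u a)) ler_wpM2r// ler_wpM2r// DVle.
  by rewrite !cabsM -!/(u _) mulrC -[leRHS]mulrA ler_wpM2r ?mulr_ge0// DVle.
apply: (le_trans (ler_wpM2l _ D)); first by rewrite mulr_ge0 ?invr_ge0.
pose S1 := `|a%:~R| * conv a * u b * u c + `|b%:~R| * u a * conv b * u c + `|c%:~R| * u a * u b * conv c.
pose S2' := `|a%:~R| * eps * u b * u c + `|b%:~R| * u a * eps * u c + `|c%:~R| * u a * u b * eps.
have S10 : 0 <= S1 by rewrite !addr_ge0 ?mulr_ge0.
have S20 : 0 <= S2' by rewrite !addr_ge0 ?mulr_ge0.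
have -> : y / 18 * (`|a%:~R| * (conv a / 2 + eps) * u b * u c + `|b%:~R| * (conv b / 2 + eps) * u a * u c
   + `|c%:~R| * (conv c / 2 + eps) * u a * u b) = y * S1 / 36 + y * S2' / 18.
  by rewrite /S1 /S2'; field.
apply: lerD; last first.
  have -> : N^-1 * (N * S2' * y) = y * S2' by field; rewrite gt_eqF.
  rewrite ler_piMr//; [exact: mulr_ge0|lra].
have -> : (N * w n)^-1 * (N * (`|a%:~R| * (w a * conv a) * x b * x c + `|b%:~R| * x a * (w b * conv b) * x c
   + `|c%:~R| * x a * x b * (w c * conv c)) * y) = (w n)^-1 * ((w a * w b * w c) * (y * S1)).
  by rewrite /S1 /x; field; rewrite !gt_eqF// (lt_le_trans ltr01).
have wn0 : 0 < w n by rewrite (lt_le_trans ltr01).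
rewrite ler_pdivlMl//.
have yS : 0 <= y * S1 by exact: mulr_ge0.
have i0 : 0 <= y * S1 / 36 by exact: divr_ge0.
apply: (le_trans (ler_wpM2r i0 (w3 aZ bZ cZ E bc))).
have -> : 4 * (w a * w b * w c) * (y * S1 / 36) = 9^-1 * (w a * w b * w c * (y * S1)) by field.
rewrite ler_piMl//; last by lra.
by apply: mulr_ge0 => //; rewrite !mulr_ge0.
Qed.

(* The resonant terms are [V n * `|V a| ^ 2 / a], odd in [a]: they cancel in pairs except
   where the truncation breaks the symmetry [a -> - a]. *)
Lemma resC_le : (`|n| < L)%N ->
  cabs (resC L n V) <= K * M / (N * w n) + K * M / (L%:R - N).
Proof.
move=> nL; have N0 : 0 < N by rewrite (lt_le_trans ltr01).
have LN : 0 < L%:R - N by rewrite subr_gt0 /N normr_int ltr_nat.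
pose f a : R[i] := (u a ^+ 2)%:C / a%:~R.
pose S (P : pred int) := \sum_(a <- Z | P a) f a.
pose P1 a := n - a \in Z; pose P2 a := P1 a && (a != - n).
have E : resC L n V = iC / 6 * (V n * S P1) + iC / 6 * (V n * S P2).
  have -> : resC L n V = \sum_(a <- Z | P1 a) (iC / 6 * (V n * f a)) + \sum_(a <- Z | P2 a) (iC / 6 * (V n * f a)).
    rewrite [X in X + _]big_mkcond [X in _ + X]big_mkcond -big_split; apply: eq_big_seq => a aZ /=.
    exact: (resonant_row nZ HJ).
  by rewrite -!mulr_sumr.
have fle a : cabs (f a) = u a ^+ 2 * iv R a.
  by rewrite cabsM cabsV cabs_int cabsR ger0_norm ?sqr_ge0.
have fN a : f (- a) = - f a.
  by rewrite /f /u HJ cabsJ mulrNz invrN mulrN.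
have Sall : \sum_(a <- Z) f a = 0.
  have h := sum_ZsN L f; move: h; under eq_bigr do rewrite fN.
  rewrite sumrN => /eqP; rewrite eq_sym -subr_eq0 opprK -mulr2n mulrn_eq0 /= => /eqP //.
have uK a : a \in Z -> u a ^+ 2 <= M.
  move=> aZ; apply: le_trans uM; rewrite (big_rem a)//= lerDl.
  by apply: sumr_ge0 => j _; exact: sqr_ge0.
have S1 : cabs (S P1) <= u n ^+ 2 / N + M / (L%:R - N).
  (* The full sum vanishes, so [S P1] is minus the sum over the [a] it omits: [a = n], for which
     [n - a = 0], and those with [|a| >= L - |n|], for which [1 / |a|] is small. *)
  have -> : S P1 = - \sum_(a <- Z | ~~ P1 a) f a.
    have h := Sall; rewrite (bigID P1) /= in h.
    by apply/eqP; rewrite -addr_eq0; apply/eqP; exact: h.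
  rewrite cabsN; apply: (le_trans (cabs_sum _ _ _)).
  rewrite (bigID (fun a => a == n)) /=; apply: lerD.
    apply: (@ler_sum1 _ _ _ _ n); rewrite ?uniq_Zs ?divr_ge0 ?sqr_ge0 ?(ltW N0)//.
      by move=> i _ /andP[_ /eqP].
    by move=> _ _; rewrite fle /iv.
  apply: (@le_trans _ _ (\sum_(a <- Z) u a ^+ 2 / (L%:R - N))); last first.
    by rewrite -mulr_suml ler_wpM2r ?invr_ge0 ?(ltW LN).
  apply: (@le_trans _ _ (\sum_(a <- Z | ~~ P1 a && (a != n)) u a ^+ 2 / (L%:R - N))).
    apply: ler_sum_mono => a aZ /andP[h1 h2]; rewrite fle ler_wpM2l ?sqr_ge0//.
    rewrite /iv lef_pV2 ?posrE ?normr_gt0 ?intr_eq0 ?(Zs_neq0 aZ)//.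
    rewrite lerBlDr /N !normr_int -natrD ler_nat.
    exact: notin_Zs.
  rewrite big_mkcond; apply: ler_sum => a _; case: ifP => // _.
  by rewrite divr_ge0 ?sqr_ge0// ltW.
have S2b : cabs (S P2) <= 2 * (u n ^+ 2 / N) + M / (L%:R - N).
  have -> : S P2 = S P1 - \sum_(a <- Z | P1 a && (a == - n)) f a.
    have -> : S P1 = \sum_(a <- Z | P1 a && (a == - n)) f a + S P2.
      by rewrite {1}/S (bigID (fun a => a == - n)).
    by rewrite addrC addKr.
  apply: (le_trans (cabsB _ _)).
  have : cabs (\sum_(a <- Z | P1 a && (a == - n)) f a) <= u n ^+ 2 / N.
    apply: (le_trans (cabs_sum _ _ _)).
    apply: (@ler_sum1 _ _ _ _ (- n)); rewrite ?uniq_Zs ?divr_ge0 ?sqr_ge0 ?(ltW N0)//.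
      by move=> i _ /andP[_ /eqP].
    by move=> _ _; rewrite fle ivN /u HJ cabsJ.
  by move: S1; lra.
rewrite E -mulrDr -mulrDr !cabsM cabs_iC cabsV cabs_nat mul1r -/(u n).
have h : cabs (S P1 + S P2) <= 3 * (u n ^+ 2 / N) + 2 * (M / (L%:R - N)).
  by apply: (le_trans (cabsD _ _)); move: S1 S2b; lra.
apply: (@le_trans _ _ (6^-1 * (u n * (3 * (u n ^+ 2 / N) + 2 * (M / (L%:R - N)))))).
  by rewrite ler_wpM2l// ler_wpM2l.
have unK : u n <= K by exact: (@x_leK R L u M uM).
have wn0 : 0 < w n by rewrite (lt_le_trans ltr01).
have a1 : u n * (u n ^+ 2 / N) <= K * M / (N * w n).
  have -> : u n * (u n ^+ 2 / N) = x n * u n ^+ 2 / (N * w n).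
    by rewrite /x; field; rewrite !gt_eqF.
  rewrite ler_wpM2r ?invr_ge0 ?mulr_ge0 ?(ltW N0)//.
  by apply: ler_pM; rewrite ?sqr_ge0 ?uK//; exact: (@x_leK R L x M xM).
have a2 : u n * (M / (L%:R - N)) <= K * M / (L%:R - N).
  by rewrite mulrA ler_wpM2r ?invr_ge0 ?(ltW LN)// ler_wpM2r.
have KM0 : 0 <= K * M by exact: mulr_ge0.
have Nw0 : 0 < N * w n by exact: mulr_gt0.
have a10 : 0 <= K * M / (N * w n) by rewrite divr_ge0 // ltW.
have a20 : 0 <= K * M / (L%:R - N) by rewrite divr_ge0 // ltW.
have fin (z1 z2 y1 y2 : R) : z1 <= y1 -> z2 <= y2 -> 0 <= y1 -> 0 <= y2 ->
    6^-1 * (3 * z1 + 2 * z2) <= y1 + y2 by move=> *; lra.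
by rewrite (mulrDr (u n)) (mulrCA (u n) 3) (mulrCA (u n) 2); exact: fin.
Qed.

End FixedTime.
(** The mean value bound is applied to [v] minus both boundary terms, which are then added back at
    the times 0 and [t]. The factor [N] next to [eps] is harmless, as [n] is fixed before [L]. *)
Lemma normal_form_step (v dv rh : int -> R -> R[i]) (T t : R) (K := (M + 4) / 2)
    (N : R := `|n%:~R|) :
  (forall k s, `|s| <= T -> cder (v k) s (dv k s)) ->
  (forall k s, k \in Z -> `|s| <= T ->
     dv k s = - (iC * k%:~R / 2) * quad L (fun j => v j s) s k + k%:~R * rh k s) ->
  (forall k s, v (- k) s = cj (v k s)) ->
  (forall k s, k \in Z -> `|s| <= T -> cabs (rh k s) <= eps) ->
  (forall s, `|s| <= T -> \sum_(k <- Z) (w k * cabs (v k s)) ^+ 2 <= M) ->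
  `|t| <= T -> (`|n| < L)%N ->
  cabs (v n t - v n 0) <=
    (2 * (M + 10 * K ^+ 3) + 2 * `|t| * (50 * K ^+ 2 * M + K * M)) / (N * w n)
    + 2 * `|t| * (eps * (N + K + 25 * K ^+ 2) + K * M / (L%:R - N)).
Proof.
move=> Hder HDV HJ Hrh HM tT nL.
have n0 : n != 0 := Zs_neq0 nZ.
have N0 : 0 < N by rewrite normr_gt0 intr_eq0.
have wn0 : 0 < w n by rewrite (lt_le_trans ltr01)// w1.
have Nw : 0 < N * w n by rewrite mulr_gt0.
have T0 : `|0 : R| <= T by rewrite normr0 (le_trans _ tT).
pose F s := v n s - bdyB L n v s - bdyC L n v s.
pose dF s := dv n s - dB L n (fun k => v k s) (fun k => dv k s) s
   - dC L n (fun k => v k s) (fun k => dv k s) s.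
pose be := (50 * K ^+ 2 * M + K * M) / (N * w n) +
   (eps * (N + K + 25 * K ^+ 2) + K * M / (L%:R - N)).
have HF : cabs (F t - F 0) <= 2 * be * `|t|.
  apply: (@cder_bound R F dF T) => // s sT.
    by apply: cder_B; [apply: cder_B => //|]; [exact: Hder|apply: cder_bdyB|apply: cder_bdyC] => k; exact: Hder.
  have HDVs k : k \in Z -> dv k s = - (iC * k%:~R / 2) * quad L (fun j => v j s) s k + k%:~R * rh k s.
    by move=> kZ; exact: HDV.
  have Hrhs k : k \in Z -> cabs (rh k s) <= eps by move=> kZ; exact: Hrh.
  have HMs := HM s sT.
  rewrite /dF (normal_form_identity nZ HDVs).
  have e1 : cabs (n%:~R * rh n s) <= N * eps.
    by rewrite cabsM cabs_int ler_wpM2l// Hrhs.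
  have e2 := rhoB_le Hrhs HMs.
  have e3 := resC_le (fun k => HJ k s) HMs nL.
  have e4 := nrC_le HDVs Hrhs HMs.
  apply: (le_trans (cabsD _ _)); apply: (le_trans (lerD (cabsD _ _) (lexx _))).
  apply: (le_trans (lerD (lerD (cabsB _ _) (lexx _)) (lexx _))).
  move: e1 e2 e3 e4; rewrite -/K -/N.
  move=> e1 e2 e3 e4; apply: (le_trans (lerD (lerD (lerD e1 e2) e3) e4)).
  by rewrite le_eqVlt /be; apply/orP; left; apply/eqP; ring.
have b1 s : `|s| <= T -> cabs (bdyB L n v s) <= M / (N * w n).
  by move=> sT; rewrite ler_pdivlMr// mulrC; exact: (bdyB_le (HM s sT)).
have b2 s : `|s| <= T -> cabs (bdyC L n v s) <= 10 * K ^+ 3 / (N * w n).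
  by move=> sT; rewrite ler_pdivlMr// mulrC; exact: (bdyC_le (HM s sT)).
have -> : v n t - v n 0 = (F t - F 0) + ((bdyB L n v t + bdyC L n v t)
   - (bdyB L n v 0 + bdyC L n v 0)) by rewrite /F; ring.
apply: (le_trans (cabsD _ _)).
have h : cabs ((bdyB L n v t + bdyC L n v t) - (bdyB L n v 0 + bdyC L n v 0)) <=
   2 * (M / (N * w n) + 10 * K ^+ 3 / (N * w n)).
  apply: (le_trans (cabsB _ _)); rewrite mulr_natl mulr2n.
  by apply: lerD; apply: (le_trans (cabsD _ _)); apply: lerD; auto.
apply: (le_trans (lerD HF h)).
by rewrite le_eqVlt /be; apply/orP; left; apply/eqP; ring.
Qed.

End NormalFormBounds.

(** * Smoothing of the nonlinear part *)

Section NormalFormLimit.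
Variable R : realType.
Implicit Types (n k : int) (v dv : int -> R -> R[i]).

(** The main part of [normal_form_step] does not depend on [L]. For fixed [n] and [t] the rest is
    made smaller than any [e], first by the choice of [eta] and then by that of [L]. *)
Lemma normal_form (w : int -> R) (M T : R) v dv : 0 <= M ->
  (forall k, k != 0 -> 1 <= w k) -> (forall k, 0 <= w k) ->
  (forall j k, j != 0 -> k != 0 -> w (j + k) <= 2 * (w j * w k)) ->
  (forall k s, `|s| <= T -> cder (v k) s (dv k s)) ->
  (forall k s, v (- k) s = cj (v k s)) ->
  (forall L s, `|s| <= T -> \sum_(k <- Zs L) (w k * cabs (v k s)) ^+ 2 <= M) ->
  (forall eta, 0 < eta -> exists L0, forall L, (L0 <= L)%N -> exists rh : int -> R -> R[i],
     forall k s, k \in Zs L -> `|s| <= T -> cabs (rh k s) <= eta /\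
       dv k s = - (iC R * k%:~R / 2) * quad L (fun j => v j s) s k + k%:~R * rh k s) ->
  exists2 C, 0 <= C & forall n t, n != 0 -> `|t| <= T ->
    cabs (v n t - v n 0) <= C / (`|n%:~R| * w n).
Proof.
move=> M0 w1 wge0 wD Hder HJ HM H.
have [K KE K0] : exists2 K, K = (M + 4) / 2 & 0 <= K.
  by exists ((M + 4) / 2); rewrite // divr_ge0// addr_ge0.
pose C t := 2 * (M + 10 * K ^+ 3) + 2 * t * (50 * K ^+ 2 * M + K * M).
have P0 : 0 <= 50 * K ^+ 2 * M + K * M by rewrite addr_ge0 ?mulr_ge0 ?sqr_ge0.
exists (C `|T|).
  by rewrite /C addr_ge0// !mulr_ge0// addr_ge0// mulr_ge0// exprn_ge0.
move=> n t n0 tT; have N1 : 1 <= `|n%:~R| :> R := norm_int_ge1 R n0.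
set N : R := `|n%:~R| in N1 *.
have N0 : 0 < N by rewrite (lt_le_trans ltr01).
have wn0 : 0 < w n by rewrite (lt_le_trans ltr01)// w1.
have Nw : 0 < N * w n by rewrite mulr_gt0.
apply/ler_addgt0Pr => e e0.
pose A := 2 * `|t| * (N + K + 25 * K ^+ 2); pose B := 2 * `|t| * (K * M).
have A0 : 0 <= A by rewrite !mulr_ge0// !addr_ge0 ?mulr_ge0 ?sqr_ge0// ltW.
have B0 : 0 <= B by rewrite !mulr_ge0.
have A1 : 0 < A + 1 by rewrite ltr_wpDl.
pose eta := e / 2 / (A + 1).
have eta0 : 0 < eta by rewrite !divr_gt0.
have [L0 HL] := H eta eta0.
pose X := 2 * B / e; have X0 : 0 <= X by rewrite divr_ge0 ?mulr_ge0// ltW.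
(* Beyond [L0], above [|n|], and with [L - |n| > 2 * B / e], which handles the resonant defect. *)
pose L := (L0 + `|n| + (Num.bound X).+1)%N.
have [rh Hrh] := HL L (leq_trans (leq_addr _ _) (leq_addr _ _)).
have nL : (`|n| < L)%N.
  by rewrite /L addnS ltnS; exact: leq_trans (leq_addl _ _) (leq_addr _ _).
have nZ : n \in Zs L by rewrite mem_Zs n0 ltnW.
have LN : X < L%:R - N.
  have h := archi_boundP X0; apply: (lt_le_trans h).
  rewrite lerBrDr /N normr_int -natrD ler_nat addnC /L addnS -addnA.
  exact: leqW (leq_addl _ _).
have LN0 : 0 < L%:R - N by rewrite (le_lt_trans X0).
have step := @normal_form_step R L n w M eta nZ w1 wge0 wD (ltW eta0) v dv rh T t Hder
  (fun k s kZ sT => (Hrh k s kZ sT).2) HJ (fun k s kZ sT => (Hrh k s kZ sT).1)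
  (fun s => HM L s) tT nL.
apply: (le_trans step); rewrite -KE -/N; apply: lerD.
  rewrite ler_wpM2r ?invr_ge0 ?(ltW Nw)//.
  rewrite lerD2l ler_wpM2r// ler_wpM2l//.
  exact: le_trans tT (ler_norm T).
have e1 : A * eta <= e / 2.
  rewrite /eta mulrCA ler_piMr ?divr_ge0 ?(ltW e0)//.
  by rewrite ler_pdivrMr// mul1r lerDl.
have e2 : B / (L%:R - N) <= e / 2.
  rewrite ler_pdivrMr// -ler_pdivrMl ?divr_gt0//.
  apply: le_trans (ltW LN); rewrite /X le_eqVlt; apply/orP; left; apply/eqP; field.
  by rewrite gt_eqF.
have -> : 2 * `|t| * (eta * (N + K + 25 * K ^+ 2) + K * M / (L%:R - N)) = A * eta + B / (L%:R - N).
  by rewrite /A /B; ring.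
by apply: (le_trans (lerD e1 e2)); rewrite -mulrDl ler_pdivrMr//; lra.
Qed.

Lemma wt_add (j k : int) : j != 0 -> k != 0 -> wt R (j + k) <= 2 * (wt R j * wt R k).
Proof.
move=> j0 k0.
apply: (@le_trans _ _ ((2 * (`|j%:~R| * `|k%:~R|)) `^ 4^-1)).
  apply: ge0_ler_powR; rewrite ?nnegrE ?invr_ge0 ?mulr_ge0 ?normr_ge0//.
  by rewrite !normr_int -!natrM ler_nat absz_add_le.
rewrite !powRM ?mulr_ge0// -!/(wt R _) ler_wpM2r ?mulr_ge0 ?wt_ge0//.
by rewrite -[leRHS](powRr1 (_ : 0 <= 2))// ler_powR ?ler1n//; lra.
Qed.

Lemma wt_pow4 (n : int) : wt R n ^+ 4 = `|n%:~R|.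
Proof. exact: pow4_root. Qed.

(* Makes the output of [normal_form] with weight [1] an input with weight [wt]. *)
Lemma weighted_mass (x : int -> R) (C : R) L : 0 <= C -> (forall n, 0 <= x n) ->
  (forall n, n != 0 -> x n <= C / `|n%:~R|) ->
  \sum_(n <- Zs L) (wt R n * x n) ^+ 2 <=
    2 * C ^+ 2 + 5 * C ^+ 2 * ((1 - (2 `^ 4^-1)^-1 ^+ 2) ^+ 2)^-1.
Proof.
move=> C0 x0 Hx; pose rho : R := 2 `^ 4^-1.
have rho1 : 1 < rho.
  have e1 : 1 = (1 : R) `^ 4^-1 by rewrite powR1.
  by rewrite /rho [ltLHS]e1 gt0_ltr_powR ?nnegrE ?invr_gt0// ltr1n.
have rho0 : 0 < rho by rewrite (lt_trans ltr01).
have rho4 : rho ^+ 4 = 2 by apply: pow4_root.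
(* With [rho ^ 4 = 2], block [k] has at most [5 * rho ^ (4 * k)] frequencies, each contributing at
   most [C ^ 2 * rho ^ (- 6 * k)]; the ratio is [rho ^ (- 2)]. *)
pose r := rho^-1 ^+ 2.
have r0 : 0 <= r by rewrite sqr_ge0.
have r1 : r < 1 by rewrite /r expr_lt1 ?invr_ge0 ?(ltW rho0)// invf_lt1.
have [K LK] := zs_sub_pow L.
have Hn n : n != 0 -> (wt R n * x n) ^+ 2 <= C ^+ 2 * (wt R n ^+ 6)^-1.
  move=> n0; have w1 := wt_ge1 R n0; have w0 := lt_le_trans ltr01 w1.
  have -> : C ^+ 2 * (wt R n ^+ 6)^-1 = (wt R n * (C / wt R n ^+ 4)) ^+ 2.
    by field; rewrite gt_eqF.
  rewrite wt_pow4 lerXn2r ?nnegrE ?mulr_ge0 ?(ltW w0) ?invr_ge0//.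
  by rewrite ler_wpM2l ?(ltW w0)// Hx.
apply: (@le_trans _ _ (\sum_(n <- zs (2 ^ K)) if n == 0 then 0 else (wt R n * x n) ^+ 2)).
  rewrite /Zs big_filter big_mkcond.
  under [leLHS]eq_bigr do rewrite if_neg.
  apply: ler_sum_sub => [||i|i _ _]; [exact: uniq_zs|exact: uniq_zs| |by case: ifP => // _; exact: sqr_ge0].
  by rewrite !mem_zs andbT => h _; exact: leq_trans h LK.
rewrite sum_zs_blk; apply: lerD.
  rewrite sum_zsS sum_zs0 /= addr0.
  have h1 (n : int) : `|n%:~R| = 1 :> R -> n != 0 -> (wt R n * x n) ^+ 2 <= C ^+ 2.
    move=> n1 n0; apply: (le_trans (Hn n n0)); rewrite ler_piMr ?sqr_ge0//.
    by rewrite invf_le1 ?exprn_gt0 ?exprn_ege1 ?wt_ge1 ?(lt_le_trans ltr01 (wt_ge1 R n0)).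
  by rewrite mulr_natl mulr2n; apply: lerD; apply: h1; rewrite ?normr_int.
apply: (@le_trans _ _ (\sum_(k < K) 5 * C ^+ 2 * (k.+1%:R * r ^+ k))).
  apply: ler_sum => k _.
  have rk0 : 0 < rho ^+ k by rewrite exprn_gt0.
  apply: (@le_trans _ _ (5 * 2 ^+ k * (C ^+ 2 * ((rho ^+ k) ^+ 6)^-1))).
    apply: sum_const_blk => [|n nk]; first by rewrite mulr_ge0 ?sqr_ge0// invr_ge0 exprn_ge0// ltW.
    have n0 : n != 0 by move: nk; rewrite mem_blk; lia.
    rewrite (negbTE n0); apply: (le_trans (Hn n n0)); rewrite ler_wpM2l ?sqr_ge0//.
    have w1 : rho ^+ k <= wt R n.
      rewrite -(@ler_pXn2r _ 4) ?nnegrE ?wt_ge0 ?(ltW rk0)//.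
      rewrite wt_pow4 -exprM mulnC exprM rho4 normr_int -natrX ler_nat.
      by move: nk; rewrite mem_blk => /andP[/ltnW].
    rewrite lef_pV2 ?posrE ?exprn_gt0 ?(lt_le_trans rk0 w1)//.
    by rewrite lerXn2r ?nnegrE ?wt_ge0 ?(ltW rk0).
  have -> : 5 * 2 ^+ k * (C ^+ 2 * ((rho ^+ k) ^+ 6)^-1) = 5 * C ^+ 2 * r ^+ k.
    have -> : r ^+ k = ((rho ^+ k) ^+ 2)^-1 by rewrite /r -!exprVn -!exprM mulnC.
    have -> : 2 ^+ k = (rho ^+ k) ^+ 4 by rewrite -rho4 -!exprM mulnC.
    by field; rewrite gt_eqF.
  apply: ler_wpM2l; first by rewrite mulr_ge0 ?sqr_ge0.
  by apply: ler_peMl; [exact: exprn_ge0|rewrite ler1n].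
rewrite -mulr_sumr; apply: ler_wpM2l; first by rewrite mulr_ge0 ?sqr_ge0.
exact: sum_geom_lin.
Qed.

End NormalFormLimit.

(** * The KdV equation *)

Section TestFunctions.
Variable R : realType.
Implicit Types (A B r x : R).

(** Test functions are real, so exponentials are tested through cosine and sine; this family is
    stable under differentiation. *)
Definition trigf A B r x := A * cos (r * x) + B * sin (r * x).

Lemma is_derive_trigf A B r x : is_derive x (1 : R) (trigf A B r) (trigf (r * B) (- (r * A)) r x).
Proof.
have dl : is_derive x (1 : R) (fun x => r * x) r.
  by have := is_deriveZ r (is_derive_id x (1 : R)); move=> h; apply: is_derive_eq1 h _; rewrite /GRing.scale /= mulr1.
have h1 := is_deriveZ A (is_derive1_comp (is_derive_cos (r * x)) dl).
have h2 := is_deriveZ B (is_derive1_comp (is_derive_sin (r * x)) dl).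
by have := is_deriveD h1 h2 => h; apply: is_derive_eq1 h _; rewrite /trigf /GRing.scale /=; ring.
Qed.

Lemma derive1_trigf A B r : derive1 (trigf A B r) = trigf (r * B) (- (r * A)) r.
Proof.
by apply/funext => x; rewrite derive1E; have [_ ->] := is_derive_trigf A B r x.
Qed.

Lemma torus_test_trigf A B (k : int) : torus_test (trigf A B k%:~R).
Proof.
split.
  move=> x; have := te_periodic k x; rewrite /te => h.
  have hc := congr1 (@complex.Re R) h; have hs := congr1 (@complex.Im R) h.
  by rewrite /trigf; move: hc hs; rewrite /= => -> ->.
move=> j x; have [A' [B' ->]] : exists A' B', derive1n j (trigf A B k%:~R) = trigf A' B' k%:~R.
  elim: j => [|j [A' [B' ih]]]; first by exists A, B.
  by rewrite derive1nS ih derive1_trigf; do 2 eexists.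
by have [h _] := is_derive_trigf A' B' k%:~R x.
Qed.

Lemma derive1n3_trigf A B r : derive1n 3 (trigf A B r) = trigf (- (r ^+ 3 * B)) (r ^+ 3 * A) r.
Proof.
rewrite !derive1nS derive1n0 !derive1_trigf; apply/funext => x; rewrite /trigf; ring.
Qed.

End TestFunctions.

(** * The Fourier coefficients of a KdV solution *)

Section KdV.
Variables (R : realType) (g : R -> R) (u : R -> R -> R).
Notation mu := (@lebesgue_measure R).
Notation D := (@torus_dom R).
Notation iC := (iC R).
Hypothesis u_L2 : forall t : R, L2_torus (u t).
Hypothesis u_cont : continuous_L2 u.
Hypothesis u_weak : weak_kdv u.

Let uc s x : R[i] := (u s x)%:C.
Let a n s : R[i] := fc (uc s) n.
Let q n s : R[i] := fc (fun x => uc s x * uc s x) n.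

Let lu s : l2 (uc s). Proof. exact: L2_torus_l2. Qed.

Let lte n : l2 (te (R:=R) n). Proof. exact: cC_l2 (cC_te R n). Qed.

Let iu s : iD (u s).
Proof. by have [h _] := l2_cI (lu s); apply: iD_ext h => x _. Qed.

Let mu_s s : mD (u s). Proof. exact: mD_iD. Qed.

Let iu2 s : iD (fun x => u s x ^+ 2).
Proof.
have [_ h] := lu s; apply: iD_ext h => x _.
by rewrite /uc cabsR real_normK ?num_real.
Qed.

Let bounded_mul (f h : R -> R) (B : R) : iD f -> continuous h -> (forall x, `|h x| <= B) ->
  iD (fun x => f x * h x).
Proof.
move=> fi ch hB; have B0 : 0 <= B := le_trans (normr_ge0 _) (hB 0).
apply: (@iD_le _ _ (fun x => B * `|f x|)); last by apply: iD_Z; exact: iD_abs.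
  by apply: measurable_funM; [exact: mD_iD|exact: mD_cont].
by move=> x _; rewrite normrM mulrC ler_wpM2r.
Qed.

Let ccos (r : R) : continuous (fun x => cos (r * x)).
Proof. by have [h _] := cC_expi r. Qed.
Let csin (r : R) : continuous (fun x => sin (r * x)).
Proof. by have [_ h] := cC_expi r. Qed.
Let bcos (r x : R) : `|cos (r * x)| <= 1. Proof. by apply: (le_trans (le_Re_cabs (expi (r * x)))); rewrite cabs_expi lexx. Qed.
Let bsin (r x : R) : `|sin (r * x)| <= 1. Proof. by apply: (le_trans (le_Im_cabs (expi (r * x)))); rewrite cabs_expi lexx. Qed.

Let Re_fc (f : R -> R) n : complex.Re (fc (fun x => (f x)%:C) n) =
  (2 * pi)^-1 * II (fun x => f x * cos ((- n)%:~R * x)).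
Proof.
rewrite /fc cReM Re_CI [complex.Im (_%:C)]/= mul0r subr0; congr (_ * _); apply: II_ext => x _.
by rewrite cReM /= mul0r subr0.
Qed.

Let Im_fc (f : R -> R) n : complex.Im (fc (fun x => (f x)%:C) n) =
  (2 * pi)^-1 * II (fun x => f x * sin ((- n)%:~R * x)).
Proof.
rewrite /fc cImM Im_CI [complex.Im (_%:C)]/= mul0r addr0; congr (_ * _); apply: II_ext => x _.
by rewrite cImM /= mul0r addr0.
Qed.

Let qE n s : q n s = fc (fun x => (u s x ^+ 2)%:C) n.
Proof. by congr (_ * _); apply: CI_ext => x _; rewrite expr2 CRM. Qed.

Lemma weak_trig A B (k : int) s : is_derive s (1 : R)
  (fun s => II (fun x => u s x * trigf A B k%:~R x))
  (II (fun x => u s x * trigf (- (k%:~R ^+ 3 * B)) (k%:~R ^+ 3 * A) k%:~R x) +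
   2^-1 * II (fun x => u s x ^+ 2 * trigf (k%:~R * B) (- (k%:~R * A)) k%:~R x)).
Proof.
have ct A' B' : continuous (trigf A' B' (k%:~R : R)).
  by apply: contD; apply: contM; (do ?exact: cst_continuous); [exact: ccos|exact: csin].
have bt A' B' x : `|trigf A' B' (k%:~R : R) x| <= `|A'| + `|B'|.
  rewrite /trigf; apply: (le_trans (ler_normD _ _)); rewrite !normrM.
  by apply: lerD; rewrite ler_piMr.
have h := u_weak (torus_test_trigf A B k) s.
apply: is_derive_eq1 h _; rewrite derive1n3_trigf derive1_trigf.
have i1 := bounded_mul (iu s) (ct (- (k%:~R ^+ 3 * B)) (k%:~R ^+ 3 * A)) (bt _ _).
have i2 := bounded_mul (iu2 s) (ct (k%:~R * B) (- (k%:~R * A))) (bt _ _).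
rewrite -(II_Z 2^-1 i2) -II_D//; last exact: iD_Z.
by apply: II_ext => x _; rewrite mulrA.
Qed.

Let Re_iCM (r : R) z : complex.Re (iC * r%:C * z) = - r * complex.Im z.
Proof. by rewrite !cReM !cImM /=; ring. Qed.
Let Im_iCM (r : R) z : complex.Im (iC * r%:C * z) = r * complex.Re z.
Proof. by rewrite 2!cImM cReM /=; ring. Qed.

Lemma cder_coef n s : cder (a n) s (iC * n%:~R ^+ 3 * a n s - iC * n%:~R / 2 * q n s).
Proof.
have p0 := twopi_gt0 R.
have nE : ((- n)%:~R : R) = - n%:~R by rewrite mulrNz.
have i1 := bounded_mul (iu s) (@ccos (- n)%:~R) (bcos _).
have i2 := bounded_mul (iu s) (@csin (- n)%:~R) (bsin _).
have i3 := bounded_mul (iu2 s) (@ccos (- n)%:~R) (bcos _).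
have i4 := bounded_mul (iu2 s) (@csin (- n)%:~R) (bsin _).
have n3 : (n%:~R : R[i]) ^+ 3 = (n%:~R ^+ 3)%:C by rewrite -CR_int rmorphXn.
have n2' : iC * n%:~R / 2 = iC * (n%:~R / 2)%:C.
  by rewrite CRM CRV CR_int CR_nat mulrA.
rewrite n3 n2' qE.
split.
  have h := is_deriveZ (2 * pi)^-1 (weak_trig 1 0 (- n) s).
  rewrite (_ : (fun x => complex.Re (a n x)) =
    (2 * pi)^-1 *: (fun s => II (fun x => u s x * trigf 1 0 (- n)%:~R x))); last first.
    apply/funext => t; rewrite /a /uc Re_fc /GRing.scale /=; congr (_ * _).
    by apply: II_ext => x _; rewrite /trigf mul1r mul0r addr0.
  apply: is_derive_eq1 h _; rewrite cReD cReN !Re_iCM !Im_fc nE /GRing.scale [LHS]/=.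
  have -> : II (fun x => u s x * trigf (- ((- n%:~R) ^+ 3 * 0)) ((- n%:~R) ^+ 3 * 1) (- n%:~R) x) =
     (- n%:~R) ^+ 3 * II (fun x => u s x * sin (- n%:~R * x)).
    by rewrite -II_Z -?nE//; apply: II_ext => x _; rewrite /trigf nE; ring.
  have -> : II (fun x => u s x ^+ 2 * trigf (- n%:~R * 0) (- (- n%:~R * 1)) (- n%:~R) x) =
     n%:~R * II (fun x => u s x ^+ 2 * sin (- n%:~R * x)).
    by rewrite -II_Z -?nE//; apply: II_ext => x _; rewrite /trigf nE; ring.
  by ring.
have h := is_deriveZ (2 * pi)^-1 (weak_trig 0 1 (- n) s).
rewrite (_ : (fun x => complex.Im (a n x)) =
  (2 * pi)^-1 *: (fun s => II (fun x => u s x * trigf 0 1 (- n)%:~R x))); last first.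
  apply/funext => t; rewrite /a /uc Im_fc /GRing.scale /=; congr (_ * _).
  by apply: II_ext => x _; rewrite /trigf mul1r mul0r add0r.
apply: is_derive_eq1 h _; rewrite cImD cImN !Im_iCM !Re_fc nE /GRing.scale [LHS]/=.
have -> : II (fun x => u s x * trigf (- ((- n%:~R) ^+ 3 * 1)) ((- n%:~R) ^+ 3 * 0) (- n%:~R) x) =
   - (- n%:~R) ^+ 3 * II (fun x => u s x * cos (- n%:~R * x)).
  by rewrite -II_Z -?nE//; apply: II_ext => x _; rewrite /trigf nE; ring.
have -> : II (fun x => u s x ^+ 2 * trigf (- n%:~R * 1) (- (- n%:~R * 0)) (- n%:~R) x) =
   - n%:~R * II (fun x => u s x ^+ 2 * cos (- n%:~R * x)).
  by rewrite -II_Z -?nE//; apply: II_ext => x _; rewrite /trigf nE; ring.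
by ring.
Qed.

(** Compactness of [[- T, T]]: by monotonicity in [L], finitely many local thresholds may be
    replaced by the largest. *)
Lemma uniform_near (T : R) (P : nat -> R -> Prop) :
  (forall L L' (s : R), (L <= L')%N -> P L s -> P L' s) ->
  (forall s0 : R, exists L, \forall s \near s0, P L s) ->
  exists L0, forall L (s : R), (L0 <= L)%N -> `|s| <= T -> P L s.
Proof.
move=> mP hP; have cT : compact `[- T, T]%classic by exact: segment_compact.
have /compact_near_coveringP/(_ nat \oo P _)[] := cT.
  move=> s0 _; have [L hL] := hP s0.
  exists ((fun s => P L s), [set n | (L <= n)%N]); first by split => //; exists L.
  by move=> [s n] /= [h1 h2]; exact: mP h2 h1.
move=> L0 _ H; exists L0 => L s L0L sT; apply: H => //.
by rewrite /= in_itv /= -ler_norml.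
Qed.

Let n2_diff s t : n2 (fun x => uc s x - uc t x) = II (fun x => (u s x - u t x) ^+ 2).
Proof. by apply: II_ext => x _; rewrite /uc -CRB cabsR real_normK ?num_real. Qed.

Let near_diff s0 (e : R) : 0 < e -> \forall s \near s0, n2 (fun x => uc s x - uc s0 x) < e.
Proof.
move=> e0; have h := u_cont s0.
have : \forall s \near s0, ((\int[mu]_(x in D) ((u s x - u s0 x) ^+ 2)%:E)%E < e%:E)%E.
  have op : nbhs (0%E : \bar R) [set y | (y < e%:E)%E].
    by apply: open_nbhs_nbhs; split; [exact: open_ereal_lt_ereal|rewrite /= lte_fin].
  exact: h op.
apply: filterS => s; rewrite n2_diff -EFin_II ?lte_fin//.
have [_ hi] := l2_B (lu s) (lu s0).
by apply: iD_ext hi => x _; rewrite /uc -CRB cabsR real_normK ?num_real.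
Qed.

Let PL L s x := tp (zs L) (fun n => a n s) x.

Let tail_mono L L' s : (L <= L')%N ->
  n2 (fun x => uc s x - PL L' s x) <= n2 (fun x => uc s x - PL L s x).
Proof. by move=> LL; apply: best_approx. Qed.

(** Completeness gives a threshold for each time. For [s] near [s0] the partial sum of [u s0] is
    still a good competitor, and [best_approx] turns it into a bound on the tail of [u s]. *)
Lemma uniform_tail (T eta : R) : 0 < eta -> exists L0, forall L (s : R), (L0 <= L)%N -> `|s| <= T ->
  n2 (fun x => uc s x - PL L s x) <= eta.
Proof.
move=> e0; apply: uniform_near => [L L' s LL h|s0].
  exact: le_trans (tail_mono s LL) h.
have e4 : 0 < eta / 4 by rewrite divr_gt0.
have [L hL] := completeness (lu s0) e4.
exists L; apply: filterS (near_diff s0 e4) => s hs.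
apply: (le_trans (@best_approx R (uc s) L L (fun n => a n s0) (lu s) (leqnn L))).
have -> : n2 (fun x => uc s x - tp (zs L) (a^~ s0) x) =
    n2 (fun x => (uc s x - uc s0 x) + (uc s0 x - tp (zs L) (a^~ s0) x)).
  by apply: n2_ext => x _; ring.
apply: (le_trans (n2_D (l2_B (lu s) (lu s0)) (l2_B (lu s0) (l2_tp _ _)))).
have := hL L (leqnn L).
rewrite (_ : fourier_coef (fun x => u s0 x) = a^~ s0); last first.
  by apply/funext => n; rewrite fourier_coefE.
by rewrite -/(uc s0); move: hs => h1 h2; lra.
Qed.

Lemma uniform_mass (T : R) : exists2 U, 0 <= U & forall s, `|s| <= T -> n2 (uc s) <= U.
Proof.
have [||L0 H] := @uniform_near T (fun L s => n2 (uc s) <= L%:R).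
- by move=> L L' s LL h; apply: (le_trans h); rewrite ler_nat.
- move=> s0; have B0 : 0 <= 2 * n2 (uc s0) + 2 by rewrite addr_ge0// mulr_ge0// n2_ge0.
  exists (Num.bound (2 * n2 (uc s0) + 2)); apply: filterS (near_diff s0 ltr01) => s hs.
  apply: le_trans (ltW (archi_boundP B0)).
  have -> : n2 (uc s) = n2 (fun x => (uc s x - uc s0 x) + uc s0 x).
    by apply: n2_ext => x _; rewrite subrK.
  by apply: (le_trans (n2_D (l2_B (lu s) (lu s0)) (lu s0))); move: hs; lra.
by exists L0%:R => // s sT; exact: H.
Qed.

(** The difference of squares is [(u - P) * (u + P)]. Young's inequality with parameter [eta^-1]
    gives [eta^-1 * eta ^ 2] from the first factor and [eta * (4 * U)] from the second. *)
Lemma bilinear_close (s U eta : R) L n : 0 < eta -> n2 (uc s) <= U ->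
  n2 (fun x => uc s x - PL L s x) <= eta ^+ 2 ->
  cabs (q n s - fc (fun x => PL L s x * PL L s x) n) <= eta * (1 + 4 * U).
Proof.
move=> e0 HU Ht; have lP : l2 (PL L s) := l2_tp _ _.
have U0 : 0 <= U := le_trans (n2_ge0 _) HU.
have lD := l2_B (lu s) lP; have lS := l2_D (lu s) lP.
have ci1 : cI (fun x => uc s x * uc s x * te (- n) x).
  by apply: cI_ext (cI_M (lu s) (l2_Mc (lu s) (cC_te R (- n)))) => x _; rewrite mulrA.
have ci2 : cI (fun x => PL L s x * PL L s x * te (- n) x).
  by apply: cI_ext (cI_M lP (l2_Mc lP (cC_te R (- n)))) => x _; rewrite mulrA.
have -> : q n s - fc (fun x => PL L s x * PL L s x) n = (2 * pi)^-1%:C *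
    CI (fun x => uc s x * uc s x * te (- n) x - PL L s x * PL L s x * te (- n) x).
  by rewrite CI_B// mulrBr.
rewrite cabsM cabsR ger0_norm ?invr_ge0 ?twopi_ge0//.
have ci3 : cI (fun x => uc s x * uc s x * te (- n) x - PL L s x * PL L s x * te (- n) x).
  by apply: cI_ext (cI_D ci1 (cI_N ci2)).
have HP : n2 (PL L s) <= U.
  by rewrite n2_tp ?uniq_zs//; apply: le_trans HU; exact: bessel_le.
have H : II (fun x => cabs (uc s x * uc s x * te (- n) x - PL L s x * PL L s x * te (- n) x))
    <= eta * (1 + 4 * U).
  have -> : II (fun x => cabs (uc s x * uc s x * te (- n) x - PL L s x * PL L s x * te (- n) x)) =
     II (fun x => cabs (uc s x - PL L s x) * cabs (uc s x + PL L s x)).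
    apply: II_ext => x _; rewrite -mulrBl cabsM cabs_te mulr1 -cabsM; congr cabs; ring.
  apply: (le_trans (@II_cabsM R _ _ eta^-1 _ lD lS)); first by rewrite invr_gt0.
  rewrite invrK mulrDr mulr1; apply: lerD.
    rewrite -(ler_pM2l e0) mulrA divff ?mul1r ?gt_eqF// -expr2//.
  rewrite ler_wpM2l ?(ltW e0)//; apply: (le_trans (n2_D (lu s) lP)); lra.
have CIb := le_trans (cabs_CI ci3) H.
apply: (@le_trans _ _ (1 * (eta * (1 + 4 * U)))); last by rewrite mul1r.
apply: ler_pM CIb; rewrite ?invr_ge0 ?twopi_ge0 ?cabs_ge0//.
by rewrite invf_le1 ?twopi_gt0//; have := pi_ge2 R; lra.
Qed.

Let sum_zs_Zs (V : nmodType) L (F : int -> V) :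
  \sum_(n <- zs L) F n = F 0 + \sum_(n <- Zs L) F n.
Proof.
rewrite (bigID (fun n => n == 0)) /= sum_eq1 ?uniq_zs// mem_zs /=.
by rewrite /Zs big_filter.
Qed.

(** The products with the zero frequency are set apart: they are linear in [a n] and amount to the
    drift by the mean. *)
Lemma fc_PL2 L n s : n \in Zs L -> fc (fun x => PL L s x * PL L s x) n =
  S2 L n (fun p q => a p s * a q s) + 2 * (a 0 s * a n s).
Proof.
move=> nZ; have nz : n \in zs L by move: nZ; rewrite mem_filter => /andP[].
have -> : fc (fun x => PL L s x * PL L s x) n =
    \sum_(u <- prs (zs L) | u.1 + u.2 - n == 0) a u.1 s * a u.2 s.
  rewrite /fc (@CI_ext _ _ (fun x => \sum_(u <- prs (zs L)) a u.1 s * a u.2 s * te (u.1 + u.2 - n) x)).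
    by rewrite CI_trig mulrA -CRM mulVf ?mul1r// gt_eqF ?twopi_gt0.
  by move=> x _; rewrite tp_sqr mulr_suml; apply: eq_bigr => w _; rewrite [te (_ - n) x]teD mulrA.
rewrite big_mkcond big_allpairs /= sum_zs_Zs sum_zs_Zs.
rewrite addr0 sub0r oppr_eq0 (negbTE (Zs_neq0 nZ)) add0r.
have -> : \sum_(j <- Zs L) (if 0 + j - n == 0 then a 0 s * a j s else 0) = a 0 s * a n s.
  under eq_bigr do rewrite add0r subr_eq0.
  by rewrite -big_mkcond sum_eq1 ?uniq_Zs// nZ.
under eq_bigr do rewrite sum_zs_Zs.
rewrite big_split /=.
have -> : \sum_(i <- Zs L) (if i + 0 - n == 0 then a i s * a 0 s else 0) = a n s * a 0 s.
  under eq_bigr do rewrite addr0 subr_eq0.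
  by rewrite -big_mkcond sum_eq1 ?uniq_Zs// nZ.
have -> : \sum_(i <- Zs L) \sum_(j <- Zs L) (if i + j - n == 0 then a i s * a j s else 0) =
    S2 L n (fun p q => a p s * a q s).
  by apply: eq_bigr => i _; apply: eq_bigr => j _; rewrite subr_eq0.
ring.
Qed.

Let m : R := complex.Re (a 0 0).

Lemma mean_conserved s : a 0 s = m%:C.
Proof.
have h : a 0 s = a 0 0.
  apply/eqP; rewrite -subr_eq0; apply/eqP; apply: cabs_eq0; apply/eqP.
  rewrite eq_le cabs_ge0 andbT.
  have := @cder_bound R (a 0) (fun=> 0) `|s| 0 s; rewrite mulr0 mul0r; apply => //.
  - by move=> t _; apply: cder_eq (cder_coef 0 t) _; rewrite mulr0z; ring.
  - by move=> t _; rewrite cabs0.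
rewrite h; apply: ReImP; rewrite ?[RHS]/=; first by [].
have := fc_cj 0 (lu 0); rewrite oppr0 => /(congr1 (@complex.Im R)); rewrite Im_cj -/(a 0 0).
by move: (complex.Im _) => y; lra.
Qed.

(* Frame in which both the Airy flow and the drift caused by the mean are removed. *)
Let lam n : R := n%:~R * m - n%:~R ^+ 3.
Let v n s : R[i] := expi (lam n * s) * a n s.
Let dv n s : R[i] := - (iC * n%:~R / 2) * (expi (lam n * s) * (q n s - 2 * (m%:C * a n s))).

Let cabs_v n s : cabs (v n s) = cabs (a n s).
Proof. by rewrite cabsM cabs_expi mul1r. Qed.

Let cder_v n s : cder (v n) s (dv n s).
Proof.
apply: cder_eq (cder_M (cder_expi (lam n) s) (cder_coef n s)) _.
have -> : (lam n)%:C = n%:~R * m%:C - n%:~R ^+ 3.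
  by rewrite /lam CRB CRM CR_int -[in RHS]CR_int rmorphXn /= CR_int.
by rewrite /dv; field.
Qed.

Let vJ n s : v (- n) s = cj (v n s).
Proof.
rewrite /v cjM -expiN -[cj (a n s)](fc_cj n (lu s)); congr (_ * _); congr expi.
by rewrite /lam mulrNz; ring.
Qed.

Let Zs_mass L s U : n2 (uc s) <= U -> \sum_(k <- Zs L) cabs (v k s) ^+ 2 <= U.
Proof.
move=> HU; have := bessel_le L (lu s); rewrite sum_zs_Zs => h.
under eq_bigr do rewrite cabs_v.
have p1 : 1 <= 2 * pi :> R by have := pi_ge2 R; lra.
have S0 : 0 <= \sum_(k <- Zs L) cabs (a k s) ^+ 2 by apply: sumr_ge0 => k _; exact: sqr_ge0.
have A0 : 0 <= cabs (fc (uc s) 0) ^+ 2 by exact: sqr_ge0.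
apply: le_trans HU; apply: le_trans h.
apply: (@le_trans _ _ (1 * (cabs (fc (uc s) 0) ^+ 2 + \sum_(k <- Zs L) cabs (a k s) ^+ 2))).
  by rewrite mul1r lerDr.
by rewrite ler_wpM2r// addr_ge0.
Qed.

(** [rh] is, up to a factor of modulus 1/2, the coefficient of the square of [u] minus the square of
    its partial sum. In this frame [lam k - lam p - lam r = - 3 * k * p * r] for [p + r = k], the
    phase of [quad]; the drift by the mean cancels because it is linear in the frequency. *)
Lemma truncated_system (T eta : R) : 0 < eta -> exists L0, forall L, (L0 <= L)%N ->
  exists rh : int -> R -> R[i], forall k s, k \in Zs L -> `|s| <= T -> cabs (rh k s) <= eta /\
    dv k s = - (iC * k%:~R / 2) * quad L (fun j => v j s) s k + k%:~R * rh k s.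
Proof.
move=> e0; have [U U0 HU] := uniform_mass T.
have U1 : 0 < 1 + 4 * U by rewrite ltr_pwDl// mulr_ge0.
pose de := eta / (1 + 4 * U); have de0 : 0 < de by rewrite divr_gt0.
have [L0 HL] := uniform_tail T (exprn_gt0 2 de0).
exists L0 => L LL; exists (fun k s => - (iC / 2) * (expi (lam k * s) *
   (q k s - fc (fun x => PL L s x * PL L s x) k))) => k s kZ sT; split.
  rewrite cabsM cabsN cabsM cabs_iC mul1r cabsV cabs_nat cabsM cabs_expi mul1r.
  have h := bilinear_close k de0 (HU s sT) (HL L s LL sT).
  have -> : eta = de * (1 + 4 * U) by rewrite /de divfK// gt_eqF.
  apply: le_trans h; rewrite ler_piMl ?cabs_ge0//; lra.
have -> : quad L (fun j => v j s) s k = expi (lam k * s) * S2 L k (fun p q => a p s * a q s).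
  rewrite /quad -S2_Z; apply: S2_ext => p r pZ rZ E.
  have -> : expi (lam k * s) = te (- (3 * k * p * r)) s * expi (lam p * s) * expi (lam r * s).
    rewrite /te -!expiD; congr expi; rewrite /lam -E !(intrD, intrM, mulrNz); ring.
  by rewrite /v; ring.
by rewrite fc_PL2// mean_conserved /dv; field.
Qed.

Hypothesis gBV : BV_torus g.
Hypothesis u_init : {ae mu, forall x : R, u 0 x = g x}.

Let a_init n : a n 0 = fourier_coef g n.
Proof.
rewrite fourier_coefE /a /fc; congr (_ * _).
have mD0 := @measurable_torus_dom R.
have mg : mD g := BV_mD gBV.
have E (f h : R -> R) : mD f -> mD h -> (forall x, u 0 x = g x -> f x = h x) -> II f = II h.
  move=> mf mh fh; rewrite /II /Rintegral; congr fine; apply: ae_eq_integral => //.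
  - exact/measurable_EFinP.
  - exact/measurable_EFinP.
  - by apply: (ae_mono _ u_init) => x ux _; rewrite (fh x ux).
have mt := cC_mC (cC_te R (- n)).
have [m1 m2] := mC_M (mC_R (mu_s 0)) mt.
have [m3 m4] := mC_M (mC_R mg) mt.
apply: ReImP; rewrite ?Re_CI ?Im_CI; apply: E => // x; by rewrite /uc => ->.
Qed.

Lemma smoothing (T : R) : exists2 C, 0 <= C & forall n t, n != 0 -> `|t| <= T ->
  cabs (v n t - v n 0) <= C / (`|n%:~R| * wt R n).
Proof.
have [U U0 HU] := uniform_mass T.
have [C1 C10 H1] : exists2 C, 0 <= C & forall n t, n != 0 -> `|t| <= T ->
    cabs (v n t - v n 0) <= C / (`|n%:~R| * 1).
  apply: (@normal_form R (fun=> 1) U T v dv) => //.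
  - by move=> j k _ _; rewrite mulr1 mulr1; lra.
  - move=> L s sT; under eq_bigr do rewrite mul1r.
    exact: Zs_mass (HU s sT).
  - exact: truncated_system.
have [C2 C20 H2] := BV_fourier_coef gBV.
have Hv n s : n != 0 -> `|s| <= T -> cabs (v n s) <= (C1 + C2) / `|n%:~R|.
  move=> n0 sT; rewrite -(subrK (v n 0) (v n s)); apply: (le_trans (cabsD _ _)).
  rewrite mulrDl; apply: lerD; first by have := H1 n s n0 sT; rewrite mulr1.
  by rewrite cabs_v a_init; exact: H2.
(* The decay [1 / |n|] from the first pass, together with that of the BV data, makes the mass with
   weight [wt] finite: [|n| ^ (1/2) / n ^ 2] is summable. *)
apply: (@normal_form R (wt R) (2 * (C1 + C2) ^+ 2
    + 5 * (C1 + C2) ^+ 2 * ((1 - (2 `^ 4^-1)^-1 ^+ 2) ^+ 2)^-1) T v dv).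
- apply: addr_ge0; first by rewrite mulr_ge0 ?sqr_ge0.
  by rewrite mulr_ge0 ?invr_ge0 ?sqr_ge0// mulr_ge0 ?sqr_ge0.
- by move=> k; exact: wt_ge1.
- exact: wt_ge0.
- exact: wt_add.
- by move=> k s _; exact: cder_v.
- exact: vJ.
- move=> L s sT.
  apply: (@weighted_mass R (fun k => cabs (v k s)) (C1 + C2)) => //; first by rewrite addr_ge0.
    by move=> k; exact: cabs_ge0.
  by move=> k k0; exact: Hv.
- exact: truncated_system.
Qed.

Lemma kdv_near_airy t : exists (be C : R), 0 <= C /\ forall n, n != 0 ->
  cabs (fourier_coef (u t) n - te n be * airy_coef (fourier_coef g) t n) <= C / (`|n%:~R| * wt R n).
Proof.
have [C C0 H] := smoothing `|t|.
(* Leaving the frame multiplies by the phase [- lam n * t = n ^ 3 * t - n * (m * t)]: the Airy phase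
   and a translation by [- (m * t)]. *)
exists (- (m * t)), C; split => // n n0; have := H n t n0 (lexx _).
have -> : fourier_coef (u t) n - te n (- (m * t)) * airy_coef (fourier_coef g) t n =
   expi (- (lam n * t)) * (v n t - v n 0).
  rewrite fourier_coefE -/(uc t) -/(a n t) /v mulr0 expi0 mul1r a_init mulrBr.
  have e1 : expi (- (lam n * t)) * expi (lam n * t) = 1 by rewrite -expiD addNr expi0.
  rewrite [expi (- (lam n * t)) * (_ * _)]mulrA e1 mul1r; congr (_ - _).
  rewrite /airy_coef mulrA; congr (_ * _); rewrite /te -expiD; congr expi.
  by rewrite /lam rmorphXn /=; ring.
by rewrite cabsM cabs_expi mul1r.
Qed.

End KdV.

Theorem theorem1p4 (R : realType) (g : R -> R) (u : R -> R -> R)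
    (g_BV : BV_torus g) (g_rough : ~ in_sobolev_half_plus g)
    (u_kdv : kdv_solution g u) :
  {ae @lebesgue_measure R, forall t : R,
    (exists v : R -> R,
       [/\ continuous_torus v, is_airy g t v
         & ((3 / 2 : R)%:E <= upper_box_dim (graph_torus v))%E]) /\
    (exists w : R -> R,
       [/\ continuous_torus w,
           {ae @lebesgue_measure R, forall x : R, w x = u t x}
         & ((3 / 2 : R)%:E <= upper_box_dim (graph_torus w))%E])}.
Proof.
have [u_L2 u_cont u_init u_weak _] := u_kdv.
have [C0 C00 HC0] := BV_fourier_coef g_BV.
have fcJ (f : R -> R) n : L2_torus f -> fourier_coef f (- n) = cj (fourier_coef f n).
  by move=> Lf; rewrite !fourier_coefE fc_cj//; exact: L2_torus_l2.
have Lg := BV_L2_torus g_BV.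
(* The only null set removed is that of the Airy flow of [g]; both conclusions hold at every other
   time. *)
apply: (ae_mono _ (strichartz_ae C00 HC0)) => t HQ; split.
  have [|||v [ctv fv dv]] := @rough_graph R g t 0 0 (airy_coef (fourier_coef g) t) g_BV g_rough HQ.
  - by move=> n; rewrite /airy_coef fcJ// cjM -teN; congr (te _ _ * _); ring.
  - by [].
  - by move=> n _; rewrite /te mulr0 expi0 mul1r subrr cabs0 mul0r.
  - by exists v; split => //; apply: airy_of_coefs.
have [be [C [C1 H]]] := kdv_near_airy u_L2 u_cont u_weak g_BV u_init t.
have [|||w [ctw fw dw]] := @rough_graph R g t be C (fourier_coef (u t)) g_BV g_rough HQ.
- by move=> n; exact: fcJ.
- by [].
- exact: H.
- by exists w; split => //; apply: ae_eq_of_coefs => //; exact: continuous_L2_torus.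
Qed.
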